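(* Let $M$ be a simple $\mathfrak{sl}(\infty)$-module which is determined up to isomorphism by its annihilator $I=\operatorname{Ann}_{\operatorname{U}(\mathfrak{sl}(\infty))}M$, i.e. every simple $\mathfrak{sl}(\infty)$-module $M'$ with $\operatorname{Ann}_{\operatorname{U}(\mathfrak{sl}(\infty))}M'=I$ is isomorphic to $M$. If $I$ is integrable, then $M$ is isomorphic to a simple tensor module.
   Context: $\mathbb F$ is an algebraically closed field of characteristic $0$. $\mathfrak{sl}(\infty)=\bigcup_n\mathfrak{sl}(n)$ under the standard (upper left corner) inclusions. $V(\infty)=\varinjlim V(n)$ and $V(\infty)_*=\varinjlim V(n)^*$ are the two natural modules, where $V(n)$ is the natural $\mathfrak{sl}(n)$-module. A simple tensor module is a module isomorphic to a simple $\mathfrak{sl}(\infty)$-submodule of the tensor algebra $T^\cdot(V(\infty)\oplus V(\infty)_* )$. An $\mathfrak{sl}(\infty)$-module $N$ is integrable if $\dim(U'\cdot m)<\infty$ for every $m\in N$ and every finitely generated subalgebra $U'\subset\operatorname{U}(\mathfrak{sl}(\infty))$; a two-sided ideal of $\operatorname{U}(\mathfrak{sl}(\infty))$ is integrable if it is the annihilator of an integrable module. *)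

(* Defs.v *)
From HB Require Import structures.
From mathcomp Require Import all_boot all_algebra.
From mathcomp Require Import all_classical.
From mathcomp Require Import ring.

Set Implicit Arguments.
Unset Strict Implicit.
Unset Printing Implicit Defensive.

Import GRing.Theory.
Local Open Scope ring_scope.
Local Open Scope classical_set_scope.

Section Terms.
Variables (F : fieldType) (X : Type).

Inductive term : Type :=
| Gen of X
| Cst of F
| Add of term & term
| Mul of term & term.

HB.instance Definition _ := gen_eqMixin term.
HB.instance Definition _ := gen_choiceMixin term.

Definition Opp (t : term) : term := Mul (Cst (-1)) t.

(* The least congruence containing [rel] and the axioms of associative unital
   F-algebras, F being mapped to the centre by [Cst]; 0 and 1 are [Cst 0] and
   [Cst 1]. *)
Inductive cong (rel : term -> term -> Prop) : term -> term -> Prop :=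
| cong_rel s t of rel s t : cong rel s t
| cong_refl t : cong rel t t
| cong_sym s t of cong rel s t : cong rel t s
| cong_trans s t u of cong rel s t & cong rel t u : cong rel s u
| cong_Add s s' t t' of cong rel s s' & cong rel t t' :
    cong rel (Add s t) (Add s' t')
| cong_Mul s s' t t' of cong rel s s' & cong rel t t' :
    cong rel (Mul s t) (Mul s' t')
| cong_AddA s t u : cong rel (Add s (Add t u)) (Add (Add s t) u)
| cong_AddC s t : cong rel (Add s t) (Add t s)
| cong_Add0 t : cong rel (Add (Cst 0) t) t
| cong_MulA s t u : cong rel (Mul s (Mul t u)) (Mul (Mul s t) u)
| cong_Mul1 t : cong rel (Mul (Cst 1) t) t
| cong_Mul0 t : cong rel (Mul (Cst 0) t) (Cst 0)
| cong_MulDl s t u : cong rel (Mul (Add s t) u) (Add (Mul s u) (Mul t u))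
| cong_MulDr s t u : cong rel (Mul s (Add t u)) (Add (Mul s t) (Mul s u))
| cong_CstC c t : cong rel (Mul (Cst c) t) (Mul t (Cst c))
| cong_CstD c d : cong rel (Cst (c + d)) (Add (Cst c) (Cst d))
| cong_CstM c d : cong rel (Cst (c * d)) (Mul (Cst c) (Cst d)).

(* The value of a term when all generators are sent to 0. *)
Fixpoint augment (t : term) : F :=
  match t with
  | Gen _ => 0
  | Cst c => c
  | Add s t => augment s + augment t
  | Mul s t => augment s * augment t
  end.

(* [pres_augment] makes the presented algebra nontrivial, as the algebraic
   structures of the library require. *)
Record presentation := Presentation {
  pres_rel : term -> term -> Prop;
  pres_augment : forall s t, pres_rel s t -> augment s = augment t
}.

Lemma cong_augment (P : presentation) s t :
  cong (pres_rel P) s t -> augment s = augment t.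
Proof.
elim=> //=.
- by move=> ? ? /pres_augment.
- by move=> ? ? ? _ -> _ ->.
- by move=> ? ? ? ? _ -> _ ->.
- by move=> ? ? ? ? _ -> _ ->.
- by move=> *; rewrite addrA.
- by move=> *; rewrite addrC.
- by move=> *; rewrite add0r.
- by move=> *; rewrite mulrA.
- by move=> *; rewrite mul1r.
- by move=> *; rewrite mul0r.
- by move=> *; rewrite mulrDl.
- by move=> *; rewrite mulrDr.
- by move=> *; rewrite mulrC.
Qed.

End Terms.

Arguments Gen F {X} x.
Arguments Cst {F} X c.

Section PresentedAlgebra.
Variables (F : fieldType) (X : Type) (P : presentation F X).

Definition congb (s t : term F X) : bool := `[< cong (pres_rel P) s t >].

Lemma congb_refl : reflexive congb.
Proof. by move=> t; apply/asboolP; exact: cong_refl. Qed.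

Lemma congb_sym : symmetric congb.
Proof. by move=> s t; apply/asboolP/asboolP; exact: cong_sym. Qed.

Lemma congb_trans : transitive congb.
Proof.
by move=> t s u /asboolP st /asboolP tu; apply/asboolP; exact: cong_trans tu.
Qed.

Canonical congb_equiv := EquivRel congb congb_refl congb_sym congb_trans.

Definition presAlg := {eq_quot congb_equiv}%qT.
HB.instance Definition _ := Choice.on presAlg.

Definition cls (t : term F X) : presAlg := (\pi_presAlg t)%qT.

Lemma cls_eqP s t : cls s = cls t <-> cong (pres_rel P) s t.
Proof.
split=> [/eqmodP/asboolP//|st]; by apply/eqmodP/asboolP.
Qed.

Lemma reprP (a : presAlg) : cls (repr a) = a.
Proof. exact: reprK. Qed.

Lemma repr_cls t : cong (pres_rel P) (repr (cls t)) t.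
Proof. by apply/cls_eqP; rewrite reprP. Qed.

Lemma cls_ind (Q : presAlg -> Prop) : (forall t, Q (cls t)) -> forall a, Q a.
Proof. by move=> Qt a; rewrite -[a]reprP. Qed.

Definition padd (a b : presAlg) := cls (Add (repr a) (repr b)).
Definition pmul (a b : presAlg) := cls (Mul (repr a) (repr b)).
Definition popp (a : presAlg) := cls (Opp (repr a)).
Definition pscale (c : F) (a : presAlg) := cls (Mul (Cst X c) (repr a)).

Let paddE s t : padd (cls s) (cls t) = cls (Add s t).
Proof. by apply/cls_eqP/cong_Add; exact: repr_cls. Qed.

Let pmulE s t : pmul (cls s) (cls t) = cls (Mul s t).
Proof. by apply/cls_eqP/cong_Mul; exact: repr_cls. Qed.

Let poppE t : popp (cls t) = cls (Opp t).
Proof. by apply/cls_eqP/cong_Mul; [exact: cong_refl|exact: repr_cls]. Qed.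

Let pscaleE c t : pscale c (cls t) = cls (Mul (Cst X c) t).
Proof. by apply/cls_eqP/cong_Mul; [exact: cong_refl|exact: repr_cls]. Qed.

Let paddA : associative padd.
Proof.
elim/cls_ind=> s; elim/cls_ind=> t; elim/cls_ind=> u.
by rewrite !paddE; apply/cls_eqP/cong_AddA.
Qed.

Let paddC : commutative padd.
Proof.
elim/cls_ind=> s; elim/cls_ind=> t.
by rewrite !paddE; apply/cls_eqP/cong_AddC.
Qed.

Let padd0 : left_id (cls (Cst X 0)) padd.
Proof. by elim/cls_ind=> s; rewrite !paddE; apply/cls_eqP/cong_Add0. Qed.

Let paddN : left_inverse (cls (Cst X 0)) popp padd.
Proof.
elim/cls_ind=> s; rewrite poppE paddE; apply/cls_eqP.
apply: cong_trans (cong_Add (cong_refl _ _) (cong_sym (cong_Mul1 _ s))) _.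
apply: cong_trans (cong_sym (cong_MulDl _ _ _ _)) _.
apply: cong_trans (cong_Mul (cong_sym (cong_CstD _ _ _)) (cong_refl _ _)) _.
by rewrite addNr; exact: cong_Mul0.
Qed.

HB.instance Definition _ :=
  GRing.isZmodule.Build presAlg paddA paddC padd0 paddN.

Let pmulA : associative pmul.
Proof.
elim/cls_ind=> s; elim/cls_ind=> t; elim/cls_ind=> u.
by rewrite !pmulE; apply/cls_eqP/cong_MulA.
Qed.

Let pmul1l : left_id (cls (Cst X 1)) pmul.
Proof. by elim/cls_ind=> s; rewrite !pmulE; apply/cls_eqP/cong_Mul1. Qed.

Let pmul1r : right_id (cls (Cst X 1)) pmul.
Proof.
elim/cls_ind=> s; rewrite !pmulE; apply/cls_eqP.
exact: cong_trans (cong_sym (cong_CstC _ _ _)) (cong_Mul1 _ _).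
Qed.

Let pmulDl : left_distributive pmul padd.
Proof.
elim/cls_ind=> s; elim/cls_ind=> t; elim/cls_ind=> u.
by rewrite !(pmulE, paddE); apply/cls_eqP/cong_MulDl.
Qed.

Let pmulDr : right_distributive pmul padd.
Proof.
elim/cls_ind=> s; elim/cls_ind=> t; elim/cls_ind=> u.
by rewrite !(pmulE, paddE); apply/cls_eqP/cong_MulDr.
Qed.

Let pone_neq0 : cls (Cst X 1) != cls (Cst X 0).
Proof. by apply/eqP=> /cls_eqP/cong_augment/eqP; rewrite oner_eq0. Qed.

HB.instance Definition _ := GRing.Zmodule_isNzRing.Build presAlg
  pmulA pmul1l pmul1r pmulDl pmulDr pone_neq0.

Let pscaleA a b v : pscale a (pscale b v) = pscale (a * b) v.
Proof.
elim/cls_ind: v => t; rewrite !pscaleE; apply/cls_eqP.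
apply: cong_trans (cong_MulA _ _ _ _) _.
by apply: cong_Mul; [exact/cong_sym/cong_CstM|exact: cong_refl].
Qed.

Let pscale1 : left_id 1 pscale.
Proof. by elim/cls_ind=> t; rewrite !pscaleE; apply/cls_eqP/cong_Mul1. Qed.

Let pscaleDr : right_distributive pscale +%R.
Proof.
move=> c; elim/cls_ind=> s; elim/cls_ind=> t.
by rewrite /+%R /= paddE !pscaleE paddE; apply/cls_eqP/cong_MulDr.
Qed.

Let pscaleDl v : {morph pscale^~ v : a b / a + b}.
Proof.
elim/cls_ind: v => t a b; rewrite !pscaleE /+%R/= paddE; apply/cls_eqP.
apply: cong_trans (cong_MulDl _ _ _ _).
by apply: cong_Mul; [exact: cong_CstD|exact: cong_refl].
Qed.

HB.instance Definition _ := GRing.Zmodule_isLmodule.Build F presAlg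
  pscaleA pscale1 pscaleDr pscaleDl.

Let pscaleAl (c : F) (u v : presAlg) : c *: (u * v) = (c *: u) * v.
Proof.
elim/cls_ind: u => s; elim/cls_ind: v => t.
rewrite /GRing.scale /*%R /= pmulE !pscaleE pmulE.
exact/cls_eqP/cong_MulA.
Qed.

HB.instance Definition _ := GRing.Lmodule_isLalgebra.Build F presAlg pscaleAl.

Let pscaleAr (c : F) (u v : presAlg) : c *: (u * v) = u * (c *: v).
Proof.
elim/cls_ind: u => s; elim/cls_ind: v => t.
rewrite /GRing.scale /*%R /= pmulE !pscaleE pmulE; apply/cls_eqP.
apply: cong_trans (cong_MulA _ _ _ _) _.
apply: cong_trans (cong_sym (cong_MulA _ _ _ _)).
by apply: cong_Mul; [exact: cong_CstC|exact: cong_refl].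
Qed.

HB.instance Definition _ := GRing.Lalgebra_isAlgebra.Build F presAlg pscaleAr.

Lemma clsD s t : cls (Add s t) = cls s + cls t.
Proof. by rewrite /+%R /= paddE. Qed.

Lemma clsM s t : cls (Mul s t) = cls s * cls t.
Proof. by rewrite /*%R /= pmulE. Qed.

Lemma clsZ c t : cls (Mul (Cst X c) t) = c *: cls t.
Proof. by rewrite /GRing.scale /= pscaleE. Qed.

Lemma clsC c : cls (Cst X c) = c%:A.
Proof.
rewrite -(clsZ c (Cst X 1)); apply/cls_eqP.
by rewrite -{1}[c]mulr1; exact: cong_CstM.
Qed.

End PresentedAlgebra.

Record lieAlgebra (F : fieldType) := LieAlgebra {
  lie_sort :> lmodType F;
  bracket : lie_sort -> lie_sort -> lie_sort;
  bracketDl : forall c x y z,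
    bracket (c *: x + y) z = c *: bracket x z + bracket y z;
  bracketxx : forall x, bracket x x = 0;
  bracket_jacobi : forall x y z, bracket x (bracket y z) +
    bracket y (bracket z x) + bracket z (bracket x y) = 0
}.

Record lieModule (F : fieldType) (g : lieAlgebra F) := LieModule {
  mod_sort :> lmodType F;
  act : g -> mod_sort -> mod_sort;
  actDl : forall c x y v, act (c *: x + y) v = c *: act x v + act y v;
  actDr : forall c x v w, act x (c *: v + w) = c *: act x v + act x w;
  act_bracket : forall x y v,
    act (bracket x y) v = act x (act y v) - act y (act x v)
}.

Section LieModules.
Variables (F : fieldType) (g : lieAlgebra F).
Implicit Types M N : lieModule g.

Definition mod_iso M N : Prop := exists f : {linear M -> N},
  bijective f /\ forall x v, f (act x v) = act x (f v).

(* By classical logic the boolean predicates are all the subsets. *)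
Record submodule M := Submodule {
  submod_pred : {pred M};
  submod_closedP : submod_closed submod_pred;
  submod_act : forall x v, v \in submod_pred -> act x v \in submod_pred
}.

HB.instance Definition _ M (S : submodule M) :=
  GRing.isSubmodClosed.Build F M (submod_pred S) (submod_closedP S).

Definition submod_sort M (S : submodule M) : Type :=
  {v : M | v \in submod_pred S}.
HB.instance Definition _ M (S : submodule M) :=
  SubChoice.on (submod_sort S).
HB.instance Definition _ M (S : submodule M) :=
  [SubChoice_isSubLmodule of submod_sort S by <:].

Section SubModule.
Variables (M : lieModule g) (S : submodule M).

Definition sub_act (x : g) (v : submod_sort S) : submod_sort S :=
  exist _ (act x (val v)) (submod_act x (valP v)).

Let sub_actDl c x y v :
  sub_act (c *: x + y) v = c *: sub_act x v + sub_act y v.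
Proof. by apply: val_inj; rewrite [RHS](linearP (val : submod_sort S -> M)) /= actDl. Qed.

Let sub_actDr c x v w : sub_act x (c *: v + w) = c *: sub_act x v + sub_act x w.
Proof. by apply: val_inj; rewrite [RHS](linearP (val : submod_sort S -> M)) /= actDr. Qed.

Let sub_act_bracket x y v :
  sub_act (bracket x y) v = sub_act x (sub_act y v) - sub_act y (sub_act x v).
Proof. by apply: val_inj; rewrite [RHS](raddfB (val : submod_sort S -> M)) /= act_bracket. Qed.

Definition subMod : lieModule g :=
  @LieModule F g (submod_sort S) sub_act sub_actDl sub_actDr sub_act_bracket.

End SubModule.

Definition mod_simple M : Prop :=
  (exists v : M, v != 0) /\
  forall S : submodule M,
    (forall v, v \in submod_pred S -> v = 0) \/
    (forall v, v \in submod_pred S).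

Section DirectSum.
Variables M N : lieModule g.

Definition sum_act (x : g) (u : M * N) : M * N := (act x u.1, act x u.2).

Let sum_actDl c x y u : sum_act (c *: x + y) u = c *: sum_act x u + sum_act y u.
Proof. by rewrite /sum_act !actDl. Qed.

Let sum_actDr c x u v : sum_act x (c *: u + v) = c *: sum_act x u + sum_act x v.
Proof. by rewrite /sum_act /= !actDr. Qed.

Let sum_act_bracket x y u :
  sum_act (bracket x y) u = sum_act x (sum_act y u) - sum_act y (sum_act x u).
Proof. by rewrite /sum_act !act_bracket. Qed.

Definition sumMod : lieModule g :=
  @LieModule F g (M * N)%type sum_act sum_actDl sum_actDr sum_act_bracket.

End DirectSum.

End LieModules.

Section EnvelopingAlgebra.
Variables (F : fieldType) (g : lieAlgebra F).

Inductive env_rel : term F g -> term F g -> Prop :=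
| env_lin c x y :
    env_rel (Gen F (c *: x + y)) (Add (Mul (Cst g c) (Gen F x)) (Gen F y))
| env_bracket x y :
    env_rel (Gen F (bracket x y))
      (Add (Mul (Gen F x) (Gen F y)) (Opp (Mul (Gen F y) (Gen F x)))).

Lemma env_augment s t : env_rel s t -> augment s = augment t.
Proof. by case=> *; rewrite /= !mulr0 addr0. Qed.

Definition envAlg : algType F := presAlg (Presentation env_augment).

Section Action.
Variable M : lieModule g.

Fixpoint term_act (t : term F g) (v : M) : M :=
  match t with
  | Gen x => act x v
  | Cst c => c *: v
  | Add s t => term_act s v + term_act t v
  | Mul s t => term_act s (term_act t v)
  end.

Definition env_act (u : envAlg) (v : M) : M := term_act (repr u) v.

Lemma term_act_linear t c v w :
  term_act t (c *: v + w) = c *: term_act t v + term_act t w.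
Proof.
elim: t v w => [x|d|s IHs t IHt|s IHs t IHt] v w /=.
- exact: actDr.
- by rewrite scalerDr !scalerA mulrC.
- by rewrite IHs IHt scalerDr addrACA.
- by rewrite IHt IHs.
Qed.

Lemma term_act_cong s t :
  cong env_rel s t -> forall v, term_act s v = term_act t v.
Proof.
have Z r c v : term_act r (c *: v) = c *: term_act r v.
  have r0 : term_act r 0 = 0.
    by have := term_act_linear r (-1) 0 0; rewrite !scaleN1r oppr0 addr0 addNr.
  by have := term_act_linear r c v 0; rewrite r0 !addr0.
have D r v w : term_act r (v + w) = term_act r v + term_act r w.
  by have := term_act_linear r 1 v w; rewrite !scale1r.
elim=> //=.
- move=> {}s {}t [c x y|x y] v /=; first exact: actDl.
  by rewrite act_bracket scaleN1r.
- by move=> ? ? ? _ IH1 _ IH2 v; rewrite IH1.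
- by move=> ? ? ? ? _ IH1 _ IH2 v; rewrite IH1 IH2.
- by move=> ? ? ? ? _ IH1 _ IH2 v; rewrite IH1 IH2.
- by move=> *; rewrite addrA.
- by move=> *; rewrite addrC.
- by move=> *; rewrite scale0r add0r.
- by move=> *; rewrite scale1r.
- by move=> *; rewrite !scale0r.
- by move=> *; rewrite scalerDl.
- by move=> *; rewrite scalerA.
Qed.

Lemma env_act_cls t v : env_act (cls _ t) v = term_act t v.
Proof. exact: (term_act_cong (repr_cls (Presentation env_augment) t)). Qed.

End Action.

Definition ann (M : lieModule g) : set envAlg :=
  [set u | forall v : M, env_act u v = 0].

(* [subalg_closed] includes membership of 1. Allowing subalgebras without unit
   in [integrable] would not change it: adjoining 1 adds at most one dimension
   to the orbit of a vector. *)
Definition gen_subalg (us : seq envAlg) : set envAlg :=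
  [set u | forall S : {pred envAlg},
     subalg_closed S -> {subset us <= S} -> u \in S].

Definition fin_dim (W : lmodType F) (A : set W) : Prop :=
  exists n (e : 'I_n -> W), forall w, A w ->
    exists c : 'I_n -> F, w = \sum_i c i *: e i.

Definition integrable (M : lieModule g) : Prop :=
  forall (us : seq envAlg) (v : M),
    fin_dim [set env_act u v | u in gen_subalg us].

Definition integrable_ideal (I : set envAlg) : Prop :=
  exists N : lieModule g, integrable N /\ I = ann N.

Definition determined_by_ann (M : lieModule g) : Prop :=
  forall M' : lieModule g, mod_simple M' -> ann M' = ann M -> mod_iso M' M.

End EnvelopingAlgebra.

Section TensorAlgebra.
Variables (F : fieldType) (W : lmodType F).

Inductive tensor_rel : term F W -> term F W -> Prop :=
| tensor_lin c v w :
    tensor_rel (Gen F (c *: v + w)) (Add (Mul (Cst W c) (Gen F v)) (Gen F w)).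

Lemma tensor_augment s t : tensor_rel s t -> augment s = augment t.
Proof. by case=> *; rewrite /= !mulr0 addr0. Qed.

Definition tensorAlg : algType F := presAlg (Presentation tensor_augment).

End TensorAlgebra.

(* [g] acts on the tensor algebra of [M] by the derivations that extend its
   action on [M]. *)
Section TensorModule.
Variables (F : fieldType) (g : lieAlgebra F) (M : lieModule g).

Fixpoint term_der (x : g) (t : term F M) : term F M :=
  match t with
  | Gen v => Gen F (act x v)
  | Cst c => Cst M 0
  | Add s t => Add (term_der x s) (term_der x t)
  | Mul s t => Add (Mul (term_der x s) t) (Mul s (term_der x t))
  end.

Local Notation T := (tensorAlg M).

Definition tensor_cls (t : term F M) : T := cls _ t.
Definition tensor_act (x : g) (a : T) : T := tensor_cls (term_der x (repr a)).

Let E s t : cong (@tensor_rel F M) s t <-> tensor_cls s = tensor_cls t.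
Proof. by split=> [st|/cls_eqP//]; exact/cls_eqP. Qed.

Let C0 : tensor_cls (Cst M 0) = 0.
Proof. by rewrite /tensor_cls clsC scale0r. Qed.

Let clsDE s t : tensor_cls (Add s t) = tensor_cls s + tensor_cls t.
Proof. exact: clsD. Qed.

Let clsME s t : tensor_cls (Mul s t) = tensor_cls s * tensor_cls t.
Proof. exact: clsM. Qed.

Let clsCE c : tensor_cls (Cst M c) = c%:A.
Proof. exact: clsC. Qed.

Let clsG c v w : tensor_cls (Gen F (c *: v + w)) =
  c *: tensor_cls (Gen F v) + tensor_cls (Gen F w).
Proof.
have -> : tensor_cls (Gen F (c *: v + w)) =
    tensor_cls (Add (Mul (Cst M c) (Gen F v)) (Gen F w)).
  by apply/E/cong_rel; exact: tensor_lin.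
by rewrite clsDE /tensor_cls clsZ.
Qed.

Lemma term_der_cong x s t : cong (@tensor_rel F M) s t ->
  tensor_cls (term_der x s) = tensor_cls (term_der x t).
Proof.
have cE := (clsDE, clsME, C0, clsCE).
elim=> /=.
- move=> {}s {}t [c v w] /=.
  by rewrite actDr clsG !cE mul0r add0r mulr_algl.
- by [].
- by move=> ? ? _ ->.
- by move=> ? ? ? _ -> _ ->.
- by move=> ? ? ? ? _ IH1 _ IH2; rewrite !cE IH1 IH2.
- move=> ? ? ? ? /E H1 IH1 /E H2 IH2.
  by rewrite !cE IH1 IH2 H1 H2.
- by move=> *; rewrite !cE addrA.
- by move=> *; rewrite !cE addrC.
- by move=> *; rewrite !cE add0r.
- by move=> *; rewrite !cE mulrDr mulrDl !mulrA addrA.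
- by move=> *; rewrite !cE mul0r add0r scale1r mul1r.
- by move=> *; rewrite !cE !mul0r addr0.
- by move=> *; rewrite !cE !mulrDl addrACA.
- by move=> *; rewrite !cE !mulrDr addrACA.
- by move=> *; rewrite !cE mul0r mulr0 add0r addr0 mulr_algl mulr_algr.
- by move=> *; rewrite !cE addr0.
- by move=> *; rewrite !cE !mul0r mulr0 addr0.
Qed.

Lemma tensor_act_cls x t : tensor_act x (tensor_cls t) = tensor_cls (term_der x t).
Proof. exact: (term_der_cong _ (repr_cls (Presentation (@tensor_augment F M)) t)). Qed.

Let tensor_ind (Q : T -> Prop) : (forall t, Q (tensor_cls t)) -> forall a, Q a.
Proof. exact: cls_ind. Qed.

Let tensor_actDl c x y a :
  tensor_act (c *: x + y) a = c *: tensor_act x a + tensor_act y a.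
Proof.
elim/tensor_ind: a => t; rewrite !tensor_act_cls.
elim: t => [v|d|s IHs t IHt|s IHs t IHt] /=.
- by rewrite actDl clsG.
- by rewrite C0 scaler0 addr0.
- by rewrite !clsDE IHs IHt scalerDr addrACA.
- rewrite !clsDE !clsME IHs IHt scalerDr mulrDl mulrDr scalerAl scalerAr.
  by rewrite addrACA.
Qed.

Let tensor_actDr c x a b :
  tensor_act x (c *: a + b) = c *: tensor_act x a + tensor_act x b.
Proof.
elim/tensor_ind: a => s; elim/tensor_ind: b => t.
have -> : c *: tensor_cls s + tensor_cls t =
    tensor_cls (Add (Mul (Cst M c) s) t).
  by rewrite clsDE clsME clsCE mulr_algl.
by rewrite !tensor_act_cls /= !(clsDE, clsME, C0, clsCE) mul0r add0r mulr_algl.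
Qed.

Let tensor_act_bracket x y a : tensor_act (bracket x y) a =
  tensor_act x (tensor_act y a) - tensor_act y (tensor_act x a).
Proof.
elim/tensor_ind: a => t; rewrite !tensor_act_cls.
elim: t => [v|d|s IHs t IHt|s IHs t IHt] /=.
- have := clsG (-1) (act y (act x v)) (act x (act y v)).
  by rewrite !scaleN1r addrC -act_bracket [RHS]addrC.
- by rewrite C0 subrr.
- by rewrite !clsDE IHs IHt opprD addrACA.
- rewrite !clsDE !clsME IHs IHt mulrBl mulrBr.
  have cancel (a b p q r u : T) :
      p - q + (r - u) = p + b + (a + r) - (q + a + (b + u)).
    have -> : p + b + (a + r) = p + r + (a + b).
      by rewrite [a + r]addrC addrACA [b + a]addrC.
    have -> : q + a + (b + u) = q + u + (a + b).
      by rewrite [b + u]addrC addrACA.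
    by rewrite [q + u + _]addrC addrKA opprD addrACA.
  exact: cancel.
Qed.

Definition tensorMod : lieModule g := @LieModule F g T tensor_act
  tensor_actDl tensor_actDr tensor_act_bracket.

End TensorModule.

Section SlInfinity.
Variable F : fieldType.

(* The regular module F^o is what equips these function spaces with the
   pointwise vector space structure. *)
Definition infmx : Type := nat -> nat -> F.
HB.instance Definition _ := GRing.Lmodule.copy infmx (nat -> nat -> F^o).

Definition infvec : Type := nat -> F.
HB.instance Definition _ := GRing.Lmodule.copy infvec (nat -> F^o).

Lemma fsum_trunc n (f : nat -> F) : (forall k, (n <= k)%N -> f k = 0) ->
  \sum_(k \in [set: nat]) f k = \sum_(k < n) f k.
Proof.
move=> f0; rewrite (fsbigE (iota 0 n)) ?iota_uniq//.
  rewrite (eq_bigl xpredT) => [|i]; last by rewrite in_setT.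
  by rewrite -(big_mkord xpredT) /index_iota subn0.
by move=> i _; rewrite mem_iota add0n -leqNgt; exact: f0.
Qed.

(* The upper left corner inclusion of n x n matrices. *)
Definition corner n (X : 'M[F]_n) : infmx := fun i j =>
  match insub i, insub j with
  | Some i', Some j' => X i' j'
  | _, _ => 0
  end.

Definition slInf_pred : {pred infmx} := [pred A |
  `[< exists n (X : 'M[F]_n), \tr X = 0 /\ A = corner X >]].

Definition supp_below n (A : infmx) :=
  forall i j, ((n <= i) || (n <= j))%N -> A i j = 0.

Lemma slInfP (A : infmx) : A \in slInf_pred <->
  exists n, supp_below n A /\ \sum_(i < n) A i i = 0.
Proof.
split=> [/asboolP[n [X [trX ->]]]|[n [A0 trA]]].
  exists n; split=> [i j|].
    by rewrite /corner => /orP[] ?; [rewrite insubN -?leqNgt//|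
      case: insub => // ?; rewrite insubN -?leqNgt//].
  by rewrite -[RHS]trX; apply: eq_bigr => i _; rewrite /corner !valK.
apply/asboolP; exists n, (\matrix_(i, j) A i j); split.
  by rewrite /mxtrace -[RHS]trA; apply: eq_bigr => i _; rewrite mxE.
apply/funext => i; apply/funext => j; rewrite /corner.
case: insubP => [i' _ <-|]; last by rewrite -leqNgt => ni; rewrite A0 ?ni.
case: insubP => [j' _ <-|]; first by rewrite mxE.
by rewrite -leqNgt => nj; rewrite A0 ?nj ?orbT.
Qed.

Lemma supp_below_le m n A : (m <= n)%N -> supp_below m A -> supp_below n A.
Proof.
by move=> mn A0 i j /orP[]/(leq_trans mn) h; rewrite A0 ?h ?orbT.
Qed.

Lemma trace_widen m n A : (m <= n)%N -> supp_below m A ->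
  \sum_(i < n) A i i = \sum_(i < m) A i i.
Proof.
move=> mn A0; rewrite -!(big_mkord xpredT (fun i => A i i)).
rewrite (big_cat_nat _ mn)//= [X in _ + X]big_nat_cond [X in _ + X]big1 ?addr0//.
by move=> i /andP[/andP[mi _] _]; rewrite A0 ?mi.
Qed.

Lemma slInf_closed : submod_closed slInf_pred.
Proof.
split=> [|c A B /slInfP[m [A0 trA]] /slInfP[n [B0 trB]]]; apply/slInfP.
  by exists 0%N; split=> //; rewrite big_ord0.
exists (maxn m n); split=> [i j ij|].
  rewrite [LHS](_ : _ = c * A i j + B i j)//.
  rewrite (supp_below_le (leq_maxl m n) A0 ij).
  by rewrite (supp_below_le (leq_maxr m n) B0 ij) mulr0 addr0.
have -> : \sum_(i < maxn m n) (c *: A + B : infmx) i i =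
  \sum_(i < maxn m n) (c * A i i + B i i) by [].
rewrite big_split -mulr_sumr /= (trace_widen (leq_maxl m n) A0).
by rewrite (trace_widen (leq_maxr m n) B0) trA trB mulr0 addr0.
Qed.

HB.instance Definition _ :=
  GRing.isSubmodClosed.Build F infmx slInf_pred slInf_closed.

Definition slInf_sort : Type := {A : infmx | A \in slInf_pred}.
HB.instance Definition _ := SubChoice.on slInf_sort.
HB.instance Definition _ := [SubChoice_isSubLmodule of slInf_sort by <:].

Definition mx_of (A : slInf_sort) : infmx := val A.

Lemma mx_of_inj : injective mx_of. Proof. exact: val_inj. Qed.

Lemma mx_ofP c (A B : slInf_sort) : mx_of (c *: A + B) = c *: mx_of A + mx_of B.
Proof. exact: (linearP (val : slInf_sort -> infmx)). Qed.

Lemma mx_of0 : mx_of 0 = 0.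
Proof. exact: (raddf0 (val : slInf_sort -> infmx)). Qed.

Lemma mx_ofD (A B : slInf_sort) : mx_of (A + B) = mx_of A + mx_of B.
Proof. exact: (raddfD (val : slInf_sort -> infmx)). Qed.

(* All the sums over nat below have finite support. *)
Definition mulinf (A B : infmx) : infmx := fun i j =>
  \sum_(k \in [set: nat]) A i k * B k j.

Definition mulvec (A : infmx) (v : infvec) : infvec := fun i =>
  \sum_(k \in [set: nat]) A i k * v k.

Definition mulcovec (v : infvec) (A : infmx) : infvec := fun j =>
  \sum_(k \in [set: nat]) v k * A k j.

Definition comm_infmx (A B : infmx) : infmx := mulinf A B - mulinf B A.

Section Truncation.
Variable n : nat.
Implicit Types (A B C : infmx) (v : infvec).

Lemma mulinf_trunc A B i j : supp_below n A ->
  mulinf A B i j = \sum_(k < n) A i k * B k j.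
Proof.
by move=> A0; apply: fsum_trunc => k nk; rewrite A0 ?nk ?orbT// mul0r.
Qed.

Lemma mulvec_trunc A v i : supp_below n A ->
  mulvec A v i = \sum_(k < n) A i k * v k.
Proof.
by move=> A0; apply: fsum_trunc => k nk; rewrite A0 ?nk ?orbT// mul0r.
Qed.

Lemma mulcovec_trunc v A j : supp_below n A ->
  mulcovec v A j = \sum_(k < n) v k * A k j.
Proof.
by move=> A0; apply: fsum_trunc => k nk; rewrite A0 ?nk// mulr0.
Qed.

Lemma supp_mulinf A B : supp_below n A -> supp_below n B ->
  supp_below n (mulinf A B).
Proof.
move=> A0 B0 i j /orP[] ij; rewrite (mulinf_trunc _ _ _ A0) big1// => k _.
  by rewrite A0 ?ij// mul0r.
by rewrite B0 ?ij ?orbT// mulr0.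
Qed.

Lemma supp_comm A B : supp_below n A -> supp_below n B ->
  supp_below n (comm_infmx A B).
Proof.
move=> A0 B0 i j ij; rewrite [LHS](_ : _ = mulinf A B i j - mulinf B A i j)//.
by rewrite !supp_mulinf// subrr.
Qed.

Lemma mulinfA A B C i j : supp_below n A -> supp_below n B ->
  mulinf A (mulinf B C) i j = mulinf (mulinf A B) C i j.
Proof.
move=> A0 B0; rewrite (mulinf_trunc _ _ _ A0).
rewrite (mulinf_trunc _ _ _ (supp_mulinf A0 B0)).
under eq_bigr do rewrite (mulinf_trunc _ _ _ B0) mulr_sumr.
rewrite exchange_big; apply: eq_bigr => k _ /=.
rewrite (mulinf_trunc _ _ _ A0) mulr_suml.
by apply: eq_bigr => l _; rewrite mulrA.
Qed.

Lemma mulvecA A B v i : supp_below n A -> supp_below n B ->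
  mulvec A (mulvec B v) i = mulvec (mulinf A B) v i.
Proof.
move=> A0 B0; rewrite (mulvec_trunc _ _ A0).
rewrite (mulvec_trunc _ _ (supp_mulinf A0 B0)).
under eq_bigr do rewrite (mulvec_trunc _ _ B0) mulr_sumr.
rewrite exchange_big; apply: eq_bigr => k _ /=.
rewrite (mulinf_trunc _ _ _ A0) mulr_suml.
by apply: eq_bigr => l _; rewrite mulrA.
Qed.

Lemma mulcovecA v A B j : supp_below n A -> supp_below n B ->
  mulcovec (mulcovec v A) B j = mulcovec v (mulinf A B) j.
Proof.
move=> A0 B0; rewrite (mulcovec_trunc _ _ B0).
rewrite (mulcovec_trunc _ _ (supp_mulinf A0 B0)).
under eq_bigr do rewrite (mulcovec_trunc _ _ A0) mulr_suml.
rewrite exchange_big; apply: eq_bigr => k _ /=.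
rewrite (mulinf_trunc _ _ _ A0) mulr_sumr.
by apply: eq_bigr => l _; rewrite mulrA.
Qed.

Lemma mulinfDl c A B C i j : supp_below n A -> supp_below n B ->
  mulinf (c *: A + B) C i j = c * mulinf A C i j + mulinf B C i j.
Proof.
move=> A0 B0; have AB0 : supp_below n (c *: A + B).
  move=> k l kl; rewrite [LHS](_ : _ = c * A k l + B k l)//.
  by rewrite A0// B0// mulr0 addr0.
rewrite (mulinf_trunc _ _ _ AB0) (mulinf_trunc _ _ _ A0).
rewrite (mulinf_trunc _ _ _ B0) mulr_sumr -big_split; apply: eq_bigr => k _ /=.
by rewrite mulrA -mulrDl.
Qed.

Lemma mulinfDr c A B C i j : supp_below n C ->
  mulinf C (c *: A + B) i j = c * mulinf C A i j + mulinf C B i j.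
Proof.
move=> C0; rewrite !(mulinf_trunc _ _ _ C0) mulr_sumr -big_split.
by apply: eq_bigr => k _ /=; rewrite mulrCA -mulrDr.
Qed.

Lemma mulinfBr A B C i j : supp_below n C ->
  mulinf C (A - B) i j = mulinf C A i j - mulinf C B i j.
Proof.
move=> C0; rewrite !(mulinf_trunc _ _ _ C0) -sumrB.
by apply: eq_bigr => k _ /=; rewrite -mulrBr.
Qed.

Lemma mulinfBl A B C i j : supp_below n A -> supp_below n B ->
  mulinf (A - B) C i j = mulinf A C i j - mulinf B C i j.
Proof.
move=> A0 B0; have -> : A - B = -1 *: B + A by rewrite scaleN1r addrC.
by rewrite mulinfDl// mulN1r addrC.
Qed.

Lemma mulvecDl c A B v i : supp_below n A -> supp_below n B ->
  mulvec (c *: A + B) v i = c * mulvec A v i + mulvec B v i.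
Proof.
move=> A0 B0; have AB0 : supp_below n (c *: A + B).
  move=> k l kl; rewrite [LHS](_ : _ = c * A k l + B k l)//.
  by rewrite A0// B0// mulr0 addr0.
rewrite (mulvec_trunc _ _ AB0) (mulvec_trunc _ _ A0).
rewrite (mulvec_trunc _ _ B0) mulr_sumr -big_split; apply: eq_bigr => k _ /=.
by rewrite mulrA -mulrDl.
Qed.

Lemma mulvecDr c A v w i : supp_below n A ->
  mulvec A (c *: v + w) i = c * mulvec A v i + mulvec A w i.
Proof.
move=> A0; rewrite !(mulvec_trunc _ _ A0) mulr_sumr -big_split.
by apply: eq_bigr => k _ /=; rewrite mulrCA -mulrDr.
Qed.

Lemma mulcovecDr c A B v i : supp_below n A -> supp_below n B ->
  mulcovec v (c *: A + B) i = c * mulcovec v A i + mulcovec v B i.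
Proof.
move=> A0 B0; have AB0 : supp_below n (c *: A + B).
  move=> k l kl; rewrite [LHS](_ : _ = c * A k l + B k l)//.
  by rewrite A0// B0// mulr0 addr0.
rewrite (mulcovec_trunc _ _ AB0) (mulcovec_trunc _ _ A0).
rewrite (mulcovec_trunc _ _ B0) mulr_sumr -big_split.
by apply: eq_bigr => k _ /=; rewrite mulrCA -mulrDr.
Qed.

Lemma mulcovecDl c v w A i : supp_below n A ->
  mulcovec (c *: v + w) A i = c * mulcovec v A i + mulcovec w A i.
Proof.
move=> A0; rewrite !(mulcovec_trunc _ _ A0) mulr_sumr -big_split.
by apply: eq_bigr => k _ /=; rewrite mulrA -mulrDl.
Qed.

Lemma trace_comm A B : supp_below n A -> supp_below n B ->
  \sum_(i < n) comm_infmx A B i i = 0.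
Proof.
move=> A0 B0; have -> : \sum_(i < n) comm_infmx A B i i =
  \sum_(i < n) (mulinf A B i i - mulinf B A i i) by [].
rewrite sumrB; apply/eqP; rewrite subr_eq0; apply/eqP.
under eq_bigr do rewrite (mulinf_trunc _ _ _ A0).
under [RHS]eq_bigr do rewrite (mulinf_trunc _ _ _ B0).
rewrite exchange_big; apply: eq_bigr => i _; apply: eq_bigr => j _.
by rewrite mulrC.
Qed.

Lemma jacobi_infmx A B C :
    supp_below n A -> supp_below n B -> supp_below n C ->
  comm_infmx A (comm_infmx B C) + comm_infmx B (comm_infmx C A) +
  comm_infmx C (comm_infmx A B) = 0.
Proof.
have E X Y Z i j : supp_below n X -> supp_below n Y -> supp_below n Z ->
    comm_infmx X (comm_infmx Y Z) i j =
    mulinf (mulinf X Y) Z i j - mulinf (mulinf X Z) Y i j -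
    (mulinf (mulinf Y Z) X i j - mulinf (mulinf Z Y) X i j).
  move=> X0 Y0 Z0; rewrite -!mulinfA// -mulinfBr//.
  by rewrite !mulinfA// -mulinfBl//; exact: supp_mulinf.
move=> A0 B0 C0; apply/funext => i; apply/funext => j.
rewrite [LHS](_ : _ = comm_infmx A (comm_infmx B C) i j +
  comm_infmx B (comm_infmx C A) i j + comm_infmx C (comm_infmx A B) i j)//.
rewrite !E//.
set a := mulinf (mulinf A B) C i j; set b := mulinf (mulinf A C) B i j.
set c := mulinf (mulinf B C) A i j; set d := mulinf (mulinf C B) A i j.
set e := mulinf (mulinf B A) C i j; set f := mulinf (mulinf C A) B i j.
by rewrite (_ : _ + _ = 0 :> F)//; ring.
Qed.

End Truncation.

Lemma slInf_supp (A B C : slInf_sort) : exists n,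
  [/\ supp_below n (mx_of A), supp_below n (mx_of B) & supp_below n (mx_of C)].
Proof.
have /slInfP[a [A0 _]] := valP A; have /slInfP[b [B0 _]] := valP B.
have /slInfP[c [C0 _]] := valP C; exists (maxn a (maxn b c)).
by split; [apply: (supp_below_le _ A0); rewrite leq_max leqnn|
  apply: (supp_below_le _ B0); rewrite !leq_max leqnn orbT|
  apply: (supp_below_le _ C0); rewrite !leq_max leqnn !orbT].
Qed.

Let comm_slInf (A B : slInf_sort) : comm_infmx (mx_of A) (mx_of B) \in slInf_pred.
Proof.
have [n [A0 B0 _]] := slInf_supp A B A.
by apply/slInfP; exists n; split; [exact: supp_comm|exact: trace_comm].
Qed.

Definition slInf_bracket (A B : slInf_sort) : slInf_sort :=
  exist _ (comm_infmx (mx_of A) (mx_of B)) (comm_slInf A B).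

Lemma mx_of_bracket A B :
  mx_of (slInf_bracket A B) = comm_infmx (mx_of A) (mx_of B).
Proof. by []. Qed.

Let slInf_bracketDl c A B C : slInf_bracket (c *: A + B) C =
  c *: slInf_bracket A C + slInf_bracket B C.
Proof.
have [n [A0 B0 C0]] := slInf_supp A B C; apply: mx_of_inj.
rewrite mx_ofP !mx_of_bracket mx_ofP; apply/funext => i; apply/funext => j.
have E X Y : comm_infmx X Y i j = mulinf X Y i j - mulinf Y X i j by [].
rewrite [RHS](_ : _ = c * comm_infmx (mx_of A) (mx_of C) i j +
  comm_infmx (mx_of B) (mx_of C) i j)// !E.
rewrite (mulinfDl (n := n))// (mulinfDr (n := n))//.
by ring.
Qed.

Let slInf_bracketxx A : slInf_bracket A A = 0.
Proof. by apply: mx_of_inj; rewrite mx_of0 mx_of_bracket /comm_infmx subrr. Qed.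

Let slInf_jacobi A B C : slInf_bracket A (slInf_bracket B C) +
  slInf_bracket B (slInf_bracket C A) + slInf_bracket C (slInf_bracket A B) = 0.
Proof.
have [n [A0 B0 C0]] := slInf_supp A B C; apply: mx_of_inj.
by rewrite !mx_ofD !mx_of_bracket mx_of0 (jacobi_infmx (n := n)).
Qed.

Definition slInf : lieAlgebra F :=
  @LieAlgebra F slInf_sort slInf_bracket slInf_bracketDl slInf_bracketxx
    slInf_jacobi.

(* Coordinates in the standard basis (e_i) of V(oo), and in the dual basis of
   V(oo)_*, identify both spaces with the finitely supported sequences. *)
Definition finvec_pred : {pred infvec} := [pred v |
  `[< exists n, forall k, (n <= k)%N -> v k = 0 >]].

Lemma finvec_closed : submod_closed finvec_pred.
Proof.
split=> [|c v w /asboolP[m v0] /asboolP[n w0]]; apply/asboolP.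
  by exists 0%N.
exists (maxn m n) => k; rewrite geq_max => /andP[mk nk].
by rewrite [LHS](_ : _ = c * v k + w k)// v0// w0// mulr0 addr0.
Qed.

HB.instance Definition _ :=
  GRing.isSubmodClosed.Build F infvec finvec_pred finvec_closed.

Definition finvec : Type := {v : infvec | v \in finvec_pred}.
HB.instance Definition _ := SubChoice.on finvec.
HB.instance Definition _ := [SubChoice_isSubLmodule of finvec by <:].

Definition vec_of (v : finvec) : infvec := val v.

Lemma vec_of_inj : injective vec_of. Proof. exact: val_inj. Qed.

Lemma vec_ofP c (v w : finvec) : vec_of (c *: v + w) = c *: vec_of v + vec_of w.
Proof. exact: (linearP (val : finvec -> infvec)). Qed.

Lemma vec_ofB (v w : finvec) : vec_of (v - w) = vec_of v - vec_of w.
Proof. exact: (raddfB (val : finvec -> infvec)). Qed.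

Let natural_finvec (A : slInf) (v : finvec) :
  mulvec (mx_of A) (vec_of v) \in finvec_pred.
Proof.
have [n [A0 _ _]] := slInf_supp A A A; apply/asboolP; exists n => k nk.
by rewrite (mulvec_trunc _ _ A0) big1// => i _; rewrite A0 ?nk// mul0r.
Qed.

Definition natural_act (A : slInf) (v : finvec) : finvec :=
  exist _ (mulvec (mx_of A) (vec_of v)) (natural_finvec A v).

Lemma vec_of_natural_act A v :
  vec_of (natural_act A v) = mulvec (mx_of A) (vec_of v).
Proof. by []. Qed.

Let natural_actDl c A B v : natural_act (c *: A + B) v =
  c *: natural_act A v + natural_act B v.
Proof.
have [n [A0 B0 _]] := slInf_supp A B A; apply: vec_of_inj.
rewrite vec_ofP !vec_of_natural_act mx_ofP; apply/funext => i.
exact: mulvecDl A0 B0.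
Qed.

Let natural_actDr c A v w : natural_act A (c *: v + w) =
  c *: natural_act A v + natural_act A w.
Proof.
have [n [A0 _ _]] := slInf_supp A A A; apply: vec_of_inj.
rewrite vec_ofP !vec_of_natural_act vec_ofP; apply/funext => i.
exact: mulvecDr A0.
Qed.

Let natural_act_bracket A B v : natural_act (bracket A B) v =
  natural_act A (natural_act B v) - natural_act B (natural_act A v).
Proof.
have [n [A0 B0 _]] := slInf_supp A B A; apply: vec_of_inj.
rewrite vec_ofB !vec_of_natural_act; apply/funext => i.
rewrite [RHS](_ : _ = mulvec (mx_of A) (mulvec (mx_of B) (vec_of v)) i -
  mulvec (mx_of B) (mulvec (mx_of A) (vec_of v)) i)//.
rewrite !(mulvecA (n := n))//.
have -> : mx_of (@bracket F slInf A B) =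
    -1 *: mulinf (mx_of B) (mx_of A) + mulinf (mx_of A) (mx_of B).
  by rewrite scaleN1r addrC.
rewrite (mulvecDl (n := n)); try exact: supp_mulinf.
by rewrite mulN1r addrC.
Qed.

Definition Vinf : lieModule slInf :=
  @LieModule F slInf finvec natural_act natural_actDl natural_actDr
    natural_act_bracket.

Let conatural_finvec (A : slInf) (v : finvec) :
  - mulcovec (vec_of v) (mx_of A) \in finvec_pred.
Proof.
have [n [A0 _ _]] := slInf_supp A A A; apply/asboolP; exists n => k nk.
rewrite [LHS](_ : _ = - mulcovec (vec_of v) (mx_of A) k)//.
rewrite (mulcovec_trunc _ _ A0) big1 ?oppr0// => i _.
by rewrite A0 ?nk ?orbT// mulr0.
Qed.

Definition conatural_act (A : slInf) (v : finvec) : finvec :=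
  exist _ (- mulcovec (vec_of v) (mx_of A)) (conatural_finvec A v).

Lemma vec_of_conatural_act A v :
  vec_of (conatural_act A v) = - mulcovec (vec_of v) (mx_of A).
Proof. by []. Qed.

Let conatural_actDl c A B v : conatural_act (c *: A + B) v =
  c *: conatural_act A v + conatural_act B v.
Proof.
have [n [A0 B0 _]] := slInf_supp A B A; apply: vec_of_inj.
rewrite vec_ofP !vec_of_conatural_act mx_ofP scalerN -opprD; congr (- _).
by apply/funext => i; exact: mulcovecDr A0 B0.
Qed.

Let conatural_actDr c A v w : conatural_act A (c *: v + w) =
  c *: conatural_act A v + conatural_act A w.
Proof.
have [n [A0 _ _]] := slInf_supp A A A; apply: vec_of_inj.
rewrite vec_ofP !vec_of_conatural_act vec_ofP scalerN -opprD; congr (- _).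
by apply/funext => i; exact: mulcovecDl A0.
Qed.

Let conatural_act_bracket A B v : conatural_act (bracket A B) v =
  conatural_act A (conatural_act B v) - conatural_act B (conatural_act A v).
Proof.
have [n [A0 B0 _]] := slInf_supp A B A; apply: vec_of_inj.
rewrite vec_ofB !vec_of_conatural_act.
have N X w i : supp_below n X -> mulcovec (- w) X i = - mulcovec w X i.
  move=> X0; rewrite !(mulcovec_trunc _ _ X0) -sumrN.
  by apply: eq_bigr => k _; rewrite -mulNr.
apply/funext => i; rewrite [RHS](_ : _ =
  - mulcovec (- mulcovec (vec_of v) (mx_of B)) (mx_of A) i -
  - mulcovec (- mulcovec (vec_of v) (mx_of A)) (mx_of B) i)//.
rewrite !N// !opprK !(mulcovecA (n := n))//.
rewrite [LHS](_ : _ = - mulcovec (vec_of v) (mx_of (@bracket F slInf A B)) i)//.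
have -> : mx_of (@bracket F slInf A B) =
    -1 *: mulinf (mx_of B) (mx_of A) + mulinf (mx_of A) (mx_of B).
  by rewrite scaleN1r addrC.
rewrite (mulcovecDr (n := n)); try exact: supp_mulinf.
by rewrite mulN1r opprD opprK.
Qed.

Definition Vinf_dual : lieModule slInf :=
  @LieModule F slInf finvec conatural_act conatural_actDl conatural_actDr
    conatural_act_bracket.

Definition is_simple_tensor_module (N : lieModule slInf) : Prop :=
  exists S : submodule (tensorMod (sumMod Vinf Vinf_dual)),
    mod_simple (subMod S) /\ mod_iso N (subMod S).

End SlInfinity.

(* Main.v *)
(* By complete reducibility, an integrable module N with annihilator I is, over
   each sl(m), a sum of simple highest weight modules; a term lies in I iff it
   kills the modules of all types (m, cs) that occur in N for m large, where cs
   lists the columns of a dominant weight. I is prime, because it is the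
   annihilator of a simple module; together with Higman's lemma this provides a
   chain of types that suffices to determine I and along which each simple module
   embeds in the next one. The direct limit L of suitable embeddings is a locally
   finite simple module with annihilator I, generated by a weight vector u. By
   hypothesis L is isomorphic to M, and so is every other module constructed in
   this way. If e_ij u were nonzero for arbitrarily large i, j, applying infinitely
   many such e_ij in the limit would produce a module that is not isomorphic to L.
   Hence e_ij u = 0 for large i, j, and a polarization argument turns u into a
   vector y that is a highest weight vector for all sl(m) with respect to an order
   P < {all other indices} < Q with P and Q finite. A product of exterior powers of
   initial segments of P in V and of final segments of Q in V_* has the same
   weights, hence the same annihilator, as y, so it generates a simple submodule of
   the tensor algebra with annihilator I. *)
Require Import Defs.
From HB Require Import structures.
From mathcomp Require Import all_boot all_algebra perm.
From mathcomp Require Import all_classical.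
From mathcomp Require Import ring zify.

Set Implicit Arguments.
Unset Strict Implicit.
Unset Printing Implicit Defensive.

Import GRing.Theory.
Local Open Scope ring_scope.

(** An annihilator sees only which simple sl(m)-modules occur for each m, not how modules of
    different levels are glued together. One choice of gluing gives L, and the hypothesis on M says
    that any other gluing with the same annihilator gives an isomorphic simple module. Operators
    e_ij with i, j large commute with sl(m) for small m, so applying infinitely many of them changes
    the gluing without changing what a single sl(m) sees. The change shows only in weights at
    infinitely many indices, and a vector of L differs from u in finitely many weights, because it
    is a term of finite level applied to u. Simple modules are compared without maps between them:
    two generators are compared through the terms over sl(m) that kill them, and for highest weight
    vectors of equal weight these terms coincide. Every weight is represented by a vector of the
    tensor algebra, so that all types of all levels live in one locally finite module. The given
    module N is only locally finite, hence complete reducibility is proved for locally finite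
    representations. *)

Section LinearMaps.
Variables (F : fieldType) (X Y : lmodType F) (f : X -> Y).
Hypothesis f_lin : forall (c : F) (x y : X), f (c *: x + y) = c *: f x + f y.

Lemma lin0 : f 0 = 0.
Proof. by have := f_lin (-1) 0 0; rewrite !scaleN1r oppr0 addr0 addNr. Qed.

Lemma linZ c x : f (c *: x) = c *: f x.
Proof. by have := f_lin c x 0; rewrite lin0 !addr0. Qed.

Lemma linD x y : f (x + y) = f x + f y.
Proof. by have := f_lin 1 x y; rewrite !scale1r. Qed.

Lemma linB x y : f (x - y) = f x - f y.
Proof. by rewrite -scaleN1r linD linZ scaleN1r. Qed.

Lemma lin_sum (I : Type) (r : seq I) (P : pred I) (g : I -> X) :
  f (\sum_(i <- r | P i) g i) = \sum_(i <- r | P i) f (g i).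
Proof. exact: (big_morph f linD lin0). Qed.

End LinearMaps.

(** * Subspaces and finite spans *)

Section Spans.
Variables (F : fieldType) (X : lmodType F).

Definition spn d (B : 'I_d -> X) (x : X) : Prop :=
  exists c : 'I_d -> F, x = \sum_i c i *: B i.

Definition subspace (Z : X -> Prop) : Prop :=
  Z 0 /\ forall c x y, Z x -> Z y -> Z (c *: x + y).

Lemma subspaceD Z x y : subspace Z -> Z x -> Z y -> Z (x + y).
Proof. by case=> _ ZD Zx Zy; rewrite -[x]scale1r; exact: ZD. Qed.

Lemma subspaceZ Z c x : subspace Z -> Z x -> Z (c *: x).
Proof. by case=> Z0 ZD Zx; rewrite -[_ *: _]addr0; exact: ZD. Qed.

Lemma subspaceB Z x y : subspace Z -> Z x -> Z y -> Z (x - y).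
Proof.
by move=> sZ Zx Zy; rewrite -scaleN1r; apply: subspaceD => //; apply: subspaceZ.
Qed.

Lemma subspace_sum Z (I : Type) (r : seq I) (P : pred I) (f : I -> X) :
  subspace Z -> (forall i, P i -> Z (f i)) -> Z (\sum_(i <- r | P i) f i).
Proof.
move=> sZ Zf; apply: (big_ind Z) => //; first by case: sZ.
by move=> *; exact: subspaceD.
Qed.

Lemma subspace_spn d (B : 'I_d -> X) : subspace (spn B).
Proof.
split=> [|c x y [a ->] [b ->]].
  by exists (fun=> 0); rewrite big1// => i _; rewrite scale0r.
exists (fun i => c * a i + b i); rewrite scaler_sumr -big_split.
by apply: eq_bigr => i _ /=; rewrite scalerDl scalerA.
Qed.

Lemma subspace0 : subspace (fun x => x = 0).
Proof. by split=> // c x y -> ->; rewrite scaler0 addr0. Qed.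

Lemma spn_mem d (B : 'I_d -> X) i : spn B (B i).
Proof.
exists (fun j => (j == i)%:R); rewrite (bigD1 i)//= eqxx scale1r big1 ?addr0//.
by move=> j /negPf->; rewrite scale0r.
Qed.

Lemma spn_dependent d (B : 'I_d -> X) n (x : 'I_n -> X) : (d < n)%N ->
  (forall k, spn B (x k)) ->
  exists2 c : 'I_n -> F, exists k, c k != 0 & \sum_k c k *: x k = 0.
Proof.
move=> dn /choice[a xa].
have : kermx (\matrix_(k, i) a k i) != 0.
  rewrite kermx_eq0 /row_free; apply: contraL dn => /eqP <-.
  by rewrite -leqNgt rank_leq_col.
have := mulmx_ker (\matrix_(k, i) a k i); move: (kermx _) => K K0.
case/matrix0Pn=> k0 [k1 nz]; exists (K k0); first by exists k1.
under eq_bigr do rewrite xa scaler_sumr.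
rewrite exchange_big big1//= => i _.
under eq_bigr do rewrite scalerA.
rewrite -scaler_suml; move/matrixP/(_ k0 i): K0; rewrite !mxE.
by under eq_bigr do rewrite mxE; move->; rewrite scale0r.
Qed.

(* A family in [Z] whose coefficient matrix has maximal rank spans [Z]. *)
Lemma subspace_spanned d (B : 'I_d -> X) (Z : X -> Prop) : subspace Z ->
  (forall x, Z x -> spn B x) ->
  exists n (C : 'I_n -> X), (forall i, Z (C i)) /\ forall x, Z x -> spn C x.
Proof.
move=> sZ ZB.
pose lc (c : 'rV[F]_d) := \sum_i c 0 i *: B i.
pose good (r : nat) := exists A : 'M[F]_d, \rank A = r /\
  forall i, Z (lc (row i A)).
have g0 : `[< good 0%N >].
  apply/asboolP; exists 0; split=> [|i]; first by rewrite mxrank0.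
  by rewrite /lc big1 => [|j _]; [case: sZ|rewrite !mxE scale0r].
have gb r : `[< good r >] -> (r <= d)%N.
  by move=> /asboolP[A [<- _]]; rewrite rank_leq_col.
case: (ex_maxnP (ex_intro (fun r => `[< good r >]) 0%N g0) gb) => r /asboolP[A [rA ZA]] maxr.
exists d, (fun i => lc (row i A)); split=> // x Zx.
have [c xc] := ZB _ Zx; pose v := \row_i c i.
have xv : x = lc v by rewrite xc; apply: eq_bigr => i _; rewrite mxE.
have lcD a u w : lc (a *: u + w) = a *: lc u + lc w.
  rewrite /lc scaler_sumr -big_split; apply: eq_bigr => i _ /=.
  by rewrite !mxE scalerDl scalerA.
have lc0 : lc 0 = 0 by rewrite /lc big1 // => i _; rewrite mxE scale0r.
have lcM (D : 'M[F]_d) k (w : 'M[F]_(k, d)) i : (forall i, Z (lc (row i D))) ->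
    Z (lc (row i (w *m D))).
  move=> ZD; rewrite row_mul mulmx_sum_row.
  elim/big_ind: _ => [|u1 u2 z1 z2|j _]; first by rewrite lc0; case: sZ.
    by rewrite -[u1]scale1r lcD; case: sZ => _; apply.
  by rewrite -[_ *: _]addr0 lcD lc0 addr0; apply: subspaceZ.
have : (v <= A)%MS.
  apply: contraT => vA; have : good (\rank (A + v)%MS).
    exists (A + v)%MS; split=> // i.
    have /submxP[D ->] : (row i (A + v)%MS <= col_mx A v)%MS.
      by rewrite (submx_trans (row_sub _ _))// addsmxE.
    rewrite -[D]hsubmxK mul_row_col -[X in lc (X + _)]scale1r lcD scale1r.
    apply: subspaceD => //.
      by have := @lcM A 1%N (lsubmx D) 0 ZA; rewrite rowE (_ : delta_mx 0 0 = 1%:M) ?mul1mx// ; apply/matrixP => a b; rewrite !mxE !ord1.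
    rewrite (mx11_scalar (rsubmx D)) mul_scalar_mx -[_ *: v]addr0 lcD lc0 addr0 -xv.
    exact: subspaceZ.
  move/asboolP/maxr; rewrite leqNgt -rA => /negP[].
  apply: rank_ltmx; rewrite ltmxE addsmxSl /=; apply: contra vA.
  exact: submx_trans (addsmxSr _ _).
case/submxP=> D vD; exists (fun i => D 0 i); rewrite xv vD mulmx_sum_row.
elim/big_rec2: _ => [|i y w _ IH]; first by rewrite lc0.
by rewrite lcD IH.
Qed.

End Spans.

(** * Highest weight theory of sl(m) *)

Lemma natF_inj (F : fieldType) : [pchar F] =i pred0 ->
  injective (fun n : nat => n%:R : F).
Proof.
move=> /pcharf0P F0 n k; wlog nk : n k / (n <= k)%N.
  by move=> H e; case: (leqP n k) => [|/ltnW] kn; [exact: H|exact/esym/H].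
move=> /eqP; rewrite eq_sym -subr_eq0 -natrB// F0 subn_eq0 => kn.
by apply/eqP; rewrite eqn_leq nk kn.
Qed.

(* A locally finite representation of sl_m, seen as a representation of gl_m on
   which the identity acts by zero so that the matrix units can be used. *)
Record glrep (F : fieldType) (m : nat) (X : lmodType F) := GlRep {
  gE :> 'I_m -> 'I_m -> X -> X;
  gE_lin : forall a b (c : F) (x y : X), gE a b (c *: x + y) = c *: gE a b x + gE a b y;
  gE_rel : forall a b c d (x : X), gE a b (gE c d x) - gE c d (gE a b x) =
    (b == c)%:R *: gE a d x - (a == d)%:R *: gE c b x;
  gE_tr : forall x : X, \sum_a gE a a x = 0;
  gE_lf : forall x, exists d (B : 'I_d -> X),
    spn B x /\ forall a b y, spn B y -> spn B (gE a b y)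
}.

(** * Eigenvectors modulo a subspace, in place of quotient spaces *)

Section Congruence.
Variables (F : fieldType) (X : lmodType F) (Z : X -> Prop).
Hypothesis sZ : subspace Z.

Definition cg (x y : X) := Z (x - y).

Lemma cg_refl x : cg x x.
Proof. by rewrite /cg subrr; case: sZ. Qed.

Lemma cg0 x : cg x 0 <-> Z x.
Proof. by rewrite /cg subr0. Qed.

Lemma cg_sym x y : cg x y -> cg y x.
Proof.
by move=> /(subspaceZ (-1) sZ); rewrite scaleN1r opprB.
Qed.

Lemma cg_trans y x z : cg x y -> cg y z -> cg x z.
Proof. by move=> /(subspaceD sZ)H /H; rewrite addrA subrK. Qed.

Lemma cgD x x' y y' : cg x x' -> cg y y' -> cg (x + y) (x' + y').
Proof. by move=> /(subspaceD sZ)H /H; rewrite /cg opprD addrACA. Qed.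

Lemma cgZ c x y : cg x y -> cg (c *: x) (c *: y).
Proof. by move=> /(subspaceZ c sZ); rewrite /cg scalerBr. Qed.

Lemma cgN x y : cg x y -> cg (- x) (- y).
Proof. by rewrite -scaleN1r -[- y]scaleN1r; exact: cgZ. Qed.

Lemma cgB x x' y y' : cg x x' -> cg y y' -> cg (x - y) (x' - y').
Proof. by move=> ? ?; apply: cgD => //; exact: cgN. Qed.

Lemma cg_mem x y : cg x y -> Z y -> Z x.
Proof. by rewrite -!cg0; exact: cg_trans. Qed.

Lemma cg_sum (I : Type) (r : seq I) (f g : I -> X) :
  (forall i, cg (f i) (g i)) -> cg (\sum_(i <- r) f i) (\sum_(i <- r) g i).
Proof. by move=> fg; rewrite /cg -sumrB; apply: subspace_sum => // i _; exact: fg. Qed.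

Variable T : X -> X.
Hypothesis T_lin : forall (c : F) (x y : X), T (c *: x + y) = c *: T x + T y.
Hypothesis TZ : forall x, Z x -> Z (T x).

Lemma cgT x y : cg x y -> cg (T x) (T y).
Proof.
have -> : cg x y = Z (-1 *: y + x) by rewrite scaleN1r addrC.
by move=> /TZ; rewrite (T_lin (-1) y x) scaleN1r addrC.
Qed.

Variables (c : nat -> F) (x : nat -> X).
Hypothesis c_inj : injective c.
Hypothesis Tx : forall k, cg (T (x k)) (c k *: x k).

(** Applying [T - c n] removes the last summand modulo [Z] and multiplies each other one by a
    nonzero factor. The conclusion is about the summands and not the coefficients, because [x k] may
    lie in [Z]. *)
Lemma eigen_indep n (a : nat -> F) : Z (\sum_(k < n) a k *: x k) ->
  forall k, (k < n)%N -> Z (a k *: x k).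
Proof.
elim: n a => // n IH a; rewrite big_ord_recr /= => Zs.
have Tsum : cg (T (\sum_(k < n) a k *: x k)) (\sum_(k < n) (a k * c k) *: x k).
  have -> : T (\sum_(k < n) a k *: x k) = \sum_(k < n) a k *: T (x k).
    by rewrite (lin_sum T_lin); apply: eq_bigr => i _; exact: (linZ T_lin).
  by apply: cg_sum => k; rewrite -scalerA; exact/cgZ/Tx.
have Zk k : (k < n)%N -> Z (a k *: x k).
  move=> kn; have : Z (\sum_(k < n) (a k * (c k - c n)) *: x k).
    have -> : \sum_(k < n) (a k * (c k - c n)) *: x k =
      (\sum_(k < n) (a k * c k) *: x k + (a n * c n) *: x n) -
      c n *: (\sum_(k < n) a k *: x k + a n *: x n).
      rewrite scalerDr opprD addrACA scalerA [c n * _]mulrC subrr addr0.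
      rewrite scaler_sumr -sumrB; apply: eq_bigr => i _.
      by rewrite scalerA -scalerBl mulrBr [c n * _]mulrC.
    apply: subspaceB => //; last exact: subspaceZ.
    apply: cg_mem (TZ Zs) => //.
    have -> : T (\sum_(i < n) a i *: x i + a n *: x n) =
      a n *: T (x n) + T (\sum_(i < n) a i *: x i) by rewrite addrC T_lin.
    rewrite addrC; apply: cgD; last exact: cg_sym.
    by rewrite -scalerA; apply/cgZ/cg_sym/Tx.
  move/(IH (fun k => a k * (c k - c n))) => /(_ k kn)/(subspaceZ (c k - c n)^-1 sZ).
  rewrite scalerA mulrC mulfK// subr_eq0; apply/eqP => /c_inj kn'.
  by rewrite kn' ltnn in kn.
move=> k; rewrite ltnS leq_eqVlt => /orP[/eqP->|]; last exact: Zk.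
have Zn : Z (\sum_(k < n) a k *: x k) by apply: subspace_sum => // i _; exact: Zk.
by move: (subspaceB sZ Zs Zn); rewrite addrAC subrr add0r.
Qed.

(** Among [d + 1] vectors in the span of [d] there is a linear relation; a term of it with nonzero
    coefficient lies in [Z] by the independence of eigenvectors. *)
Lemma eigen_bound d (B : 'I_d -> X) : (forall k, spn B (x k)) ->
  exists k, Z (x k).
Proof.
move=> Bx; have [a [k ak] a0] := @spn_dependent _ _ _ B d.+1 (fun k => x k) (ltnSn d) (fun k => Bx k).
exists k; have Z0 : Z (\sum_(j < d.+1) (if insub (val j) is Some i then a i else 0) *: x j).
  suff -> : \sum_(j < d.+1) (if insub (val j) is Some i then a i else 0) *: x j = 0.
    by case: sZ.
  by rewrite -[RHS]a0; apply: eq_bigr => i _; rewrite valK.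
have := @eigen_indep _ (fun j => if insub j is Some i then a i else 0) Z0 k (ltn_ord k).
by rewrite valK => /(subspaceZ (a k)^-1 sZ); rewrite scalerA mulVf// scale1r.
Qed.

End Congruence.

(** * Weights and raising operators modulo a submodule *)

Section GlRep.
Variables (F : closedFieldType) (charF : [pchar F] =i pred0).
Variables (m : nat) (X : lmodType F) (E : glrep m X).
Implicit Types (x y z : X) (a b : 'I_m) (lam mu : 'I_m -> F).

Lemma gE0 a b : E a b 0 = 0.
Proof. exact: (lin0 (gE_lin E a b)). Qed.

Lemma gED a b x y : E a b (x + y) = E a b x + E a b y.
Proof. exact: (linD (gE_lin E a b)). Qed.

Lemma gEZ a b c x : E a b (c *: x) = c *: E a b x.
Proof. exact: (linZ (gE_lin E a b)). Qed.

Lemma gEB a b x y : E a b (x - y) = E a b x - E a b y.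
Proof. exact: (linB (gE_lin E a b)). Qed.

Lemma gE_sum a b (I : Type) (r : seq I) (P : pred I) (f : I -> X) :
  E a b (\sum_(i <- r | P i) f i) = \sum_(i <- r | P i) E a b (f i).
Proof. exact: (lin_sum (gE_lin E a b)). Qed.

Lemma gE_comm a b c d x : E a b (E c d x) =
  E c d (E a b x) + ((b == c)%:R *: E a d x - (a == d)%:R *: E c b x).
Proof. by rewrite -gE_rel addrC subrK. Qed.

Definition stable (Z : X -> Prop) :=
  subspace Z /\ forall a b x, Z x -> Z (E a b x).

Inductive cyc x : X -> Prop :=
| cyc_gen : cyc x x
| cyc_lin c y z of cyc x y & cyc x z : cyc x (c *: y + z)
| cyc_E a b y of cyc x y : cyc x (E a b y).

Lemma stable_cyc x : stable (cyc x).
Proof.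
split; last by move=> *; exact: cyc_E.
split; last by move=> *; exact: cyc_lin.
have -> : 0 = -1 *: x + x by rewrite scaleN1r addNr.
by apply: cyc_lin; exact: cyc_gen.
Qed.

Lemma cyc_min Z x y : stable Z -> Z x -> cyc x y -> Z y.
Proof.
move=> [[Z0 ZD] ZE] Zx; elim=> // *; first exact: ZD.
exact: ZE.
Qed.

Lemma cyc_trans y x z : cyc x y -> cyc y z -> cyc x z.
Proof. by move=> xy; apply: cyc_min xy => //; exact: stable_cyc. Qed.

Lemma stable0 : stable (fun x => x = 0).
Proof. by split; [exact: subspace0|move=> a b x ->; rewrite gE0]. Qed.

Section Mod.
Variable Z : X -> Prop.
Hypothesis sZ : stable Z.
Let sub := sZ.1.
Local Notation "x == y %[Z]" := (cg Z x y) (at level 70, y at next level, format "x  ==  y  %[Z]").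

Definition wtm lam x := forall a, E a a x == lam a *: x %[Z].

Lemma cgE a b x y : x == y %[Z] -> E a b x == E a b y %[Z].
Proof. by apply: cgT => //; [exact: gE_lin|exact: sZ.2]. Qed.

Lemma wtm_E lam x a b : wtm lam x ->
  wtm (fun c => lam c + (c == a)%:R - (c == b)%:R) (E a b x).
Proof.
move=> wx c; rewrite gE_comm.
have -> : (lam c + (c == a)%:R - (c == b)%:R) *: E a b x =
  E a b (lam c *: x) + ((c == a)%:R *: E c b x - (c == b)%:R *: E a c x).
  rewrite gEZ -addrA scalerDl scalerBl; congr (_ + (_ - _)).
    by case: eqP => [->//|]; rewrite !scale0r.
  by case: eqP => [->//|]; rewrite !scale0r.
by apply: cgD => //; [exact: cgE|exact: cg_refl].
Qed.

Lemma wtm_iter lam x a b k : a != b -> wtm lam x ->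
  wtm (fun c => lam c + k%:R * ((c == a)%:R - (c == b)%:R)) (iter k (E a b) x).
Proof.
move=> ab wx; elim: k => [|k IH] c /=; first by rewrite mul0r addr0; exact: wx.
have -> : lam c + k.+1%:R * ((c == a)%:R - (c == b)%:R) =
  lam c + k%:R * ((c == a)%:R - (c == b)%:R) + (c == a)%:R - (c == b)%:R.
  by rewrite -natr1; ring.
exact: (wtm_E a b IH).
Qed.

(** The iterates stay in a finite span while their weights at [a] are [lam a + k], pairwise distinct
    in characteristic 0. *)
Lemma wtm_nilp lam x a b : a != b -> wtm lam x ->
  exists k, Z (iter k (E a b) x).
Proof.
move=> ab wx; have [d [B [Bx BE]]] := gE_lf E x.
apply: (@eigen_bound _ _ Z sub (E a a) _ _ (fun k => lam a + k%:R) _ _ _ d B).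
- exact: gE_lin.
- exact: sZ.2.
- by move=> j k /addrI/(natF_inj charF).
- move=> k; have := wtm_iter k ab wx a.
  by rewrite eqxx (negPf ab) subr0 mulr1.
- by elim=> //= k; exact: BE.
Qed.

(** The sl(2) identity for e = [E a b], f = [E b a], h = [E a a - E b b]: e f^(k+1) x = (k+1)(h-k)
    f^k x on a vector killed by e. *)
Lemma sl2_iter lam x a b k : a != b -> wtm lam x -> Z (E a b x) ->
  E a b (iter k.+1 (E b a) x) ==
  (k.+1%:R * (lam a - lam b - k%:R)) *: iter k (E b a) x %[Z].
Proof.
move=> ab wx Zx; have ba : b != a by rewrite eq_sym.
have step y : E a b (E b a y) = E b a (E a b y) + (E a a y - E b b y).
  by rewrite gE_comm !eqxx !scale1r.
elim: k => [|k IH]; rewrite [iter _.+1 _ _]/= step.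
  rewrite mul1r subr0 -[X in _ == X %[Z]]add0r; apply: cgD => //.
    by apply/cg0; exact: sZ.2.
  by rewrite scalerBl; apply: cgB => //; exact: wx.
have wk := wtm_iter k.+1 ba wx.
apply: (@cg_trans _ _ _ sub (E b a ((k.+1%:R * (lam a - lam b - k%:R)) *: iter k (E b a) x) +
  (lam a - k.+1%:R - (lam b + k.+1%:R)) *: iter k.+1 (E b a) x)).
  apply: cgD => //; first exact: cgE.
  rewrite scalerBl; apply: cgB => //.
    by have := wk a; rewrite eqxx (negPf ab) sub0r mulrN1.
  by have := wk b; rewrite eqxx (negPf ba) subr0 mulr1.
rewrite gEZ -scalerDl; set u := _ *: _; set v := _ *: _.
suff -> : u = v by exact: cg_refl.
rewrite /u /v; congr (_ *: _); rewrite -!natr1; ring.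
Qed.

(** With [n.+1] the first exponent at which the iterate lies in [Z], the sl(2) identity puts a
    multiple of the n-th iterate in [Z], so its coefficient vanishes. *)
Lemma hw_dominant lam x a b : a != b -> wtm lam x -> Z (E a b x) -> ~ Z x ->
  exists n, [/\ lam a - lam b = n%:R, ~ Z (iter n (E b a) x) &
    Z (iter n.+1 (E b a) x)].
Proof.
move=> ab wx Zx nZ; have ba : b != a by rewrite eq_sym.
have [k0 Zk0] := wtm_nilp ba wx.
have ex : exists k, `[< Z (iter k (E b a) x) >] by exists k0; apply/asboolP.
case: (ex_minnP ex) => -[|n] /asboolP Zn minn; first by [].
have nZn : ~ Z (iter n (E b a) x).
  by move=> h; have := minn n (asboolT h); rewrite ltnn.
exists n; split=> //.
have := cg_mem sub (cg_sym sub (sl2_iter n ab wx Zx)) (sZ.2 a b _ Zn).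
have [|nz] := eqVneq (n.+1%:R * (lam a - lam b - n%:R)) 0.
  move/eqP; rewrite mulf_eq0 => /orP[/eqP h|]; last by rewrite subr_eq0 => /eqP.
  by have := natF_inj charF (h : n.+1%:R = 0%:R).
move=> /(subspaceZ (n.+1%:R * (lam a - lam b - n%:R))^-1 sub).
by rewrite scalerA mulVf// scale1r.
Qed.

(* Every raising operator strictly increases the functional [h], and only
   finitely many eigenvalues of [T] occur in the finite-dimensional span [B]. *)
Lemma raise (P : X -> Prop) lam x : wtm lam x -> ~ Z x -> P x ->
  (forall a b y, (a < b)%N -> P y -> P (E a b y)) ->
  exists y mu, [/\ wtm mu y, ~ Z y, P y &
    forall a b, (a < b)%N -> Z (E a b y)].
Proof.
move=> wx nZ Px PE; have [d [B [Bx BE]]] := gE_lf E x.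
(* [E a b] adds 1 to the weight at [a] and subtracts 1 at [b], so with coefficients [- c] the
   eigenvalue of [T] grows by [b - a]. *)
pose T y := \sum_(c < m) (- (c%:R : F)) *: E c c y.
have T_lin c u v : T (c *: u + v) = c *: T u + T v.
  rewrite /T scaler_sumr -big_split; apply: eq_bigr => i _ /=.
  by rewrite gE_lin scalerDr !scalerA mulrC.
have TZ y : Z y -> Z (T y).
  by move=> Zy; apply: subspace_sum => // i _; apply: subspaceZ => //; exact: sZ.2.
pose h mu : F := \sum_(c < m) (- (c%:R : F)) * mu c.
have Twt mu y : wtm mu y -> T y == h mu *: y %[Z].
  move=> wy; rewrite /T /h scaler_suml; apply: cg_sum => // i.
  by rewrite -scalerA; exact: (cgZ sub _ (wy i)).
pose good n y := exists mu, [/\ wtm mu y, ~ Z y, P y, spn B y &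
  h mu = h lam + n%:R].
have g0 : good 0%N x by exists lam; split=> //; rewrite addr0.
apply: contrapT => noh.
have up n y : good n y -> exists n' y', (n < n')%N /\ good n' y'.
  move=> [mu [wy nZy Py By hy]].
  have [] := pselect (forall a b, (a < b)%N -> Z (E a b y)).
    by move=> all0; case: noh; exists y, mu.
  move=> /existsNP[a /existsNP[b /not_implyP[ab nZE]]].
  exists (n + (b - a))%N, (E a b y); split; first by rewrite -[ltnLHS]addn0 ltn_add2l subn_gt0.
  exists (fun c => mu c + (c == a)%:R - (c == b)%:R); split=> //; first exact: wtm_E.
  - exact: PE.
  - exact: BE.
  rewrite /h; under eq_bigr do rewrite mulrBr mulrDr.
  rewrite sumrB big_split /= -/(h mu) hy.
  have D e : \sum_(i < m) - (i%:R : F) * (i == e)%:R = - e%:R.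
    by rewrite (bigD1 e)//= eqxx mulr1 big1 ?addr0// => i /negPf->; rewrite mulr0.
  by rewrite -/(h lam) !D opprK natrD natrB ?(ltnW ab)//; ring.
have /choice[f fP] : forall p : nat * X, exists q : nat * X,
    good p.1 p.2 -> (p.1 < q.1)%N /\ good q.1 q.2.
  move=> [n y] /=; have [/up[n' [y' [? ?]]]|ng] := pselect (good n y).
    by exists (n', y').
  by exists (n, y).
pose q k := iter k f (0%N, x).
have qg k : good (q k).1 (q k).2 by elim: k => //= k /fP[].
have qlt k : ((q k).1 < (q k.+1).1)%N by case: (fP _ (qg k)).
have qinj : injective (fun k => (q k).1).
  move=> i j; have H := @homo_ltn _ (fun k => (q k).1) _ (@ltn_trans) qlt.
  by case: (ltngtP i j) => // /H lt e; rewrite e ltnn in lt.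
have := @eigen_bound _ _ Z sub T T_lin TZ (fun k => h lam + (q k).1%:R)
    (fun k => (q k).2) _ _ d B _.
case.
- by move=> i j /addrI/(natF_inj charF)/qinj.
- by move=> k; have [mu [wy _ _ _ <-]] := qg k; exact: Twt.
- by move=> k; have [mu [_ _ _ By _]] := qg k.
by move=> k; have [mu [_ nZy _ _ _]] := qg k.
Qed.

End Mod.
End GlRep.

(** Take a nonzero polynomial p of least size with p(T) x in [Z] and divide it by X - r for a root
    r: the quotient q has q(T) x outside [Z] by minimality, while T - r sends q(T) x into [Z]. *)
Lemma eigenvector_mod (F : closedFieldType) (X : lmodType F) (T : X -> X)
    (Z P : X -> Prop) d (B : 'I_d -> X) (x : X) :
  (forall (c : F) (u v : X), T (c *: u + v) = c *: T u + T v) ->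
  subspace Z -> subspace P -> (forall y, P y -> P (T y)) ->
  (forall y, spn B y -> spn B (T y)) -> spn B x -> P x -> ~ Z x ->
  exists y r, [/\ P y, ~ Z y & Z (T y - r *: y)].
Proof.
move=> T_lin sZ sP PT BT Bx Px nZ.
pose pact (p : {poly F}) := \sum_(i < size p) p`_i *: iter i T x.
have pactE n (p : {poly F}) : (size p <= n)%N ->
    pact p = \sum_(i < n) p`_i *: iter i T x.
  move=> pn; rewrite /pact (big_ord_widen n (fun i => p`_i *: iter i T x))//.
  rewrite big_mkcond; apply: eq_bigr => i _; case: ltnP => // /leq_sizeP->//.
  by rewrite scale0r.
have pactX r q : pact (q * ('X - r%:P)) = T (pact q) - r *: pact q.
  rewrite (@pactE (size q).+1 (q * ('X - r%:P))); last first.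
    by apply: leq_trans (size_polyMleq _ _) _; rewrite size_XsubC addn2.
  rewrite mulrBr; under eq_bigr do rewrite coefB coefMX coefMC scalerBl.
  rewrite sumrB; congr (_ - _).
    rewrite big_ord_recl /= scale0r add0r /pact (lin_sum T_lin).
    by apply: eq_bigr => i _; rewrite (linZ T_lin).
  rewrite big_ord_recr /= nth_default// mul0r scale0r addr0 scaler_sumr.
  by apply: eq_bigr => i _; rewrite scalerA mulrC.
have Pit k : P (iter k T x) by elim: k => //= k; exact: PT.
have Bit k : spn B (iter k T x) by elim: k => //= k; exact: BT.
pose good n := exists2 p : {poly F}, p != 0 & (size p = n) /\ Z (pact p).
have [n0 gn0] : exists n, `[< good n >].
  have [c [k ck] c0] := @spn_dependent _ _ _ B d.+1 (fun k => iter k T x) (ltnSn d) (fun k => Bit k).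
  pose p := \poly_(i < d.+1) (if insub i is Some j then c j else 0).
  exists (size p); apply/asboolP; exists p.
    apply: contra_neq ck => p0; have := coef_poly d.+1 (fun i => if insub i is Some j then c j else 0) k.
    by rewrite -/p p0 coef0 ltn_ord valK.
  split=> //; rewrite (@pactE d.+1) ?size_poly// (_ : \sum_(i < _) _ = 0); first by case: sZ.
  by rewrite -[RHS]c0; apply: eq_bigr => i _; rewrite coef_poly ltn_ord valK.
case: (ex_minnP (ex_intro (fun n => `[< good n >]) n0 gn0)) => n /asboolP[p p0 [sp Zp]] minn.
have sp1 : size p != 1%N.
  apply/eqP => /eqP/size_poly1P[c c0 pc]; apply: nZ; move: Zp.
  rewrite (@pactE 1) ?pc ?size_polyC_leq1// big_ord1 coefC /=.
  by move=> /(subspaceZ c^-1 sZ); rewrite scalerA mulVf// scale1r.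
have /closed_rootP[r /factor_theorem[q pq]] := sp1.
have q0 : q != 0 by apply: contra_neq p0 => q0; rewrite pq q0 mul0r.
exists (pact q), r; split; last by rewrite -pactX -pq.
  by apply: subspace_sum => // i _; apply: subspaceZ.
move=> Zq; have := minn (size q) (asboolT (ex_intro2 _ _ q q0 (conj erefl Zq))).
by rewrite -sp pq size_Mmonic ?monicXsubC// size_XsubC addn2 ltnn.
Qed.

Section GlRep.
Variables (F : closedFieldType) (charF : [pchar F] =i pred0).
Variables (m : nat) (X : lmodType F) (E : glrep m X).
Implicit Types (x y z : X) (a b : 'I_m) (lam mu : 'I_m -> F).

(** The diagonal operators are treated one by one; as they commute, the joint eigenspace modulo [Z]
    of those already treated is stable under the next. *)
Lemma torus_eigenvector (Z : X -> Prop) x : stable E Z -> ~ Z x ->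
  exists y lam, [/\ cyc E x y, ~ Z y & wtm E Z lam y].
Proof.
move=> sZ nZ.
suff H (l : seq 'I_m) : exists y lam, [/\ cyc E x y, ~ Z y &
    forall a, a \in l -> cg Z (E a a y) (lam a *: y)].
  have [y [lam [xy nZy wy]]] := H (enum 'I_m).
  by exists y, lam; split=> // a; apply: wy; rewrite mem_enum.
elim: l => [|a l [y [lam [xy nZy wy]]]].
  by exists x, (fun=> 0); split=> //; exact: cyc_gen.
pose P z := cyc E x z /\ forall b, b \in l -> cg Z (E b b z) (lam b *: z).
have sP : subspace P.
  split=> [|c u v [xu wu] [xv wv]].
    split=> [|b _]; first by case: (stable_cyc E x) => -[].
    by rewrite gE0 scaler0; apply: cg_refl; case: sZ.
  split=> [|b bl]; first exact: cyc_lin.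
  rewrite gE_lin scalerDr scalerA mulrC -scalerA.
  by apply: cgD; [case: sZ|apply: cgZ; [case: sZ|exact: wu]|exact: wv].
have [d [B [By BE]]] := gE_lf E y.
have PE z : P z -> P (E a a z).
  move=> [xz wz]; split=> [|b bl]; first exact: cyc_E.
  have -> : E b b (E a a z) = E a a (E b b z).
    by rewrite gE_comm; case: eqP => [->|_]; rewrite ?scale0r subrr addr0.
  by rewrite -gEZ; apply: cgE => //; exact: wz.
have [z [r [Pz nZz Zr]]] := eigenvector_mod (gE_lin E a a) sZ.1 sP PE
  (BE a a) By (conj xy wy) nZy.
case: Pz => xz wz.
exists z, (fun b => if b == a then r else lam b); split=> // b.
rewrite inE; case: eqP => [-> _|_]; first exact: Zr.
exact: wz.
Qed.

Lemma hw_exists (Z : X -> Prop) x : stable E Z -> ~ Z x ->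
  exists y lam, [/\ cyc E x y, ~ Z y, wtm E Z lam y &
    forall a b, (a < b)%N -> Z (E a b y)].
Proof.
move=> sZ nZ; have [y [lam [xy nZy wy]]] := torus_eigenvector sZ nZ.
have [|z [mu [wz nZz xz hz]]] := raise charF sZ (P := cyc E x) wy nZy xy.
  by move=> a b z _; exact: cyc_E.
by exists z, mu.
Qed.

Definition wt lam x := forall a, E a a x = lam a *: x.

Lemma wt_wtm lam x : wt lam x <-> wtm E (fun z => z = 0) lam x.
Proof.
split=> wx a; first by rewrite /cg wx subrr.
by apply/eqP; rewrite -subr_eq0; apply/eqP; exact: wx.
Qed.

Definition hw lam x := wt lam x /\ forall a b, (a < b)%N -> E a b x = 0.

Lemma wt_E lam x a b : wt lam x ->
  wt (fun c => lam c + (c == a)%:R - (c == b)%:R) (E a b x).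
Proof. by move=> /wt_wtm wx; apply/wt_wtm; exact: (wtm_E (stable0 E) a b wx). Qed.

(** A list of index pairs stands for a sum of roots. [monomial] applies the opposite root vectors,
    hence subtracts this sum from the weight. *)
Definition shift (l : seq ('I_m * 'I_m)) (c : 'I_m) : F :=
  \sum_(p <- l) ((c == p.1)%:R - (c == p.2)%:R).

Definition raising (l : seq ('I_m * 'I_m)) := all (fun p : 'I_m * 'I_m => p.1 < p.2)%N l.

Definition monomial (l : seq ('I_m * 'I_m)) x :=
  foldr (fun p z => E p.2 p.1 z) x l.

Lemma wt_monomial lam x l : wt lam x ->
  wt (fun c => lam c - shift l c) (monomial l x).
Proof.
move=> wx; elim: l => [|p l IH] c /=.
  by rewrite /shift big_nil subr0.
have := wt_E p.2 p.1 IH c; rewrite /shift big_cons => ->; congr (_ *: _).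
by rewrite opprD opprB; ring.
Qed.

Inductive lowspan x : X -> Prop :=
| lowspan0 : lowspan x 0
| lowspanD c l y of raising l & lowspan x y : lowspan x (c *: monomial l x + y).

Lemma lowspan_lin x c y z : lowspan x y -> lowspan x z -> lowspan x (c *: y + z).
Proof.
move=> ly lz; elim: ly => [|d l {}y rl _ IH]; first by rewrite scaler0 add0r.
by rewrite scalerDr -addrA scalerA; exact: lowspanD.
Qed.

Lemma lowspan_monomial x l : raising l -> lowspan x (monomial l x).
Proof.
move=> rl; rewrite -[monomial _ _]scale1r -[_ *: _]addr0.
by apply: lowspanD => //; exact: lowspan0.
Qed.

(** The part of the Poincare-Birkhoff-Witt theorem that is needed: moving any matrix unit to the
    right through a lowering monomial produces shorter monomials, and at the end the unit meets
    [x]. *)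
Lemma lowspan_cyc lam x y : hw lam x -> cyc E x y -> lowspan x y.
Proof.
move=> [wx hx].
have sub : subspace (lowspan x).
  by split; [exact: lowspan0|move=> *; exact: lowspan_lin].
have lw a b y' : (a < b)%N -> lowspan x y' -> lowspan x (E b a y').
  move=> ab; elim=> [|c l z rl _ IH]; first by rewrite gE0; exact: lowspan0.
  rewrite gE_lin; apply: (@lowspanD x c ((a, b) :: l)) => //.
  by rewrite /raising /= ab.
have mE l : raising l -> forall a b, lowspan x (E a b (monomial l x)).
  elim: l => [_ a b|p l IH /= /andP[p12 rl] a b].
    case: (ltngtP a b) => [/hx|ab|/val_inj->] /=; first by move->; exact: lowspan0.
      by apply: lw => //; exact: lowspan_monomial [::] isT.
    by rewrite wx; apply: subspaceZ => //; exact: lowspan_monomial [::] isT.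
  rewrite gE_comm; apply: subspaceD => //; first by apply: lw => //; exact: IH.
  by apply: subspaceB => //; apply: subspaceZ => //; exact: IH.
move=> xy; apply: (cyc_min _ _ xy); last exact: lowspan_monomial [::] isT.
split=> // a b z; elim=> [|c l {}z rl _ IH]; first by rewrite gE0; exact: lowspan0.
by rewrite gE_lin; apply: lowspan_lin => //; exact: mE.
Qed.

Definition torus_op (G : seq ('I_m * F)) x :=
  foldr (fun g z => E g.1 g.1 z - g.2 *: z) x G.

Lemma torus_op_wt lam x G : wt lam x ->
  torus_op G x = (\prod_(g <- G) (lam g.1 - g.2)) *: x.
Proof.
move=> wx; elim: G => [|g G IH] /=; first by rewrite big_nil scale1r.
by rewrite IH gEZ wx !scalerA -scalerBl big_cons mulrBl [_ * lam _]mulrC.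
Qed.

Lemma torus_op_lin G c x y :
  torus_op G (c *: x + y) = c *: torus_op G x + torus_op G y.
Proof.
elim: G => //= g G ->; rewrite gE_lin scalerDr scalerBr opprD !scalerA.
by rewrite [g.2 * c]mulrC addrACA.
Qed.

(** A product of torus operators kills every nonempty lowering monomial, whose weight is not [mu],
    but acts on weight [mu] by a nonzero scalar. Only the part [d *: x] from the empty monomials
    remains, and a further factor kills it too unless [lam] is [mu]. *)
Lemma lowspan_wt lam mu x y : wt lam x -> wt mu y -> lowspan x y ->
  (forall l, raising l -> l != [::] -> ~ (forall c, lam c = mu c + shift l c)) ->
  y != 0 -> (forall c, lam c = mu c) /\ exists c, y = c *: x.
Proof.
move=> wx wy ly nl y0.
have [d [G [Gmu Gy]]] : exists d G, (forall g, g \in G -> mu g.1 - g.2 != 0) /\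
    torus_op G (y - d *: x) = 0.
  elim: ly {wy y0} => [|c l z rl _ [d [G [Gmu Gz]]]].
    by exists 0, [::]; split=> //=; rewrite scale0r subrr.
  have [->|l0] := eqVneq l [::].
    exists (c + d), G; split=> //; rewrite -[RHS]Gz; congr (torus_op _ _).
    by rewrite /= scalerDl opprD addrACA subrr add0r.
  have [a /eqP ha] : exists a, lam a <> mu a + shift l a.
    by apply/existsNP; exact: nl.
  exists d, ((a, lam a - shift l a) :: G); split=> [g|].
    rewrite inE => /orP[/eqP->/=|/Gmu//].
    apply: contra_neq ha => /eqP; rewrite subr_eq0 => /eqP ->.
    by rewrite subrK.
  rewrite -addrA /= torus_op_lin Gz addr0 gEZ.
  have wG := torus_op_wt G (wt_monomial l wx).
  rewrite !wG !gEZ (wt_monomial l wx) !scalerA.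
  by rewrite [(_ - _) * c]mulrC -mulrA [_ * (_ - _)]mulrC mulrA subrr.
have prod0 (nu : 'I_m -> F) : (forall a, nu a = mu a) -> \prod_(g <- G) (nu g.1 - g.2) != 0.
  by move=> e; rewrite prodf_seq_neq0; apply/allP => g /Gmu; rewrite e.
have [lm|/existsNP[a /eqP la]] := pselect (forall c, lam c = mu c).
  split=> //; exists d; apply/eqP; rewrite -subr_eq0.
  have w : wt mu (y - d *: x).
    by move=> a; rewrite gEB gEZ wy wx lm scalerBr !scalerA mulrC.
  move: Gy; rewrite (torus_op_wt _ w) => /eqP; rewrite scaler_eq0.
  by rewrite (negPf (prod0 mu (fun=> erefl))).
exfalso; move/negP: y0; apply.
have : torus_op ((a, lam a) :: G) y = 0.
  have : torus_op ((a, lam a) :: G) (y - d *: x) = 0 by rewrite /= Gy gE0 scaler0 subrr.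
  rewrite addrC -scaleNr torus_op_lin (torus_op_wt _ wx) big_cons /= subrr mul0r.
  by rewrite scale0r scaler0 add0r.
rewrite (torus_op_wt _ wy) big_cons /= => /eqP; rewrite scaler_eq0 mulf_eq0.
by rewrite subr_eq0 eq_sym (negPf la) (negPf (prod0 mu (fun=> erefl))).
Qed.

End GlRep.

(** * The Casimir operator and simplicity of highest weight modules *)

Section Casimir.
Variables (F : closedFieldType) (charF : [pchar F] =i pred0).
Variables (m : nat) (X : lmodType F) (E : glrep m X).
Implicit Types (x y z : X) (a b : 'I_m) (lam mu : 'I_m -> F).

Definition casimir y := \sum_a \sum_b E a b (E b a y).

Lemma casimir_comm c d y : E c d (casimir y) = casimir (E c d y).
Proof.
have pick (V : lmodType F) (e : 'I_m) (f : 'I_m -> V) : \sum_a (e == a)%:R *: f a = f e.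
  rewrite (bigD1 e)//= eqxx scale1r big1 ?addr0// => i.
  by rewrite eq_sym => /negPf->; rewrite scale0r.
rewrite /casimir gE_sum; under eq_bigr do rewrite gE_sum.
have EE a b : E c d (E a b (E b a y)) = E a b (E b a (E c d y)) +
   (((d == b)%:R *: E a b (E c a y) - (c == a)%:R *: E a b (E b d y)) +
    ((d == a)%:R *: E c b (E b a y) - (c == b)%:R *: E a d (E b a y))).
  by rewrite [LHS]gE_comm [E c d (E b a y)]gE_comm gED gEB !gEZ -addrA.
under eq_bigr do under eq_bigr do rewrite EE.
under eq_bigr do rewrite big_split /=; rewrite big_split /= -[RHS]addr0; congr (_ + _).
under eq_bigr do rewrite big_split /= !sumrB !pick.
rewrite big_split /= !sumrB.
under [X in _ - X + _]eq_bigr do rewrite -scaler_sumr.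
under [X in _ + (X - _)]eq_bigr do rewrite -scaler_sumr.
by rewrite !pick addrC addrA subrK subrr.
Qed.

(** The classical (lam, lam + 2 rho), with 2 rho written as the sum of the positive roots. *)
Definition cas (lam : 'I_m -> F) : F := \sum_a lam a ^+ 2 +
  \sum_(a < m) \sum_(b < m) (if (a < b)%N then lam a - lam b else 0).

Lemma casimir_lin c x y : casimir (c *: x + y) = c *: casimir x + casimir y.
Proof.
rewrite /casimir scaler_sumr -big_split; apply: eq_bigr => a _ /=.
by rewrite scaler_sumr -big_split; apply: eq_bigr => b _ /=; rewrite !gE_lin.
Qed.

Lemma casimir_hwm Z lam x : stable E Z -> wtm E Z lam x ->
  (forall a b, (a < b)%N -> Z (E a b x)) -> cg Z (casimir x) (cas lam *: x).
Proof.
move=> sZ wx hx; have sub := sZ.1.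
have EE a b : cg Z (E a b (E b a x)) (((a == b)%:R * lam a ^+ 2) *: x +
    (if (a < b)%N then lam a - lam b else 0) *: x).
  case: (ltngtP a b) => [ab|ab|/val_inj->].
  - rewrite gE_comm !eqxx !scale1r -[X in cg _ _ X]add0r.
    rewrite (_ : (a == b) = false) ?mul0r ?scale0r ?add0r; last by apply/eqP => e; rewrite e ltnn in ab.
    rewrite -[X in cg _ _ X]add0r scalerBl; apply: cgD => //; last by apply: cgB => //; exact: wx.
    by apply/cg0; apply: sZ.2; exact: hx.
  - rewrite (_ : (a == b) = false) ?mul0r ?scale0r ?add0r; last by apply/eqP => e; rewrite e ltnn in ab.
    by apply/cg0; apply: sZ.2; exact: hx.
  - rewrite eqxx mul1r scale0r addr0 expr2 -scalerA.
    apply: (@cg_trans _ _ _ sub (E b b (lam b *: x))); first by apply: cgE.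
    by rewrite gEZ; apply: cgZ.
have -> : cas lam *: x = \sum_a \sum_b (((a == b)%:R * lam a ^+ 2) *: x +
    (if (a < b)%N then lam a - lam b else 0) *: x).
  under eq_bigr do rewrite big_split /=.
  rewrite big_split /= scalerDl; congr (_ + _).
    rewrite scaler_suml; apply: eq_bigr => a _; rewrite -scaler_suml; congr (_ *: _).
    by rewrite (bigD1 a)//= eqxx mul1r big1 ?addr0// => b; rewrite eq_sym => /negPf->; rewrite mul0r.
  by rewrite scaler_suml; apply: eq_bigr => a _; rewrite scaler_suml.
by apply: cg_sum => // a; apply: cg_sum => // b.
Qed.

Lemma casimir_hw lam x : hw E lam x -> casimir x = cas lam *: x.
Proof.
move=> [/wt_wtm wx hx]; have := casimir_hwm (stable0 E) wx hx.
by move/eqP; rewrite subr_eq0 => /eqP.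
Qed.

Lemma casimir_cyc lam x y : hw E lam x -> cyc E x y -> casimir y = cas lam *: y.
Proof.
move=> hx; elim=> [|c u v _ IHu _ IHv|a b u _ IH]; first exact: casimir_hw.
  by rewrite casimir_lin IHu IHv scalerDr !scalerA mulrC.
by rewrite -casimir_comm IH gEZ.
Qed.

Definition dominant lam := forall a b, (a < b)%N -> exists n : nat, lam a - lam b = n%:R.

Lemma dominant_hw lam x : hw E lam x -> x != 0 -> dominant lam.
Proof.
move=> [wx hx] x0 a b ab.
have nab : a != b by apply/eqP => e; rewrite e ltnn in ab.
have [n [-> _ _]] := hw_dominant charF (stable0 E) nab ((wt_wtm E lam x).1 wx)
  (hx a b ab) (fun xZ => negP x0 (introT eqP xZ)).
by exists n.
Qed.

Lemma sum_ord_lt (p : 'I_m) : \sum_(a < m) (a < p)%:R = p%:R :> F.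
Proof.
rewrite -natr_sum; congr _%:R.
rewrite -[RHS]card_ord -sum1_card (big_ord_widen m (fun=> 1%N)) ?(ltnW (ltn_ord p))//.
by rewrite [RHS]big_mkcond; apply: eq_bigr => i _; case: ltnP.
Qed.

(** For delta = lam - mu the difference of Casimir values is (delta, lam + mu) + (delta, 2 rho),
    linear in delta and a positive integer on each positive root. *)
Lemma cas_raising lam mu l : raising l -> l != [::] ->
  dominant lam -> dominant mu -> (forall c, lam c = mu c + shift F l c) ->
  cas lam <> cas mu.
Proof.
move=> rl l0 dlam dmu e.
pose D (delta : 'I_m -> F) := \sum_a delta a * (lam a + mu a) +
  \sum_(a < m) \sum_(b < m) (if (a < b)%N then delta a - delta b else 0).
have casD : cas lam - cas mu = D (shift F l).
  have dE a : shift F l a = lam a - mu a by rewrite e addrC addKr.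
  rewrite /cas opprD addrACA /D; congr (_ + _).
    by rewrite -sumrB; apply: eq_bigr => a _; rewrite dE subr_sqr.
  rewrite -sumrB; apply: eq_bigr => a _; rewrite -sumrB; apply: eq_bigr => b _.
  by case: ifP => _; rewrite ?subr0// !dE; ring.
have Dp (p : 'I_m * 'I_m) : (p.1 < p.2)%N -> exists n : nat,
    D (fun c => (c == p.1)%:R - (c == p.2)%:R) = n.+1%:R.
  move=> p12; have [n1 n1E] := dlam _ _ p12; have [n2 n2E] := dmu _ _ p12.
  have pick (f : 'I_m -> F) q : \sum_a (a == q)%:R * f a = f q.
    rewrite (bigD1 q)//= eqxx mul1r big1 ?addr0// => i /negPf->.
    by rewrite mul0r.
  have H (q : 'I_m) : \sum_(a < m) \sum_(b < m) (if (a < b)%N then (a == q)%:R - (b == q)%:R else 0)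
      = m%:R - 1 - q%:R *+ 2 :> F.
    have -> : \sum_(a < m) \sum_(b < m) (if (a < b)%N then (a == q)%:R - (b == q)%:R else 0) =
      \sum_(a < m) (a == q)%:R * (\sum_(b < m) (a < b)%:R) -
      \sum_(b < m) (b == q)%:R * (\sum_(a < m) (a < b)%:R) :> F.
      under [X in _ = X - _]eq_bigr do rewrite mulr_sumr.
      under [X in _ = _ - X]eq_bigr do rewrite mulr_sumr.
      rewrite [X in _ = _ - X]exchange_big -sumrB; apply: eq_bigr => a _ /=.
      rewrite -sumrB; apply: eq_bigr => b _ /=.
      by case: ifP; rewrite ?mulr1 ?mulr0 ?subrr.
    rewrite !pick sum_ord_lt.
    have -> : \sum_(b < m) (q < b)%:R = m%:R - 1 - q%:R :> F.
      have : \sum_(b < m) ((q < b)%:R + (b == q)%:R + (b < q)%:R) = m%:R :> F.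
        have -> : m%:R = (\sum_(b < m) 1%N)%:R :> F by rewrite sum1_card card_ord.
        rewrite natr_sum; apply: eq_bigr => b _.
        rewrite -val_eqE /=; case: ltngtP; rewrite ?addr0 ?add0r//.
      rewrite !big_split /= sum_ord_lt => <-.
      under [X in _ = _ + X + _ - _ - _]eq_bigr do rewrite -[(_ == _)%:R]mulr1.
      by rewrite pick; ring.
    by rewrite mulr2n opprD addrA.
  (* Dominance of [lam] and [mu] contributes [n1] and [n2]; the pairing of the root with 2 rho
     contributes [2 (p.2 - p.1)], which is positive. *)
  exists (n1 + n2 + (p.2 - p.1).*2.-1)%N; rewrite /D.
  have -> : \sum_a ((a == p.1)%:R - (a == p.2)%:R) * (lam a + mu a) = n1%:R + n2%:R :> F.
    under eq_bigr do rewrite mulrBl.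
    by rewrite sumrB !pick -n1E -n2E; ring.
  have -> : \sum_(a < m) \sum_(b < m) (if (a < b)%N then
      ((a == p.1)%:R - (a == p.2)%:R) - ((b == p.1)%:R - (b == p.2)%:R) else 0) =
      (m%:R - 1 - (p.1 : nat)%:R *+ 2) - (m%:R - 1 - (p.2 : nat)%:R *+ 2) :> F.
    rewrite -!H -sumrB; apply: eq_bigr => a _; rewrite -sumrB; apply: eq_bigr => b _.
    by case: ifP => _; rewrite ?subrr//; ring.
  have -> : (n1 + n2 + (p.2 - p.1).*2.-1).+1 = (n1 + n2 + ((p.2 - p.1) + (p.2 - p.1)))%N by lia.
  by rewrite !natrD natrB ?(ltnW p12)//; ring.
have DD l' : raising l' -> exists n : nat, D (shift F l') = n%:R /\ (l' != [::] -> (0 < n)%N).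
  elim: l' => [_|p l' IH /= /andP[/Dp[n nE] /IH[n' [n'E _]]]].
    exists 0%N; split=> //; rewrite /D big1 ?add0r => [|a _]; last by rewrite /shift big_nil mul0r.
    by rewrite big1// => a _; rewrite big1// => b _; rewrite /shift !big_nil subrr if_same.
  exists (n.+1 + n')%N; split=> //; rewrite natrD -nE -n'E /D addrACA; congr (_ + _).
    by rewrite -big_split; apply: eq_bigr => a _ /=; rewrite /shift big_cons mulrDl.
  rewrite -big_split; apply: eq_bigr => a _ /=; rewrite -big_split; apply: eq_bigr => b _ /=.
  by case: ifP => _; rewrite ?addr0//= /shift !big_cons; ring.
have [n [nE /(_ l0)]] := DD l rl.
move=> n0 ce; move: casD; rewrite ce subrr nE => /esym h.
by have n00 := natF_inj charF (h : n%:R = 0%:R); rewrite n00 in n0.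
Qed.

(** The Casimir operator acts on the whole cyclic module by one scalar, so a second highest weight
    cannot lie strictly below the first. *)
Lemma hw_in_cyc lam mu x y : hw E lam x -> hw E mu y -> cyc E x y -> y != 0 ->
  (forall c, lam c = mu c) /\ exists c, y = c *: x.
Proof.
move=> hx hy xy y0.
have x0 : x != 0.
  apply: contra_neq y0 => x0; move: xy; rewrite x0.
  by apply: (cyc_min (stable0 E)).
apply: (lowspan_wt (E := E)) => //; [exact: hx.1|exact: hy.1|exact: lowspan_cyc hx xy|].
move=> l rl l0 e; apply: (cas_raising rl l0 (dominant_hw hx x0) (dominant_hw hy y0) e).
have := casimir_cyc hx xy; rewrite (casimir_hw hy) => /eqP.
by rewrite -subr_eq0 -scalerBl scaler_eq0 (negPf y0) orbF subr_eq0 => /eqP.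
Qed.

Lemma hw_simple lam x y : hw E lam x -> cyc E x y -> y != 0 -> cyc E y x.
Proof.
move=> hx xy y0.
have [z [mu [yz z0 wz hz]]] := hw_exists charF (stable0 E) (fun yZ : y = 0 => negP y0 (introT eqP yZ)).
have hwz : hw E mu z by split=> //; apply/wt_wtm.
have [||_ [c zc]] := hw_in_cyc hx hwz; [exact: cyc_trans yz|exact/eqP|].
have c0 : c != 0 by apply/eqP => c0; apply: z0; rewrite zc c0 scale0r.
have -> : x = c^-1 *: z + 0 by rewrite addr0 zc scalerA mulVf// scale1r.
by apply: cyc_lin => //; case: (stable_cyc E y) => -[].
Qed.

End Casimir.

(** * Complete reducibility of locally finite representations *)

Section Weyl.
Variables (F : closedFieldType) (charF : [pchar F] =i pred0).
Variables (m : nat) (X : lmodType F) (E : glrep m X).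
Implicit Types (x y z : X) (a b : 'I_m) (lam mu : 'I_m -> F).

Inductive hwsum : X -> Prop :=
| hwsum0 : hwsum 0
| hwsumD lam w z y of hw E lam w & w != 0 & cyc E w z & hwsum y : hwsum (z + y).

Lemma stable_hwsum : stable E hwsum.
Proof.
split.
  split=> [|c x y hx hy]; first exact: hwsum0.
  elim: hx => [|lam w z {}x hw w0 wz _ IH]; first by rewrite scaler0 add0r.
  rewrite scalerDr -addrA; apply: (hwsumD hw w0) => //.
  by apply: subspaceZ => //; exact: (stable_cyc E w).1.
move=> a b x; elim=> [|lam w z y hw w0 wz _ IH]; first by rewrite gE0; exact: hwsum0.
by rewrite gED; apply: (hwsumD hw w0) => //; exact: cyc_E.
Qed.

Lemma hwsum_hw lam w : hw E lam w -> w != 0 -> hwsum w.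
Proof.
by move=> hw w0; rewrite -[w]addr0; apply: (hwsumD hw w0); [exact: cyc_gen|exact: hwsum0].
Qed.

(* The torus operators [Some a] and the Casimir operator [None]. *)
Definition diag_op (i : option 'I_m) x :=
  if i is Some a then E a a x else casimir E x.
Local Notation T := diag_op.
Implicit Types (i j : option 'I_m) (s t : option 'I_m -> F).

Lemma diag_lin i (c : F) x y : T i (c *: x + y) = c *: T i x + T i y.
Proof. by case: i => [a|]; [exact: gE_lin|exact: casimir_lin]. Qed.

Lemma diag0 i : T i 0 = 0.
Proof. exact: (lin0 (diag_lin i)). Qed.

Lemma diagZ i c x : T i (c *: x) = c *: T i x.
Proof. exact: (linZ (diag_lin i)). Qed.

Lemma diagB i x y : T i (x - y) = T i x - T i y.
Proof. exact: (linB (diag_lin i)). Qed.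

Definition raise_char a b t i : F :=
  if i is Some c then t i + (c == a)%:R - (c == b)%:R else t i.

Lemma diag_comm i a b t x :
  T i (E a b x) - raise_char a b t i *: E a b x = E a b (T i x - t i *: x).
Proof.
case: i => [c|] /=; last by rewrite -casimir_comm gEB gEZ.
rewrite gE_comm gEB gEZ.
have -> : (c == a)%:R *: E c b x - (c == b)%:R *: E a c x =
    ((c == a)%:R - (c == b)%:R) *: E a b x.
  rewrite scalerBl; congr (_ - _).
    by case: eqP => [->//|]; rewrite !scale0r.
  by case: eqP => [->//|]; rewrite !scale0r.
by rewrite -[X in _ - X *: _]addrA [in X in _ - X]scalerDl opprD addrACA subrr addr0.
Qed.

Lemma diag_stable Z i x : stable E Z -> Z x -> Z (T i x).
Proof.
move=> [sZ EZ] Zx; case: i => [a|] /=; first exact: EZ.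
by apply: subspace_sum => // a _; apply: subspace_sum => // b _; exact/EZ/EZ.
Qed.

Lemma diagC i j x : T i (T j x) = T j (T i x).
Proof.
case: i j => [a|] [b|] //=; last 2 first.
- by rewrite casimir_comm.
- by rewrite casimir_comm.
rewrite gE_comm; case: eqP => [->|_]; first by rewrite subrr addr0.
by rewrite !scale0r subrr addr0.
Qed.

Definition eig t z := forall i, T i z = t i *: z.

Lemma eig_E t a b z : eig t z -> eig (raise_char a b t) (E a b z).
Proof.
move=> tz i; apply/eqP; rewrite -subr_eq0 diag_comm tz subrr.
by rewrite gE0.
Qed.

Lemma eig_lin t c x y : eig t x -> eig t y -> eig t (c *: x + y).
Proof.
by move=> ex ey i; rewrite diag_lin ex ey scalerDr !scalerA mulrC.
Qed.

Definition diag_prod (G : seq (option 'I_m * F)) x :=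
  foldr (fun g z => T g.1 z - g.2 *: z) x G.
Local Notation P := diag_prod.
Implicit Types (G : seq (option 'I_m * F)).

Lemma diag_prod_lin G c x y : P G (c *: x + y) = c *: P G x + P G y.
Proof.
elim: G => //= g G ->; rewrite diag_lin scalerDr scalerBr opprD !scalerA.
by rewrite [g.2 * c]mulrC addrACA.
Qed.

Lemma diag_prodC i G x : T i (P G x) = P G (T i x).
Proof. by elim: G => //= g G IH; rewrite diagB diagZ diagC IH. Qed.

Lemma diag_prodD G x y : P G (x + y) = P G x + P G y.
Proof. exact: (linD (diag_prod_lin G)). Qed.

Lemma diag_prod0 G : P G 0 = 0.
Proof. exact: (lin0 (diag_prod_lin G)). Qed.

Lemma diag_prodZ G c x : P G (c *: x) = c *: P G x.
Proof. exact: (linZ (diag_prod_lin G)). Qed.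

Lemma diag_prodBZ G c x y : P G (x - c *: y) = P G x - c *: P G y.
Proof. by rewrite (linB (diag_prod_lin G)) diag_prodZ. Qed.

Lemma diag_prod_cat G G' x : P (G ++ G') x = P G (P G' x).
Proof. by rewrite /P foldr_cat. Qed.

Lemma diag_prodCC G G' x : P G (P G' x) = P G' (P G x).
Proof.
elim: G x => //= g G IH x.
by rewrite IH diag_prodC diag_prodBZ.
Qed.

Lemma diag_prod_eig t G z : eig t z ->
  P G z = (\prod_(g <- G) (t g.1 - g.2)) *: z.
Proof.
move=> tz; elim: G => [|g G IH] /=; first by rewrite big_nil scale1r.
by rewrite IH diagZ tz !scalerA -scalerBl big_cons mulrBl [_ * t _]mulrC.
Qed.

Lemma eig_prod t G z : eig t z -> eig t (P G z).
Proof. by move=> tz i; rewrite diag_prodC tz diag_prodZ. Qed.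

Definition avoids t G := forall g, g \in G -> t g.1 - g.2 != 0.

Lemma avoids_cat t G G' : avoids t G -> avoids t G' -> avoids t (G ++ G').
Proof. by move=> a a' g; rewrite mem_cat => /orP[/a|/a']. Qed.

Lemma avoids_prod t G : avoids t G -> \prod_(g <- G) (t g.1 - g.2) != 0.
Proof. by move=> aG; rewrite prodf_seq_neq0; apply/allP => g /aG. Qed.

(** The joint eigenvalues possible in a highest weight module: a lowered weight together with the
    Casimir value of the highest one. *)
Definition hw_char t := exists lam w l, [/\ hw E lam w, w != 0, raising l,
  t None = cas lam & forall c, lam c = t (Some c) + shift F l c].

(** [P G] replaces the projection to the joint eigenspace of [t]: it acts there by a nonzero scalar
    and kills the components of [z] with other eigenvalues. *)
Lemma hwsum_diag t z : hwsum z -> exists G, [/\ avoids t G, eig t (P G z) &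
  ~ hw_char t -> P G z = 0].
Proof.
pose Q z := exists G, [/\ avoids t G, eig t (P G z) & ~ hw_char t -> P G z = 0].
have Q0 : Q 0.
  by exists [::]; split=> // i; rewrite /= diag0 scaler0.
have QD x y : Q x -> Q y -> Q (x + y).
  move=> [G [aG eG nG]] [G' [aG' eG' nG']]; exists (G ++ G').
  rewrite diag_prod_cat diag_prodD diag_prodD [P G (P G' x)]diag_prodCC; split.
  - exact: avoids_cat.
  - rewrite -[X in eig t (X + _)]scale1r.
    by apply: eig_lin; exact: eig_prod.
  - by move=> nt; rewrite nG// nG'// !diag_prod0 addr0.
have QZ c x : Q x -> Q (c *: x).
  move=> [G [aG eG nG]]; exists G; rewrite diag_prodZ; split=> //.
    by move=> i; rewrite diagZ eG !scalerA mulrC.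
  by move=> /nG->; rewrite scaler0.
have Qeig s x : eig s x -> hw_char s -> Q x.
  move=> sx hs; have [ts|/existsNP[i /eqP ti]] := pselect (forall i, t i = s i).
    exists [::]; split=> //= [i|[]]; first by rewrite sx ts.
    move: hs => [lam [w [l [h1 h2 h3 h4 h5]]]]; exists lam, w, l.
    by split=> // [|c]; rewrite ts.
  have e0 : P [:: (i, s i)] x = 0 by rewrite /= sx subrr.
  exists [:: (i, s i)]; split=> //; last by rewrite e0 => j; rewrite diag0 scaler0.
  by move=> g; rewrite inE => /eqP->; rewrite subr_eq0.
elim=> [|lam w {}z y hw0 w0 wz _ IH]; first exact: Q0.
apply: (QD _ _ _ IH); elim: (lowspan_cyc hw0 wz) => [|c l u rl _ IHu]; first exact: Q0.
apply: QD => //; apply: QZ.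
apply: (Qeig (fun i => if i is Some c then lam c - shift F l c else cas lam)).
  case=> [a|] /=; first exact: (wt_monomial l hw0.1 a).
  apply: (casimir_cyc hw0); elim: l {rl} => [|p l IHl] /=; first exact: cyc_gen.
  exact: cyc_E.
by exists lam, w, l; split=> // a; rewrite subrK.
Qed.

Lemma hwsum_eig t z : hwsum z -> eig t z -> z != 0 -> hw_char t.
Proof.
move=> hz tz z0; have [G [aG _ nG]] := hwsum_diag t hz.
apply: contrapT => /nG/eqP; rewrite (diag_prod_eig _ tz) scaler_eq0.
by rewrite (negPf (avoids_prod aG)) (negPf z0).
Qed.

(** The commuting operators act semisimply on [hwsum], so a generalized eigenvector is an
    eigenvector. *)
Lemma hwsum_eig2 t z : hwsum z -> (forall i, eig t (T i z - t i *: z)) -> eig t z.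
Proof.
move=> hz tz i; have [G [aG eG _]] := hwsum_diag t hz.
apply/eqP; rewrite -subr_eq0; apply/eqP.
have : P G (T i z - t i *: z) = 0.
  by rewrite diag_prodBZ -diag_prodC eG subrr.
move/eqP; rewrite (diag_prod_eig _ (tz i)) scaler_eq0.
by rewrite (negPf (avoids_prod aG)) => /eqP.
Qed.

Lemma iter_weight (a b c : 'I_m) k x : E c c (iter k (E a b) x) =
  iter k (E a b) (E c c x) +
  (k%:R * ((c == a)%:R - (c == b)%:R)) *: iter k (E a b) x.
Proof.
elim: k => [|k IH] /=; first by rewrite mul0r scale0r addr0.
have := diag_comm (Some c) a b (fun=> 0) (iter k (E a b) x).
rewrite /= add0r scale0r subr0 => /eqP; rewrite subr_eq => /eqP->.
rewrite IH gED gEZ -addrA -scalerDl; congr (_ + _ *: _); rewrite -natr1; ring.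
Qed.

Lemma iter_gEB a b k x y :
  iter k (E a b) (x - y) = iter k (E a b) x - iter k (E a b) y.
Proof. by elim: k => //= k ->; rewrite gEB. Qed.

Lemma iter_gEZ a b k c x : iter k (E a b) (c *: x) = c *: iter k (E a b) x.
Proof. by elim: k => //= k ->; rewrite gEZ. Qed.

Lemma iter_gE_le a b k n x : (k <= n)%N -> iter k (E a b) x = 0 -> iter n (E a b) x = 0.
Proof.
by move=> /subnK <- h; rewrite iterD h; elim: (n - k)%N => //= i ->; rewrite gE0.
Qed.

(* Modulo [hwsum] there would be a highest weight vector [y]; it can be chosen
   in a generalized eigenspace of [diag_op]. Raising operators kill [y] because
   the Casimir operator separates dominant weights, and [sl2] theory shows that
   the errors [u a] of [y] being a weight vector all vanish. *)
Theorem weyl x : hwsum x.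
Proof.
have sZ := stable_hwsum; have sub := sZ.1.
apply: contrapT => nx.
have [y [mu [_ nZy wy hy]]] := hw_exists charF sZ nx.
pose t i := if i is Some c then mu c else cas mu.
have Ty i : hwsum (T i y - t i *: y).
  by case: i => [c|] /=; [exact: wy|exact: casimir_hwm].
(* The errors lie in [hwsum], so one product [P G] moves all of them into the eigenspace of [t];
   replacing [y] by [P G y] changes it modulo [hwsum] only by a nonzero factor. *)
wlog Tye : y nZy wy hy Ty / forall i, eig t (T i y - t i *: y).
  move=> H; have [G [aG eG]] : exists G, avoids t G /\
      forall i, i \in enum {: option 'I_m} -> eig t (P G (T i y - t i *: y)).
    elim: (enum _) => [|i l [G [aG eG]]]; first by exists [::].
    have [G' [aG' eG' _]] := hwsum_diag t (Ty i).
    exists (G ++ G'); split=> [|j]; first exact: avoids_cat.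
    rewrite diag_prod_cat inE => /orP[/eqP->|jl]; first exact: eig_prod.
    by rewrite diag_prodCC; apply/eig_prod/eG.
  have Gy : cg hwsum (P G y) ((\prod_(g <- G) (t g.1 - g.2)) *: y).
    elim: {aG eG} G => [|g G IH] /=; first by rewrite big_nil scale1r; exact: cg_refl.
    rewrite big_cons mulrBl scalerBl -!scalerA; apply: cgB => //; last exact: cgZ.
    apply: (@cg_trans _ _ _ sub (T g.1 ((\prod_(g0 <- G) (t g0.1 - g0.2)) *: y))).
      by apply: cgT => //; [exact: diag_lin|move=> z; exact: diag_stable].
    by rewrite diagZ scalerA mulrC -scalerA; apply: cgZ.
  have TG i : T i (P G y) - t i *: P G y = P G (T i y - t i *: y).
    by rewrite diag_prodC diag_prodBZ.
  have PZ z : hwsum z -> hwsum (P G z).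
    move=> hz; elim: (G) => //= g G' IH.
    by apply: subspaceB => //; [exact: diag_stable|exact: subspaceZ].
  apply: (H (P G y)).
  - move=> /(cg_mem sub (cg_sym sub Gy))/(subspaceZ (\prod_(g <- G) (t g.1 - g.2))^-1 sub).
    by rewrite scalerA mulVf ?avoids_prod// scale1r.
  - by move=> a; rewrite /cg (TG (Some a)); exact/PZ/(Ty (Some a)).
  - move=> a b ab; apply: cg_mem (cgE sZ a b Gy) _ => //; rewrite gEZ.
    by apply: subspaceZ => //; exact: hy.
  - by move=> i; rewrite TG; exact: PZ.
  - by move=> i; rewrite TG; apply: eG; rewrite mem_enum.
have dmu : dominant mu.
  move=> a b ab; have nab : a != b by apply/eqP => e; rewrite e ltnn in ab.
  by have [n [-> _ _]] := hw_dominant charF sZ nab wy (hy a b ab) nZy; exists n.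
have y0 a b : (a < b)%N -> E a b y = 0.
  move=> ab; apply/eqP; apply: contraT => Ey0.
  have eE : eig (raise_char a b t) (E a b y).
    by apply: hwsum_eig2 => [|i]; [exact: hy|rewrite diag_comm; exact: eig_E].
  have [lam [w [l [hw0 w0 rl cl le]]]] := hwsum_eig (hy a b ab) eE Ey0.
  (* The weight of [E a b y] already exceeds [mu] by a root, so the list leading from [mu] to [lam]
     is nonempty although the Casimir values agree. *)
  exfalso; apply: (@cas_raising _ charF m lam mu ((a, b) :: l)) => //=.
  - by rewrite ab.
  - exact: dominant_hw hw0 w0.
  - by move=> c; rewrite le /= /shift big_cons /=; ring.
pose u a := E a a y - mu a *: y.
have uE a : u a = T (Some a) y - t (Some a) *: y by [].
have hu a : hw E mu (u a).
  split=> [c|c d cd]; first exact: (Tye (Some a) (Some c)).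
  have := diag_comm (Some a) c d t y; rewrite !(y0 c d cd) diag0 scaler0 subrr.
  by move=> <-.
have ueq a b : (a < b)%N -> u a = u b.
  move=> ab; have nab : a != b by apply/eqP => e; rewrite e ltnn in ab.
  have nba : b != a by rewrite eq_sym.
  pose v := u a - u b.
  have hv : hw E mu v.
    split=> [c|c d cd]; first by rewrite /v gEB (hu a).1 (hu b).1 -scalerBr.
    by rewrite /v gEB (hu a).2// (hu b).2// subrr.
  apply/eqP; rewrite -subr_eq0 -/v; apply: contraT => v0.
  have [n [nE fn fn1]] := hw_dominant charF (stable0 E) nab ((wt_wtm E mu v).1 hv.1)
    (hv.2 a b ab) (fun vZ => negP v0 (introT eqP vZ)).
  pose f k := iter k (E b a) y.
  have [k fk] : exists k, f k = 0.
    have [k0 Zk0] := wtm_nilp charF sZ nba wy.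
    have eigk : eig (iter k0 (raise_char b a) t) (f k0).
      apply: hwsum_eig2; first exact: Zk0.
      rewrite /f; elim: (k0) => [|k IH] i /=; first exact: Tye.
      by rewrite diag_comm; apply: eig_E; exact: IH.
    have wk : wt E (fun c => iter k0 (raise_char b a) t (Some c)) (f k0).
      by move=> c; exact: (eigk (Some c)).
    have [k1 Zk1] := wtm_nilp charF (stable0 E) nba ((wt_wtm E _ _).1 wk).
    by exists (k1 + k0)%N; rewrite /f iterD.
  have ex : exists k, f k == 0 by exists k; apply/eqP.
  case: (ex_minnP ex) => -[|k'] /eqP fk' mink.
    by case: nZy; rewrite -[y]/(f 0%N) fk'; exact: hwsum0.
  have hfj (j : nat) : E a a (f j) - E b b (f j) = (mu a - mu b - j%:R *+ 2) *: f j + iter j (E b a) v.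
    rewrite /f !iter_weight !eqxx (negPf nab) (negPf nba) opprD addrACA -scalerBl.
    have -> : v = (E a a y - E b b y) - (mu a - mu b) *: y.
      by rewrite /v /u scalerBl !opprB [_ *: y - E b b y]addrC addrACA [- _ + _]addrC.
    rewrite !iter_gEB iter_gEZ [RHS]addrC -[RHS]addrA -scaleNr -scalerDl /=.
    by congr (_ + _ *: _); ring.
  (* The sl(2) identity with a correction in [v], which measures how far [y] is from being an
     eigenvector of [E a a - E b b]. *)
  have ef (j : nat) : E a b (f j.+1) = (j.+1%:R * (mu a - mu b - j%:R)) *: f j +
      j.+1%:R *: iter j (E b a) v.
    have fS (i : nat) : f i.+1 = E b a (f i) by [].
    elim: j => [|j IH]; rewrite fS gE_comm !eqxx !scale1r.
      by rewrite (y0 a b ab : E a b (f 0%N) = 0) gE0 add0r hfj mulr0n mul0rn mul1r.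
    rewrite hfj IH gED !gEZ -fS addrACA -scalerDl.
    congr (_ *: _ + _); first by rewrite -!natr1; ring.
    by rewrite -[in RHS]natr1 scalerDl scale1r.
  have fv (j : nat) : f j = 0 -> iter j (E b a) v = 0.
    by move=> fj; have := hfj j; rewrite fj !gE0 subrr scaler0 add0r.
  have := ef k'; rewrite fk' gE0 nE.
  (* If [n < k'] the correction vanishes and [f k'] would be 0 against minimality; if [n > k'] then
     [f k'.+1 = 0] forces the n-th iterate of [v] to be 0; if [n = k'] only the correction is left,
     and it must vanish. *)
  case: (ltngtP n k') => [nk|nk|nk].
  - rewrite (iter_gE_le nk fn1) scaler0 addr0 => /esym/eqP; rewrite scaler_eq0 mulf_eq0.
    have -> : (k'.+1%:R == 0 :> F) = false.
      by apply/eqP => h; have := natF_inj charF (h : k'.+1%:R = 0%:R).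
    rewrite subr_eq0; case: eqP => [/(natF_inj charF) e|_ /= f0].
      by rewrite e ltnn in nk.
    by have := mink _ f0; rewrite ltnn.
  - by case: fn; apply: iter_gE_le nk _; exact: fv fk'.
  - rewrite nk subrr mulr0 scale0r add0r -nk => /esym/eqP; rewrite scaler_eq0.
    have -> : (n.+1%:R == 0 :> F) = false.
      by apply/eqP => h; have := natF_inj charF (h : n.+1%:R = 0%:R).
    by move=> /eqP.
have ueq' a b : u a = u b.
  by case: (ltngtP a b) => [/ueq//|/ueq//|/val_inj->].
(* All errors are equal and the trace acts by 0, so [m u a] is a multiple of [y]. It lies in [hwsum]
   and [y] does not, hence it is 0. *)
have u0 a : u a = 0.
  have sum_u : \sum_b u b = - (\sum_b mu b) *: y.
    by rewrite /u sumrB gE_tr sub0r scaleNr scaler_suml.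
  have m0 : (m%:R : F) != 0.
    apply/eqP => h; have mE := natF_inj charF (h : m%:R = 0%:R).
    by move: (ltn_ord a); rewrite [X in (_ < X)%N]mE.
  have mu0 : m%:R *: u a = - (\sum_b mu b) *: y.
    rewrite -sum_u (eq_bigr (fun=> u a)) => [|b _]; last exact: ueq'.
    by rewrite sumr_const card_ord scaler_nat.
  have [s0|s0] := eqVneq (\sum_b mu b) 0.
    by move/eqP: mu0; rewrite s0 oppr0 scale0r scaler_eq0 (negPf m0) => /eqP.
  case: nZy; have : hwsum (- (\sum_b mu b) *: y).
    by rewrite -mu0; apply: subspaceZ => //; exact: (Ty (Some a)).
  move=> /(subspaceZ (- (\sum_b mu b))^-1 sub).
  by rewrite scalerA mulVf ?oppr_eq0// scale1r.
apply: nZy; have [->|ynz] := eqVneq y 0; first exact: hwsum0.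
apply: (@hwsum_hw mu) => //; split=> [a|]; last exact: y0.
by apply/eqP; rewrite -subr_eq0; apply/eqP; exact: u0.
Qed.

End Weyl.

(** * Complements of simple submodules and simple reflections *)

Section Complement.
Variables (F : closedFieldType) (charF : [pchar F] =i pred0).
Variables (m : nat) (X : lmodType F) (E : glrep m X).
Implicit Types (x y z : X) (a b : 'I_m) (lam mu : 'I_m -> F) (Z : X -> Prop).

Definition sum_sub Z Z' y := exists u v, [/\ Z u, Z' v & y = u + v].

Lemma stable_sum Z Z' : stable E Z -> stable E Z' -> stable E (sum_sub Z Z').
Proof.
move=> [[Z0 ZD] ZE] [[Z'0 Z'D] Z'E]; split; first split.
- by exists 0, 0; rewrite addr0.
- move=> c y y' [u [v [Zu Zv ->]]] [u' [v' [Zu' Zv' ->]]].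
  exists (c *: u + u'), (c *: v + v'); split; [exact: ZD|exact: Z'D|].
  by rewrite scalerDr addrACA.
- move=> a b y [u [v [Zu Zv ->]]]; exists (E a b u), (E a b v).
  by rewrite gED; split=> //; [exact: ZE|exact: Z'E].
Qed.

(** A complement that is large enough for the single vector [x]. The simple summands met by [x] are
    added to [Z] one at a time; if adding one would bring [z] in, then [z = p + q] with [q] nonzero
    in that summand, which is therefore contained in [Z] plus the module of [z]. *)
Lemma complement lam z x : hw E lam z -> z != 0 ->
  exists Z y, [/\ stable E Z, ~ Z z, cyc E z y & Z (x - y)].
Proof.
move=> hz z0; elim: (weyl charF E x) => [|mu w u v hw0 w0 wu _ [Z [y [sZ nZ zy Zvy]]]].
  exists (fun x => x = 0), 0; split; [exact: stable0|exact/eqP| |by rewrite subrr].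
  by case: (stable_cyc E z) => -[].
have [sz sw] := (stable_cyc E z, stable_cyc E w).
have [in_sum|nin] := pselect (sum_sub Z (cyc E w) z); last first.
  exists (sum_sub Z (cyc E w)), y; split=> //; first exact: stable_sum.
  by exists (v - y), u; split=> //; rewrite [RHS]addrC addrA.
have [p [q [Zp wq zpq]]] := in_sum.
have q0 : q != 0 by apply/eqP => q0; apply: nZ; rewrite zpq q0 addr0.
have : sum_sub Z (cyc E z) u.
  apply: (cyc_min _ _ wu); first exact: stable_sum.
  apply: (cyc_min _ _ (hw_simple charF hw0 wq q0)); first exact: stable_sum.
  exists (- p), z; split; [|exact: cyc_gen|by rewrite zpq addKr].
  by rewrite -scaleN1r; apply: subspaceZ => //; exact: sZ.1.
move=> [u1 [u2 [Zu1 zu2 ->]]].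
exists Z, (u2 + y); split=> //; first by apply: subspaceD => //; exact: sz.1.
rewrite opprD addrA -addrA -[u1 + u2 + v]addrA [u2 + v]addrC.
rewrite -[X in Z X]addrA -[v + u2 + _]addrA [u2 + _]addrA subrr add0r.
by apply: subspaceD => //; exact: sZ.1.
Qed.

(** The last nonzero iterate of [E j i] on [x] is extremal: a highest weight vector for the order
    with the neighbours [i] and [j] exchanged. Only the pair [(j, i)] becomes newly positive, and it
    kills by the choice of exponent. *)
Lemma reflection lam x (i j : 'I_m) : j = i.+1 :> nat -> hw E lam x -> x != 0 ->
  exists y, [/\ cyc E x y, y != 0,
    forall a, E (tperm i j a) (tperm i j a) y = lam a *: y &
    forall a b, (a < b)%N -> E (tperm i j a) (tperm i j b) y = 0].
Proof.
move=> ji [wx hx] x0.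
have ij : i != j by apply/eqP => e; move: ji; rewrite -e => /n_Sn.
have ji' : j != i by rewrite eq_sym.
have ltij : (i < j)%N by rewrite ji.
have [n [nE fn fn1]] := hw_dominant charF (stable0 E) ij ((wt_wtm E lam x).1 wx)
  (hx i j ltij) (fun xZ => negP x0 (introT eqP xZ)).
exists (iter n (E j i) x); split.
- by elim: n {nE fn fn1} => [|k IH] /=; [exact: cyc_gen|exact: cyc_E].
- exact/eqP.
- move=> a; rewrite iter_weight wx iter_gEZ -scalerDl; congr (_ *: _).
  case: tpermP => [->|->|/eqP ai /eqP aj].
  - by rewrite eqxx (negPf ji') subr0 mulr1 -nE addrC subrK.
  - by rewrite eqxx (negPf ij) sub0r mulrN1 -nE opprB addrC subrK.
  - by rewrite (negPf ai) (negPf aj) subrr mulr0 addr0.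
move=> a b ab; have [c [d [ca db]]] : exists c d, tperm i j a = c /\ tperm i j b = d.
  by exists (tperm i j a), (tperm i j b).
rewrite ca db; have [[cj di]|cd] : (c = j /\ d = i) \/ ((c < d)%N /\ (c, d) != (i, j)).
  have neq (p q : 'I_m) : p <> q -> p <> q :> nat by move=> h /val_inj.
  have neqP (p q : 'I_m) : (p == q) = (p == q :> nat) by rewrite -val_eqE.
  rewrite xpair_eqE !neqP.
  move: ca db; case: tpermP => [ea|ea|/neq ai /neq aj] <-;
    case: tpermP => [eb|eb|/neq bi /neq bj] <-; rewrite ?ea ?eb in ab *;
    try (by left); right; lia.
  by rewrite cj di; exact: fn1.
case: cd => cd cdij.
(* Commuting [E c d] past [E j i] produces [E c i] or [E j d], so these families are carried along
   in the induction. *)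
have E0 k : E c d (iter k (E j i) x) = 0 /\
    (forall e : 'I_m, (e < i)%N -> E e i (iter k (E j i) x) = 0) /\
    (forall e : 'I_m, (j < e)%N -> E j e (iter k (E j i) x) = 0).
  elim: k => [|k [IH1 [IH2 IH3]]] /=.
    split; [exact: hx|split=> e ei; [exact: hx|exact: hx]].
  split; last split.
  - rewrite gE_comm IH1 gE0 add0r.
    case: eqP => [dj|_]; last case: eqP => [ci|_]; rewrite ?scale0r ?subrr ?sub0r ?subr0 ?scale1r//.
      have ci : (c < i)%N.
        by move: cdij cd; rewrite dj xpair_eqE eqxx andbT -val_eqE /=; lia.
      rewrite IH2//; case: eqP => [e|_]; first by rewrite e ltnn in ci.
      by rewrite scale0r subrr.
    have jd : (j < d)%N.
      by move: cdij cd; rewrite ci xpair_eqE eqxx /= -val_eqE /=; lia.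
    by rewrite IH3// oppr0.
  - move=> e ei; rewrite gE_comm IH2// gE0 add0r (negPf ij) scale0r.
    case: eqP => [ee|_]; first by rewrite ee ltnn in ei.
    by rewrite scale0r subrr.
  - move=> e je; rewrite gE_comm IH3// gE0 add0r (negPf ji') scale0r.
    case: eqP => [ee|_]; first by rewrite ee ltnn in je.
    by rewrite scale0r subrr.
by case: (E0 n).
Qed.

End Complement.

(** * The subalgebras sl(m) of sl(oo) *)

Section Corner.
Variables (F : closedFieldType) (charF : [pchar F] =i pred0).

Lemma supp_corner m (A : 'M[F]_m) : supp_below m (corner A).
Proof.
move=> i j; rewrite /corner => /orP[] ?; first by rewrite insubN -?leqNgt.
by case: insub => // ?; rewrite insubN -?leqNgt.
Qed.

Lemma cornerE m (A : 'M[F]_m) (i j : 'I_m) : corner A i j = A i j.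
Proof. by rewrite /corner !valK. Qed.

Lemma supp_ext m (A B : infmx F) : supp_below m A -> supp_below m B ->
  (forall i j : 'I_m, A i j = B i j) -> A = B.
Proof.
move=> A0 B0 AB; apply/funext => i; apply/funext => j.
have [im|mi] := ltnP i m; last by rewrite A0 ?mi// B0 ?mi.
have [jm|mj] := ltnP j m; last by rewrite A0 ?mj ?orbT// B0 ?mj ?orbT.
exact: (AB (Ordinal im) (Ordinal jm)).
Qed.

Definition traceless m (A : 'M[F]_m) : 'M[F]_m := A - (\tr A / m%:R)%:M.

Lemma tr_traceless m (A : 'M[F]_m) : \tr (traceless A) = 0.
Proof.
rewrite /traceless raddfB /= mxtrace_scalar.
case: m A => [|m] A; first by rewrite /mxtrace big_ord0 mulr0n subr0.
have m0 : (m.+1%:R : F) != 0.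
  by apply/eqP => h; have := natF_inj charF (h : m.+1%:R = 0%:R).
by rewrite -[X in _ - X]mulr_natr divfK// subrr.
Qed.

Lemma comm_scalar m (A B : 'M[F]_m) a b :
  (A - a%:M) *m (B - b%:M) - (B - b%:M) *m (A - a%:M) = A *m B - B *m A.
Proof.
have H (C D : 'M[F]_m) c d : (C - c%:M) *m (D - d%:M) = C *m D - (d *: C + c *: D) + (c * d)%:M.
  rewrite mulmxBl mulmxBr mulmxBr !mul_scalar_mx mul_mx_scalar scale_scalar_mx.
  by rewrite !opprD !opprK !addrA.
rewrite (H A B a b) (H B A b a) [b * a]mulrC [a *: B + _]addrC.
by move: (_ + _ *: B) => u; rewrite opprD addrACA subrr addr0 opprB addrA subrK.
Qed.

Lemma comm_traceless m (A B : 'M[F]_m) :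
  traceless A *m traceless B - traceless B *m traceless A = A *m B - B *m A.
Proof. exact: comm_scalar. Qed.

Definition slm m (A : 'M[F]_m) : slInf F := insubd (0 : slInf_sort F) (corner (traceless A)).

Lemma mx_of_slm m (A : 'M[F]_m) : mx_of (slm A) = corner (traceless A).
Proof.
rewrite /mx_of /slm insubdK//; apply/slInfP; exists m; split.
  exact: supp_corner.
by rewrite -[RHS](tr_traceless A); apply: eq_bigr => i _; rewrite cornerE.
Qed.

Lemma supp_slm m (A : 'M[F]_m) : supp_below m (mx_of (slm A)).
Proof. by rewrite mx_of_slm; exact: supp_corner. Qed.

Lemma supp_lin m c (A B : slInf F) : supp_below m (mx_of A) ->
  supp_below m (mx_of B) -> supp_below m (mx_of (c *: A + B)).
Proof.
move=> A0 B0 i j ij; rewrite mx_ofP [LHS](_ : _ = c * mx_of A i j + mx_of B i j)//.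
by rewrite A0// B0// mulr0 addr0.
Qed.

Lemma slm_lin m c (A B : 'M[F]_m) : slm (c *: A + B) = c *: slm A + slm B.
Proof.
apply: mx_of_inj; apply: (@supp_ext m); [exact: supp_slm|apply: supp_lin; exact: supp_slm|].
move=> i j; rewrite mx_ofP [RHS](_ : _ = c * mx_of (slm A) i j + mx_of (slm B) i j)//.
rewrite !mx_of_slm !cornerE /traceless !mxE raddfD /= mxtraceZ.
by case: (i == j); rewrite ?mulr1n ?mulr0n; ring.
Qed.

Lemma bracket_slm m (A B : 'M[F]_m) :
  bracket (slm A) (slm B) = slm (A *m B - B *m A).
Proof.
apply: mx_of_inj; rewrite mx_of_bracket; apply: (@supp_ext m).
- by apply: supp_comm; exact: supp_slm.
- exact: supp_slm.
move=> i j; rewrite [LHS](_ : _ = mulinf (mx_of (slm A)) (mx_of (slm B)) i j -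
  mulinf (mx_of (slm B)) (mx_of (slm A)) i j)//.
rewrite !(mulinf_trunc _ _ _ (supp_slm _)) !mx_of_slm !cornerE.
have H (C D : 'M[F]_m) : \sum_(k < m) corner (traceless C) i k * corner (traceless D) k j =
    (traceless C *m traceless D) i j.
  by rewrite mxE; apply: eq_bigr => k _; rewrite !cornerE.
have tr0 : \tr (A *m B - B *m A) = 0 by rewrite linearB /= mxtrace_mulC subrr.
have -> : traceless (A *m B - B *m A) = A *m B - B *m A.
  by rewrite {1}/traceless tr0 mul0r -scalemx1 scale0r subr0.
by rewrite !H -(comm_traceless A B) !mxE.
Qed.

Lemma slm_of m (x : slInf F) : supp_below m (mx_of x) ->
  x = slm (\matrix_(i < m, j < m) mx_of x i j).
Proof.
move=> x0; apply: mx_of_inj; apply: (@supp_ext m) => //; first exact: supp_slm.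
move=> i j; rewrite mx_of_slm cornerE /traceless.
have -> : \tr (\matrix_(i < m, j < m) mx_of x i j) = 0.
  have /slInfP[n [xn trn]] := valP x.
  have := trace_widen (leq_maxl m n) x0; rewrite (trace_widen (leq_maxr m n) xn) trn.
  by move=> e; rewrite [RHS]e; apply: eq_bigr => k _; rewrite mxE.
by rewrite mul0r !mxE mul0rn subr0.
Qed.

Lemma slm_sum m (I : Type) (r : seq I) (f : I -> 'M[F]_m) :
  slm (\sum_(i <- r) f i) = \sum_(i <- r) slm (f i).
Proof. exact: (lin_sum (@slm_lin m)). Qed.

(** Indices are natural numbers so that one pair names a matrix unit at every level. *)
Definition dmx m (a b : nat) : 'M[F]_m :=
  \matrix_(i < m, j < m) ((i == a :> nat) && (j == b :> nat))%:R.

(* The traceless part of the matrix unit: E_ab - (a == b)/m Id_m. *)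
Definition el m a b : slInf F := slm (dmx m a b).

Lemma mul_dmx m a b c d : (b < m)%N ->
  dmx m a b *m dmx m c d = (b == c)%:R *: dmx m a d.
Proof.
move=> bm; apply/matrixP => i j; rewrite !mxE (bigD1 (Ordinal bm))//= big1 ?addr0.
  by rewrite !mxE /= eqxx andbT -!natrM !mulnb; congr (_ %:R); case: (_ == a); case: (b == c).
by move=> k; rewrite -val_eqE /= !mxE => /negPf->; rewrite andbF mul0r.
Qed.

Lemma slmZ m c (A : 'M[F]_m) : slm (c *: A) = c *: slm A.
Proof. exact: (linZ (@slm_lin m)). Qed.

Lemma slmB m (A B : 'M[F]_m) : slm (A - B) = slm A - slm B.
Proof. exact: (linB (@slm_lin m)). Qed.

Lemma bracket_el m a b c d : (b < m)%N -> (d < m)%N ->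
  bracket (el m a b) (el m c d) = (b == c)%:R *: el m a d - (a == d)%:R *: el m c b.
Proof.
by move=> bm dm; rewrite /el bracket_slm !mul_dmx// slmB !slmZ [d == a]eq_sym.
Qed.

Lemma supp_el m a b : supp_below m (mx_of (el m a b)).
Proof. exact: supp_slm. Qed.

Lemma el_span m (x : slInf F) : supp_below m (mx_of x) ->
  x = \sum_(i < m) \sum_(j < m) mx_of x i j *: el m i j.
Proof.
move=> x0; rewrite {1}(slm_of x0).
have -> : \matrix_(i < m, j < m) mx_of x i j = \sum_(i < m) \sum_(j < m) mx_of x i j *: dmx m i j.
  rewrite [LHS]matrix_sum_delta; apply: eq_bigr => i _; apply: eq_bigr => j _.
  by rewrite mxE; congr (_ *: _); apply/matrixP => k l; rewrite !mxE.
by rewrite slm_sum; apply: eq_bigr => i _; rewrite slm_sum; apply: eq_bigr => j _; rewrite slmZ.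
Qed.

Lemma el_tr m : \sum_(a < m) el m a a = 0.
Proof.
rewrite -slm_sum; apply: mx_of_inj; apply: (@supp_ext m); [exact: supp_slm|by rewrite mx_of0|].
have -> : \sum_(i < m) dmx m i i = 1%:M.
  apply/matrixP => i j; rewrite summxE !mxE (bigD1 i)//= !mxE eqxx big1 ?addr0.
    by rewrite -val_eqE /= eq_sym.
  by move=> k ki; rewrite mxE eq_sym -val_eqE in ki *; rewrite /= (negPf ki).
move=> i j; rewrite mx_of_slm cornerE mx_of0 /traceless mxtrace1.
have m0 : (m%:R : F) != 0.
  apply/eqP => h; have mE := natF_inj charF (h : m%:R = 0%:R).
  by move: (ltn_ord i); rewrite [X in (_ < X)%N]mE.
by rewrite divff// subrr mxE.
Qed.

End Corner.

Section LieModuleBasics.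
Variables (F : fieldType) (g : lieAlgebra F) (X : lieModule g).
Implicit Types (x y : g) (v w : X) (t : term F g).

Lemma act0r x : act x (0 : X) = 0.
Proof. exact: (lin0 (fun c => actDr c x)). Qed.

Lemma actZr x c v : act x (c *: v) = c *: act x v.
Proof. exact: (linZ (fun c => actDr c x)). Qed.

Lemma actDrr x v w : act x (v + w) = act x v + act x w.
Proof. exact: (linD (fun c => actDr c x)). Qed.

Let act_linl v c x y : act (c *: x + y) v = c *: act x v + act y v.
Proof. exact: actDl. Qed.

Lemma act0l v : act 0 v = 0.
Proof. exact: (lin0 (f := fun z => act z v) (act_linl v)). Qed.

Lemma actZl c x v : act (c *: x) v = c *: act x v.
Proof. exact: (linZ (f := fun z => act z v) (act_linl v)). Qed.

Lemma actDll x y v : act (x + y) v = act x v + act y v.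
Proof. exact: (linD (f := fun z => act z v) (act_linl v)). Qed.

Lemma act_suml (I : Type) (r : seq I) (f : I -> g) v :
  act (\sum_(i <- r) f i) v = \sum_(i <- r) act (f i) v.
Proof. exact: (lin_sum (f := fun z => act z v) (act_linl v)). Qed.

Lemma act_sumr (I : Type) (r : seq I) x (f : I -> X) :
  act x (\sum_(i <- r) f i) = \sum_(i <- r) act x (f i).
Proof. exact: (lin_sum (fun c => actDr c x)). Qed.

Lemma act_lin2 (c d : F) x y v : act (c *: x - d *: y) v = c *: act x v - d *: act y v.
Proof. by rewrite -scaleNr actDll !actZl scaleNr. Qed.

Lemma act_comm x y v : act x (act y v) = act y (act x v) + act (bracket x y) v.
Proof. by rewrite act_bracket addrC subrK. Qed.

Lemma term_act0 t : term_act t (0 : X) = 0.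
Proof. exact: (lin0 (@term_act_linear F g X t)). Qed.

Lemma term_actZ t c v : term_act t (c *: v) = c *: term_act t v.
Proof. exact: (linZ (@term_act_linear F g X t)). Qed.

Lemma term_actD t v w : term_act t (v + w) = term_act t v + term_act t w.
Proof. exact: (linD (@term_act_linear F g X t)). Qed.

Lemma term_actB t v w : term_act t (v - w) = term_act t v - term_act t w.
Proof. exact: (linB (@term_act_linear F g X t)). Qed.

End LieModuleBasics.

(** * Restriction of sl(oo)-modules to sl(m) *)

Section Levels.
Variables (F : closedFieldType) (charF : [pchar F] =i pred0).
Local Notation sl := (slInf F).
Implicit Types (X Y : lieModule sl) (t : term F sl) (s : seq nat).

(** Terms of level [m] represent U(sl(m)); levels of terms replace the inclusions between these
    subalgebras. *)
Fixpoint level m t : Prop :=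
  match t with
  | Gen x => supp_below m (mx_of x)
  | Cst _ => True
  | Add t t' | Mul t t' => level m t /\ level m t'
  end.

Lemma level_le m n t : (m <= n)%N -> level m t -> level n t.
Proof.
move=> mn; elim: t => //= [x|t1 IH1 t2 IH2|t1 IH1 t2 IH2].
- exact: supp_below_le.
- by move=> [/IH1 ? /IH2 ?].
- by move=> [/IH1 ? /IH2 ?].
Qed.

Lemma level_ex t : exists m, level m t.
Proof.
elim: t => [x|c|t [m mt] t' [n nt]|t [m mt] t' [n nt]].
- by have [m [h _ _]] := slInf_supp x x x; exists m.
- by exists 0%N.
- by exists (maxn m n); split; [apply: level_le mt|apply: level_le nt]; rewrite ?leq_maxl ?leq_maxr.
- by exists (maxn m n); split; [apply: level_le mt|apply: level_le nt]; rewrite ?leq_maxl ?leq_maxr.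
Qed.

Definition locfin X := forall m (x : X), exists d (B : 'I_d -> X),
  spn B x /\ forall z : sl, supp_below m (mx_of z) -> forall y, spn B y -> spn B (act z y).

Definition gen m X (x y : X) := exists2 t, level m t & y = term_act t x.

Lemma gen_refl m X (x : X) : gen m x x.
Proof. by exists (Cst _ 1) => //=; rewrite scale1r. Qed.

Lemma gen_act m X (x y : X) (z : sl) : supp_below m (mx_of z) -> gen m x y -> gen m x (act z y).
Proof. by move=> mz [t mt ->]; exists (Mul (Gen F z) t). Qed.

Lemma gen_subspace m X (x : X) : subspace (gen m x).
Proof.
split=> [|c y y' [t mt ->] [t' mt' ->]]; first by exists (Cst _ 0) => //=; rewrite scale0r.
by exists (Add (Mul (Cst _ c) t) t').
Qed.

Lemma gen_min m X (Z : X -> Prop) (x y : X) : subspace Z ->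
  (forall (z : sl) u, supp_below m (mx_of z) -> Z u -> Z (act z u)) ->
  Z x -> gen m x y -> Z y.
Proof.
move=> sZ ZE Zx [t mt ->]; elim: t x Zx mt => /= [z|c|t IHt t' IHt'|t IHt t' IHt'] x Zx.
- by move=> mz; exact: ZE.
- by move=> _; exact: subspaceZ.
- by move=> [mt mt']; apply: subspaceD => //; [exact: IHt|exact: IHt'].
- by move=> [mt mt']; apply: IHt => //; exact: IHt'.
Qed.

Lemma gen_trans m X (x y z : X) : gen m x y -> gen m y z -> gen m x z.
Proof. by move=> [t mt ->] [t' mt' ->]; exists (Mul t' t). Qed.

Lemma gen_le m n X (x y : X) : (m <= n)%N -> gen m x y -> gen n x y.
Proof. by move=> mn [t mt ->]; exists t => //; exact: level_le mt. Qed.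

Section Rep.
Variables (X : lieModule sl) (lfX : locfin X) (m : nat) (s : seq nat).
Hypothesis sP : perm_eq s (iota 0 m).

Let size_s : size s = m. Proof. by rewrite (perm_size sP) size_iota. Qed.
Let nth_lt (i : 'I_m) : (nth 0%N s i < m)%N.
Proof.
have : nth 0%N s i \in s by rewrite mem_nth// size_s.
by rewrite (perm_mem sP) mem_iota.
Qed.
Let nth_eq (i j : 'I_m) : (nth 0%N s i == nth 0%N s j) = (i == j).
Proof. by rewrite nth_uniq ?size_s// (perm_uniq sP) iota_uniq. Qed.

(** Renumbering the matrix units by [s] lets the theory for the standard order serve every order of
    the indices. *)
Definition rep_op (i j : 'I_m) (x : X) := act (el F m (nth 0%N s i) (nth 0%N s j) : sl) x.

Lemma rep_rel a b c d x : rep_op a b (rep_op c d x) - rep_op c d (rep_op a b x) =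
    (b == c)%:R *: rep_op a d x - (a == d)%:R *: rep_op c b x.
Proof.
rewrite /rep_op -act_bracket (@bracket_el _ charF)// !nth_eq.
by rewrite -scaleN1r actDll !actZl scaleN1r.
Qed.

Lemma rep_tr x : \sum_a rep_op a a x = 0.
Proof.
rewrite /rep_op -act_suml -[RHS](act0l x); congr (act _ _).
apply: etrans (el_tr charF m).
rewrite -(big_mkord xpredT (fun a => el F m (nth 0%N s a) (nth 0%N s a))).
rewrite -[X in index_iota _ X]size_s -(big_nth 0%N xpredT (fun a => el F m a a)) (perm_big _ sP) /=.
by rewrite -(big_mkord xpredT (fun a => el F m a a)) /index_iota subn0.
Qed.

Lemma rep_lf x : exists d (B : 'I_d -> X),
    spn B x /\ forall a b y, spn B y -> spn B (rep_op a b y).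
Proof.
have [d [B [Bx BE]]] := lfX m x; exists d, B; split=> // a b y; apply: BE.
exact: supp_el.
Qed.

Definition rep : glrep m X :=
  @GlRep F m X rep_op (fun a b c x y => actDr c _ x y) rep_rel rep_tr rep_lf.

Lemma act_span (Z : X -> Prop) : stable rep Z -> forall (z : sl) u,
  supp_below m (mx_of z) -> Z u -> Z (act z u).
Proof.
move=> [sZ ZE] z u mz Zu; rewrite (el_span charF mz) act_suml.
apply: subspace_sum => // i _; rewrite act_suml; apply: subspace_sum => // j _.
rewrite actZl; apply: subspaceZ => //.
have idx (k : 'I_m) : exists k' : 'I_m, nth 0%N s k' = k.
  have ks : (k : nat) \in s by rewrite (perm_mem sP) mem_iota /=.
  have km : (index (k : nat) s < m)%N by rewrite -[X in (_ < X)%N]size_s index_mem.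
  by exists (Ordinal km); rewrite /= nth_index.
have [[i' <-] [j' <-]] := (idx i, idx j).
exact: (ZE i' j').
Qed.

Lemma cyc_gen_iff x y : cyc rep x y <-> gen m x y.
Proof.
split=> [|xy].
  elim=> [|c u v _ xu _ xv|a b u _ xu]; first exact: gen_refl.
    by have [_] := gen_subspace m x; apply.
  by apply: gen_act => //; exact: supp_el.
have sc := stable_cyc rep x.
by apply: gen_min xy => //; [exact: sc.1|exact: act_span|exact: cyc_gen].
Qed.

End Rep.

(* Highest weight vectors of sl(m) for the order [s] of the indices; [lam i] is
   the weight at the index in position [i]. *)
Definition hwT m s (lam : nat -> F) X (x : X) :=
  (forall i, (i < m)%N -> act (el F m (nth 0%N s i) (nth 0%N s i) : sl) x = lam i *: x) /\
  (forall i j, (i < j)%N -> (j < m)%N ->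
    act (el F m (nth 0%N s i) (nth 0%N s j) : sl) x = 0).

Definition wtT m s (lam : nat -> F) X (x : X) :=
  forall i, (i < m)%N -> act (el F m (nth 0%N s i) (nth 0%N s i) : sl) x = lam i *: x.

Section HighestWeight.
Variables (m : nat) (s : seq nat) (sP : perm_eq s (iota 0 m)).
Variables (X : lieModule sl) (lfX : locfin X).
Implicit Types (x y : X).

Let E := rep lfX sP.

Lemma hwTE lam x : hwT m s lam x <-> hw E (fun i => lam i) x.
Proof.
split=> [[wx hx]|[wx hx]].
  by split=> [i|i j ij]; [exact: wx|exact: hx].
split=> [i im|i j ij jm]; first exact: (wx (Ordinal im)).
exact: (hx (Ordinal (ltn_trans ij jm)) (Ordinal jm)).
Qed.

Lemma hwT_simple lam x y : hwT m s lam x -> gen m x y -> y != 0 -> gen m y x.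
Proof.
move=> /hwTE hx /(cyc_gen_iff lfX sP) xy y0; apply/(cyc_gen_iff lfX sP).
exact: (hw_simple charF hx xy y0).
Qed.

Lemma hwT_unique lam mu x y : hwT m s lam x -> hwT m s mu y -> gen m x y ->
  y != 0 -> exists c, y = c *: x.
Proof.
move=> /hwTE hx /hwTE hy /(cyc_gen_iff lfX sP) xy y0.
by have [] := hw_in_cyc charF hx hy xy y0.
Qed.

Lemma hwT_complement lam z x : hwT m s lam z -> z != 0 ->
  exists (Z : X -> Prop) y, [/\ subspace Z /\ (forall (u : sl) v, supp_below m (mx_of u) -> Z v -> Z (act u v)),
     ~ Z z, gen m z y & Z (x - y)].
Proof.
move=> /hwTE hz z0; have [Z [y [sZ nZ /(cyc_gen_iff lfX sP) zy Zxy]]] := complement charF x hz z0.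
exists Z, y; split=> //; split; first exact: sZ.1.
by move=> u v; exact: (act_span sZ).
Qed.

Lemma hwT_raise (P : X -> Prop) lam x : wtT m s lam x -> x != 0 -> P x ->
  (forall i j y, (i < j)%N -> (j < m)%N -> P y ->
     P (act (el F m (nth 0%N s i) (nth 0%N s j) : sl) y)) ->
  exists y mu, [/\ hwT m s mu y, y != 0 & P y].
Proof.
move=> wx x0 Px PE.
have wx' : wtm E (fun z => z = 0) (fun i => lam i) x.
  by apply/wt_wtm => i; exact: wx.
have [|y [mu [/wt_wtm wy y0 Py hy]]] := raise charF (stable0 E) wx' (fun xZ => negP x0 (introT eqP xZ)) Px.
  by move=> a b y ab; apply: PE.
have hwy : hw E mu y by split.
exists y, (fun i => if insub i is Some i' then mu i' else 0); split=> //; last exact/eqP.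
apply/hwTE; split=> [a|]; last exact: hy.
by rewrite valK wy.
Qed.

Lemma hwT_kill t : level m t ->
  (forall lam (w : X), hwT m s lam w -> w != 0 -> forall u, gen m w u -> term_act t u = 0) ->
  forall x : X, term_act t x = 0.
Proof.
move=> mt H x; elim: (weyl charF E x) => [|lam w z y hw0 w0 wz _ IH].
  exact: term_act0.
rewrite term_actD IH addr0; apply: (H (fun i => if insub i is Some i' then lam i' else 0) w) => //.
  by apply/hwTE; split=> [a|]; [rewrite valK; exact: hw0.1|exact: hw0.2].
by apply/(cyc_gen_iff lfX sP).
Qed.

Lemma hwT_dominant lam x i j : hwT m s lam x -> x != 0 -> (i < j)%N -> (j < m)%N ->
  exists n : nat, lam i - lam j = n%:R.
Proof.
move=> /hwTE hx x0 ij jm.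
exact: (dominant_hw charF hx x0 (a := Ordinal (ltn_trans ij jm)) (b := Ordinal jm)).
Qed.

Lemma wtT_sum lam x : wtT m s lam x -> x != 0 -> \sum_(i < m) lam i = 0.
Proof.
move=> wx x0; apply/eqP; have := gE_tr E x.
under eq_bigr do rewrite [E _ _ _]wx//.
by rewrite -scaler_suml => /eqP; rewrite scaler_eq0 (negPf x0) orbF.
Qed.

Lemma wtT_nilp lam x i j : wtT m s lam x -> (i < m)%N -> (j < m)%N -> i != j ->
  exists k, iter k (act (el F m (nth 0%N s i) (nth 0%N s j) : sl)) x = 0.
Proof.
move=> wx im jm ij.
have wx' : wtm E (fun z => z = 0) (fun i => lam i) x by apply/wt_wtm => k; exact: wx.
exact: (wtm_nilp charF (stable0 E) (a := Ordinal im) (b := Ordinal jm) ij wx').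
Qed.

End HighestWeight.

Lemma nth_swap s1 s2 (a b : nat) m (i j k : 'I_m) :
  size s1 = i -> j = i.+1 :> nat ->
  nth 0%N (s1 ++ b :: a :: s2) k = nth 0%N (s1 ++ a :: b :: s2) (tperm i j k).
Proof.
move=> si ji; case: tpermP => [->|->|ki kj].
- by rewrite !nth_cat -si ji -si ltnn subnn ltnNge leqnSn /= subSn// subnn.
- by rewrite !nth_cat ji -si ltnn subnn ltnNge leqnSn /= subSn// subnn.
have ki' : (k : nat) <> i by move/val_inj.
have kj' : (k : nat) <> j by move/val_inj.
rewrite !nth_cat; case: ltnP => // sk.
have -> : (k - size s1 = (k - size s1 - 2).+2)%N by lia.
by [].
Qed.

Lemma hwT_swap m s1 s2 a b X (lfX : locfin X) (x : X) lam :
  perm_eq (s1 ++ a :: b :: s2) (iota 0 m) -> hwT m (s1 ++ a :: b :: s2) lam x -> x != 0 ->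
  exists y, [/\ gen m x y, y != 0 & hwT m (s1 ++ b :: a :: s2) lam y].
Proof.
move=> sP hx x0.
have im : (size s1 < m)%N.
  by move: (perm_size sP); rewrite size_cat size_iota /= => <-; lia.
have jm : ((size s1).+1 < m)%N.
  by move: (perm_size sP); rewrite size_cat size_iota /= => <-; lia.
have /(hwTE sP lfX) hx' := hx.
have [y [xy y0 wy hy]] := reflection charF (i := Ordinal im) (j := Ordinal jm) erefl hx' x0.
exists y; split=> //; first exact/(cyc_gen_iff lfX sP).
pose nE := @nth_swap s1 s2 a b m (Ordinal im) (Ordinal jm) _ erefl erefl.
split=> [k km|k l kl lm].
  by have := wy (Ordinal km); rewrite /= /rep_op -!(@nth_swap s1 s2 a b m (Ordinal im) (Ordinal jm)).
have km := ltn_trans kl lm.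
have := hy (Ordinal km) (Ordinal lm) kl; rewrite /= /rep_op.
by rewrite -!(@nth_swap s1 s2 a b m (Ordinal im) (Ordinal jm)).
Qed.

Lemma perm_swap_ind (T : eqType) (P : seq T -> Prop) :
  (forall (s1 s2 : seq T) a b, P (s1 ++ a :: b :: s2) -> P (s1 ++ b :: a :: s2)) ->
  forall s s' : seq T, perm_eq s s' -> P s -> P s'.
Proof.
move=> sw; suff H (s s' p : seq T) : perm_eq s s' -> P (p ++ s) -> P (p ++ s').
  by move=> s s' ss' Ps; exact: (H s s' [::]).
elim: s' s p => [|a s' IH] s p ss' Ps.
  by move: Ps; have /size0nil-> : size s = 0%N by rewrite (perm_size ss').
have as_ : a \in s by rewrite (perm_mem ss') mem_head.
case: (splitPr as_) ss' Ps => q r ss' Ps.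
have Pa : P (p ++ a :: q ++ r).
  elim/last_ind: q r {ss'} Ps => [//|q b IHq] r Ps.
  rewrite cat_rcons; apply: IHq; move: Ps.
  by rewrite cat_rcons !catA; apply: sw.
rewrite -cat_rcons; apply: (IH (q ++ r)); last by rewrite cat_rcons.
by move: ss'; rewrite -(cat1s a r) perm_catCA /= perm_cons.
Qed.

(** Adjacent swaps are simple reflections and lead from any order to any other. Weights are indexed
    by position, so [lam] does not change. *)
Lemma hwT_reorder m s s' X (lfX : locfin X) (x : X) lam :
  perm_eq s (iota 0 m) -> perm_eq s' (iota 0 m) -> hwT m s lam x -> x != 0 ->
  exists y, [/\ gen m x y, y != 0 & hwT m s' lam y].
Proof.
move=> sP s'P hx x0.
pose P r := perm_eq r (iota 0 m) /\ exists y, [/\ gen m x y, y != 0 & hwT m r lam y].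
suff [] : P s' by [].
apply: (@perm_swap_ind _ P _ s); last first.
- by split=> //; exists x; split=> //; exact: gen_refl.
- by rewrite (perm_trans sP)// perm_sym.
move=> s1 s2 a b [rP [y [xy y0 hy]]]; split.
  by apply: perm_trans rP; rewrite perm_cat2l -[X in perm_eq X _]/([:: b] ++ [:: a] ++ s2) perm_catCA.
have [z [yz z0 hz]] := hwT_swap lfX rP hy y0.
by exists z; split=> //; exact: gen_trans yz.
Qed.

End Levels.

Lemma spn_fin (F : fieldType) (X : lmodType F) (I : finType) (B : I -> X) (c : I -> F) :
  spn (fun k : 'I_#|I| => B (enum_val k)) (\sum_i c i *: B i).
Proof.
exists (fun k => c (enum_val k)).
by rewrite (reindex (@enum_val I I)) //; apply: onW_bij; exact: enum_val_bij.
Qed.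

Lemma env_gen_lin (F : fieldType) (g : lieAlgebra F) c (x y : g) :
  cls (Presentation (@env_augment F g)) (Gen F (c *: x + y)) =
  c *: cls _ (Gen F x) + cls _ (Gen F y).
Proof. by rewrite -clsZ -clsD; apply/cls_eqP/cong_rel; exact: env_lin. Qed.

(** * Local finiteness of the modules in use *)

Section LocallyFinite.
Variables (F : closedFieldType) (charF : [pchar F] =i pred0).
Local Notation sl := (slInf F).
Implicit Types (X Y : lieModule sl) (t : term F sl) (s : seq nat).

(** The family [B] only bounds the invariant subspace [A]; it need not lie in [A]. *)
Lemma locfin_intro X m (A : X -> Prop) (I : finType) (B : I -> X) (x : X) :
  subspace A -> (forall (z : sl) u, supp_below m (mx_of z) -> A u -> A (act z u)) ->
  A x -> (forall u, A u -> exists c : I -> F, u = \sum_i c i *: B i) ->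
  exists d (C : 'I_d -> X), spn C x /\
    forall z : sl, supp_below m (mx_of z) -> forall y, spn C y -> spn C (act z y).
Proof.
move=> sA AE Ax AB.
have AB' u : A u -> spn (fun k : 'I_#|I| => B (enum_val k)) u.
  by move=> /AB[c ->]; exact: spn_fin.
have [d [C [AC CA]]] := subspace_spanned sA AB'.
have CA' u : spn C u -> A u.
  move=> [c ->]; apply: subspace_sum => // i _; exact: subspaceZ.
exists d, C; split=> [|z mz y Cy]; first exact: CA.
by apply: CA; apply: AE => //; exact: CA'.
Qed.

Lemma locfin_sum X Y : locfin X -> locfin Y -> locfin (sumMod X Y).
Proof.
move=> lX lY m [x y].
have [d1 [B1 [xB E1]]] := lX m x; have [d2 [B2 [yB E2]]] := lY m y.
have [s1 s2] := (subspace_spn B1, subspace_spn B2).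
pose B (k : 'I_d1 + 'I_d2) : X * Y := match k with inl i => (B1 i, 0) | inr j => (0, B2 j) end.
apply: (@locfin_intro (sumMod X Y) m (fun u => spn B1 u.1 /\ spn B2 u.2) _ B) => //.
- split=> [|c u v [u1 u2] [v1 v2]]; first by split; [case: s1|case: s2].
  by split; [case: s1 => _; apply|case: s2 => _; apply].
- by move=> z u mz [u1 u2]; split; [exact: E1|exact: E2].
move=> [u v] /= [[c ->] [c' ->]].
exists (fun k => match k with inl i => c i | inr j => c' j end).
rewrite big_sumType /=.
have P1 (I : finType) (f : I -> X * Y) : \sum_i f i = (\sum_i (f i).1, \sum_i (f i).2).
  by elim/big_rec3: _ => //= i a b p _ ->; case: (f i).
have addE (p q : X * Y) : p + q = (p.1 + q.1, p.2 + q.2) by [].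
rewrite !P1 addE /=; congr pair.
  by rewrite [X in _ = _ + X]big1 ?addr0// => ? _; rewrite scaler0.
by rewrite [X in _ = X + _]big1 ?add0r// => ? _; rewrite scaler0.
Qed.

Lemma term_act_sum X Y t (x : X) (y : Y) :
  term_act t ((x, y) : sumMod X Y) = (term_act t x, term_act t y).
Proof.
elim: t x y => [z|c|t1 IH1 t2 IH2|t1 IH1 t2 IH2] x y //=.
  by rewrite IH1 IH2.
by rewrite IH2 IH1.
Qed.

(* The pair [(x, y)] generates a simple module inside the direct sum. *)
Lemma hwT_ann m s (sP : perm_eq s (iota 0 m)) X Y (lX : locfin X) (lY : locfin Y)
    (x : X) (y : Y) lam t :
  hwT m s lam x -> hwT m s lam y -> x != 0 -> y != 0 -> level m t ->
  term_act t x = 0 <-> term_act t y = 0.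
Proof.
move=> [wx hx] [wy hy] x0 y0 mt.
have lXY := locfin_sum lX lY; pose z : sumMod X Y := (x, y).
have hz : hwT m s lam z.
  by split=> [i im|i j ij jm]; rewrite /= /sum_act /=; [rewrite wx// wy|rewrite hx// hy].
have zt : gen m z (term_act t z) by exists t.
have tz : term_act t z = (term_act t x, term_act t y) := term_act_sum t x y.
split=> t0; apply/eqP; apply: contraT => nz.
- have [|t' mt'] := hwT_simple charF sP lXY hz zt.
    by rewrite tz xpair_eqE negb_and nz orbT.
  by rewrite tz t0 [RHS]term_act_sum term_act0 => -[xx]; rewrite xx eqxx in x0.
- have [|t' mt'] := hwT_simple charF sP lXY hz zt.
    by rewrite tz xpair_eqE negb_and nz.
  by rewrite tz t0 [RHS]term_act_sum term_act0 => -[_ yy]; rewrite yy eqxx in y0.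
Qed.

Lemma env_act_lin X c (u u' : envAlg sl) (v : X) :
  env_act (c *: u + u') v = c *: env_act u v + env_act u' v.
Proof.
have -> : c *: u + u' = cls _ (Add (Mul (Cst sl c) (repr u)) (repr u')).
  by rewrite clsD clsZ !reprP.
by rewrite env_act_cls.
Qed.

(** The finitely many traceless matrix units of level [m] span sl(m), so the subalgebra that they
    generate contains its action. *)
Lemma locfin_integrable X : integrable X -> locfin X.
Proof.
move=> intX m x; pose G (z : sl) : envAlg sl := cls _ (Gen F z).
pose us := [seq G (el F m i j) | i <- iota 0 m, j <- iota 0 m].
have [d [e eP]] := intX us x.
pose A w := exists2 u, gen_subalg us u & env_act u x = w.
have GA z : supp_below m (mx_of z) -> gen_subalg us (G z).
  move=> mz S SS uS; have [S1 SD SM] := SS.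
  have [S0 SA] := GRing.subalg_closedZ SS.
  have Ssum (I : Type) (r : seq I) (f : I -> envAlg sl) :
      (forall i, f i \in S) -> \sum_(i <- r) f i \in S.
    by move=> fS; elim/big_ind: _ => // a b Sa Sb; rewrite -[a]scale1r; exact: SD.
  have G_lin : forall c (y z : sl), G (c *: y + z) = c *: G y + G z := @env_gen_lin F sl.
  rewrite (el_span charF mz) (lin_sum G_lin); apply: (Ssum) => i.
  rewrite (lin_sum G_lin); apply: (Ssum) => j; rewrite (linZ G_lin) -[_ *: _]addr0.
  apply: SD => //; apply: uS; apply/allpairsP; exists (i : nat, j : nat) => /=.
  by rewrite !mem_iota /= !ltn_ord.
have A0 : subspace A.
  split=> [|c w w' [u gu <-] [u' gu' <-]].
    exists (0 : envAlg sl); first by move=> S /GRing.subalg_closedZ[].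
    exact: (lin0 (f := fun u => env_act u x) (fun c u v => env_act_lin c u v x)).
  exists (c *: u + u'); last exact: env_act_lin.
  by move=> S SS uS; have [_ SD _] := SS; apply: SD; [exact: gu|exact: gu'].
apply: (@locfin_intro X m A _ e) => //.
- move=> z w mz [u gu <-]; exists (G z * u); last first.
    by rewrite -[u in LHS]reprP -clsM env_act_cls.
  by move=> S SS uS; have [S1 SD SM] := SS; apply: SM; [exact: (GA z)|exact: gu].
- exists 1; first by move=> S [S1 _ _].
  by rewrite -[1]scale1r -[_ *: 1]/(1%:A) -clsC env_act_cls /= scale1r.
Qed.

Lemma sum_vec_of (I : Type) (r : seq I) (f : I -> finvec F) k :
  vec_of (\sum_(i <- r) f i) k = \sum_(i <- r) vec_of (f i) k.
Proof.
elim: r => [|i r IH]; first by rewrite !big_nil.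
by rewrite !big_cons -[f i]scale1r vec_ofP -IH !scale1r.
Qed.

Lemma unitvec_subproof (i : nat) : (fun k : nat => (k == i)%:R : F) \in @finvec_pred F.
Proof. by apply/asboolP; exists i.+1 => k ik; rewrite gtn_eqF. Qed.

Definition unitvec (i : nat) : finvec F :=
  exist (fun v : infvec F => v \in @finvec_pred F) _ (unitvec_subproof i).

Lemma finvec_span n (v : finvec F) : (forall k, (n <= k)%N -> vec_of v k = 0) ->
  v = \sum_(i < n) vec_of v i *: unitvec i.
Proof.
move=> v0; apply: vec_of_inj; apply/funext => k; rewrite sum_vec_of.
have E (i : 'I_n) : vec_of (vec_of v i *: unitvec i) k = vec_of v i * (k == i)%:R by [].
under eq_bigr do rewrite E.
have [kn|nk] := ltnP k n.
  rewrite (bigD1 (Ordinal kn))//= eqxx mulr1 big1 ?addr0// => i.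
  by rewrite -val_eqE /= eq_sym => /negPf->; rewrite mulr0.
rewrite v0// big1// => i _; rewrite gtn_eqF ?mulr0//.
exact: leq_trans (ltn_ord i) nk.
Qed.

Lemma finvec_bound (v : finvec F) : exists n, forall k, (n <= k)%N -> vec_of v k = 0.
Proof. by have /asboolP := valP v. Qed.

Lemma locfin_Vinf : locfin (Vinf F) /\ locfin (Vinf_dual F).
Proof.
have sA N : subspace (fun u : finvec F => forall k, (N <= k)%N -> vec_of u k = 0).
  split=> // c u v u0 v0 k Nk.
  by rewrite vec_ofP [LHS](_ : _ = c * vec_of u k + vec_of v k)// u0// v0// mulr0 addr0.
split=> m v; have [n vn] := finvec_bound v; pose N := maxn n m.
- apply: (@locfin_intro (Vinf F) m (fun u => forall k, (N <= k)%N -> vec_of u k = 0) _ (fun i : 'I_N => unitvec i)) => //.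
  + move=> z u mz u0 k Nk; rewrite vec_of_natural_act (mulvec_trunc _ _ mz) big1// => i _.
    by rewrite mz ?mul0r// (leq_trans _ Nk)// leq_maxr.
  + by move=> k Nk; apply: vn; rewrite (leq_trans _ Nk)// leq_maxl.
  + by move=> u u0; exists (fun i : 'I_N => vec_of u i); exact: finvec_span.
- apply: (@locfin_intro (Vinf_dual F) m (fun u => forall k, (N <= k)%N -> vec_of u k = 0) _ (fun i : 'I_N => unitvec i)) => //.
  + move=> z u mz u0 k Nk; rewrite vec_of_conatural_act.
    rewrite [LHS](_ : _ = - mulcovec (vec_of u) (mx_of z) k)//.
    rewrite (mulcovec_trunc _ _ mz) big1 ?oppr0// => i _.
    by rewrite mz ?mulr0// (leq_trans _ Nk) ?orbT// leq_maxr.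
  + by move=> k Nk; apply: vn; rewrite (leq_trans _ Nk)// leq_maxl.
  + by move=> u u0; exists (fun i : 'I_N => vec_of u i); exact: finvec_span.
Qed.

Section Tensor.
Variables (W : lieModule sl).
Local Notation T := (tensorMod W).

Definition tg (v : W) : T := tensor_cls (Gen F v).

Lemma tg_lin c v w : tg (c *: v + w) = c *: tg v + tg w.
Proof.
rewrite /tg /tensor_cls -clsZ -clsD; apply/cls_eqP/cong_rel; exact: tensor_lin.
Qed.

Lemma act_tg z v : act z (tg v) = tg (act z v).
Proof. exact: tensor_act_cls. Qed.

Lemma act_tM z (a b : tensorAlg W) : act z (a * b : T) =
  (act z (a : T) : tensorAlg W) * b + a * (act z (b : T) : tensorAlg W) :> tensorAlg W.
Proof.
elim/cls_ind: a => s; elim/cls_ind: b => t.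
rewrite -clsM -[cls _ s]/(tensor_cls s) -[cls _ t]/(tensor_cls t).
have h u : act z (cls _ u : T) = tensor_cls (term_der z u) := tensor_act_cls z u.
by rewrite !h /= /tensor_cls clsD !clsM.
Qed.

Lemma act_tC z c : @act F sl T z (c%:A : tensorAlg W) = 0.
Proof.
rewrite -clsC; have h u : act z (cls _ u : T) = tensor_cls (term_der z u) := tensor_act_cls z u.
by rewrite h /= /tensor_cls clsC scale0r.
Qed.

Lemma locfin_tensor : locfin W -> locfin T.
Proof.
move=> lW m; elim/cls_ind; elim=> [v|c|t1 IH1 t2 IH2|t1 IH1 t2 IH2].
- have [d [B [Bv BE]]] := lW m v.
  apply: (@locfin_intro T m (fun a => exists2 u, spn B u & a = tg u) _ (fun i => tg (B i))).
  + split=> [|c a b [u Bu ->] [w Bw ->]].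
      exists 0; first by case: (subspace_spn B).
      by rewrite (lin0 tg_lin).
    exists (c *: u + w); last by rewrite tg_lin.
    by case: (subspace_spn B) => _; apply.
  + by move=> z a mz [u Bu ->]; exists (act z u); [exact: BE|exact: act_tg].
  + by exists v.
  + move=> a [u [c ->] ->]; exists c.
    by rewrite (lin_sum tg_lin); apply: eq_bigr => i _; rewrite (linZ tg_lin).
- apply: (@locfin_intro T m (fun a => exists c, a = c%:A) _ (fun _ : 'I_1 => 1)).
  + split=> [|c' a b [x ->] [y ->]]; first by exists 0; rewrite scale0r.
    by exists (c' * x + y); rewrite scalerDl scalerA.
  + by move=> z a mz [x ->]; exists 0; rewrite scale0r act_tC.
  + by exists c; rewrite clsC.
  + by move=> a [x ->]; exists (fun=> x); rewrite big_ord1.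
- move: IH1 IH2 => [d1 [B1 [xB E1]]] [d2 [B2 [yB E2]]].
  have [s1 s2] := (subspace_spn B1, subspace_spn B2).
  pose B (k : 'I_d1 + 'I_d2) : T := match k with inl i => B1 i | inr j => B2 j end.
  apply: (@locfin_intro T m (fun a => exists u v, [/\ spn B1 u, spn B2 v & a = u + v]) _ B).
  + split=> [|c a b [u [v [u1 v1 ->]]] [u' [v' [u1' v1' ->]]]].
      by exists 0, 0; rewrite addr0; split=> //; [case: s1|case: s2].
    exists (c *: u + u'), (c *: v + v'); split; [by case: s1 => _; apply|by case: s2 => _; apply|].
    by rewrite scalerDr addrACA.
  + move=> z a mz [u [v [u1 v1 ->]]]; exists (act z u), (act z v).
    by rewrite actDrr; split=> //; [exact: E1|exact: E2].
  + by exists (cls _ t1), (cls _ t2); rewrite clsD.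
  + move=> a [u [v [[c ->] [c' ->] ->]]].
    exists (fun k => match k with inl i => c i | inr j => c' j end).
    by rewrite big_sumType.
- move: IH1 IH2 => [d1 [B1 [xB E1]]] [d2 [B2 [yB E2]]].
  pose B (k : 'I_d1 * 'I_d2) : tensorAlg W := (B1 k.1 : tensorAlg W) * B2 k.2.
  pose A (a : T) := exists c : 'I_d1 * 'I_d2 -> F, a = \sum_k c k *: B k.
  have AM u v : spn B1 u -> spn B2 v -> A ((u : tensorAlg W) * v).
    move=> [c ->] [c' ->]; exists (fun k => c k.1 * c' k.2).
    rewrite mulr_suml; under eq_bigr do rewrite mulr_sumr.
    rewrite pair_big /=; apply: eq_bigr => k _.
    by rewrite /B -scalerAl -scalerAr scalerA.
  have sA : subspace A.
    split=> [|c a b [x ->] [y ->]].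
      by exists (fun=> 0); rewrite big1// => k _; rewrite scale0r.
    exists (fun k => c * x k + y k); rewrite scaler_sumr -big_split.
    by apply: eq_bigr => k _ /=; rewrite scalerDl scalerA.
  apply: (@locfin_intro T m A _ B) => //.
  + move=> z a mz [c ->]; rewrite act_sumr; apply: subspace_sum => // k _.
    rewrite actZr; apply: subspaceZ => //; rewrite act_tM.
    by apply: subspaceD => //; apply: AM; try exact: spn_mem; [apply: E1|apply: E2] => //; exact: spn_mem.
  + by rewrite clsM; exact: AM.
Qed.

End Tensor.

End LocallyFinite.

(** * Tensor vectors *)

Section Contraction.
Variables (F : fieldType) (W : lmodType F) (phi : W -> F).
Hypothesis phi_lin : forall (c : F) (v w : W), phi (c *: v + w) = c * phi v + phi w.
Local Notation T := (tensorAlg W).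
Let P := Presentation (@tensor_augment F W).

(** Contraction of the first tensor factor with [phi]. The augmentation picks the degree 0 part of
    [s], behind which the first factor belongs to [t]. These contractions detect nonzero elements of
    an algebra that is known only by its presentation. *)
Fixpoint term_contr (t : term F W) : term F W :=
  match t with
  | Gen v => Cst W (phi v)
  | Cst _ => Cst W 0
  | Add s t => Add (term_contr s) (term_contr t)
  | Mul s t => Add (Mul (term_contr s) t) (Mul (Cst W (augment s)) (term_contr t))
  end.

Let C (t : term F W) : T := cls P t.

Let CE := (@clsD F W P, @clsM F W P, @clsC F W P).

Lemma term_contr_cong s t : cong (@tensor_rel F W) s t ->
  C (term_contr s) = C (term_contr t).
Proof.
have CEq u v : cong (@tensor_rel F W) u v -> C u = C v by move=> h; exact/(@cls_eqP F W P).
have aug u v (h : cong (@tensor_rel F W) u v) := @cong_augment F W P u v h.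
rewrite /C; elim=> /=.
- move=> {}s {}t [c v w] /=; rewrite !CE phi_lin.
  by rewrite scale0r mul0r add0r scalerDl mulr_algl scalerA.
- by [].
- by move=> ? ? _ ->.
- by move=> ? ? ? _ -> _ ->.
- by move=> ? ? ? ? _ IH1 _ IH2; rewrite !CE IH1 IH2.
- move=> ? ? ? ? h1 IH1 h2 IH2; rewrite !CE IH1 IH2 (aug _ _ h1).
  by have := CEq _ _ h2; rewrite /C => ->.
- by move=> *; rewrite !CE addrA.
- by move=> *; rewrite !CE addrC.
- by move=> *; rewrite !CE scale0r add0r.
- move=> *; rewrite !CE !mulr_algl /= mulrDl -scalerAl scalerDr scalerA !mulrA addrA.
  by [].
- by move=> *; rewrite !CE !mulr_algl scale0r add0r scale1r.
- by move=> *; rewrite !CE !mulr_algl !scale0r addr0.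
- by move=> *; rewrite !CE !mulr_algl scalerDl !mulrDl addrACA.
- by move=> *; rewrite !CE !mulr_algl scalerDr !mulrDr addrACA.
- by move=> *; rewrite !CE !mulr_algl !scale0r scaler0 add0r addr0 mulr_algr.
- by move=> *; rewrite !CE scale0r addr0.
- by move=> *; rewrite !CE !mulr_algl !scale0r scaler0 addr0.
Qed.

Definition contr (a : T) : T := C (term_contr (repr a)).

Lemma contr_cls t : contr (cls P t) = C (term_contr t).
Proof. exact: (term_contr_cong (repr_cls P t)). Qed.

Lemma contr_lin c a b : contr (c *: a + b) = c *: contr a + contr b.
Proof.
rewrite -[a]reprP -[b]reprP; move: (repr a) (repr b) => s t.
rewrite -clsZ -clsD !contr_cls /C /= !CE.
by rewrite scale0r mul0r add0r mulr_algl.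
Qed.

Lemma contr_gen v (a : T) : contr (cls P (Gen F v) * a) = phi v *: a.
Proof.
rewrite -[a]reprP -clsM contr_cls /C /= !CE.
by rewrite scale0r mul0r addr0 mulr_algl.
Qed.

End Contraction.

Section Alternating.
Variables (F : closedFieldType) (charF : [pchar F] =i pred0).
Variables (R : algType F).
Implicit Types (n : nat).

Definition altg n (g : 'I_n -> R) : R :=
  \sum_(s : 'S_n) (-1) ^+ s *: \prod_(i < n) g (s i).

Lemma altg_alternate n (g : 'I_n -> R) i j : i != j -> g i = g j -> altg g = 0.
Proof.
move=> ij gij; have H : altg g = - altg g.
  rewrite {1}/altg (reindex_inj (mulIg (tperm i j))) /= /altg -sumrN.
  apply: eq_bigr => s _; rewrite odd_permM odd_tperm ij addbT signrN scaleNr.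
  congr (- (_ *: _)); apply: eq_bigr => k _.
  by rewrite permM; case: tpermP => // ->.
apply/eqP; have : 2%:R *: altg g == 0 by rewrite scaler_nat mulr2n {1}H addNr.
by rewrite scaler_eq0 => /orP[/eqP h|//]; have := natF_inj charF (h : 2%:R = 0%:R).
Qed.

Definition subst n (g : 'I_n -> R) (k : 'I_n) (u : R) : 'I_n -> R :=
  fun i => if i == k then u else g i.

Lemma prod_subst_lin n (g : 'I_n -> R) k (c : F) u v :
  \prod_(i < n) subst g k (c *: u + v) i =
  c *: \prod_(i < n) subst g k u i + \prod_(i < n) subst g k v i.
Proof.
have := index_enum_uniq 'I_n; have := mem_index_enum k.
move: (index_enum _) => r /splitPr[p q] upq.
have split w : \prod_(i <- p ++ k :: q) subst g k w i =
    (\prod_(i <- p) g i) * w * (\prod_(i <- q) g i).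
  move: upq; rewrite cat_uniq /= negb_or => /and3P[_ /andP[kp _] /andP[kq _]].
  rewrite big_cat big_cons /= mulrA; congr (_ * _ * _).
  - apply: eq_big_seq => i ip; rewrite /subst; case: eqP => // ik.
    by rewrite -ik ip in kp.
  - by rewrite /subst eqxx.
  - apply: eq_big_seq => i iq; rewrite /subst; case: eqP => // ik.
    by rewrite -ik iq in kq.
by rewrite !split mulrDr mulrDl -scalerAr -scalerAl.
Qed.

Lemma altg_subst_lin n (g : 'I_n -> R) k (c : F) u v :
  altg (subst g k (c *: u + v)) = c *: altg (subst g k u) + altg (subst g k v).
Proof.
rewrite /altg scaler_sumr -big_split; apply: eq_bigr => s _ /=.
have E w : \prod_(i < n) subst g k w (s i) = \prod_(i < n) subst (fun i => g (s i)) ((s^-1)%g k) w i.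
  by apply: eq_bigr => i _; rewrite /subst (canF_eq (permK s)) || (rewrite /subst; congr (if _ then _ else _); rewrite -{2}[k](permKV s) (inj_eq perm_inj)).
by rewrite !E prod_subst_lin scalerDr !scalerA mulrC.
Qed.

Variable D : R -> R.
Hypothesis D_lin : forall (c : F) (a b : R), D (c *: a + b) = c *: D a + D b.
Hypothesis DM : forall a b, D (a * b) = D a * b + a * D b.
Hypothesis D1 : D 1 = 0.

Lemma deriv_prod n (g : 'I_n -> R) :
  D (\prod_(i < n) g i) = \sum_k \prod_(i < n) subst g k (D (g k)) i.
Proof.
elim: n g => [|n IH] g; first by rewrite !big_ord0.
rewrite big_ord_recl DM IH [RHS]big_ord_recl; congr (_ + _).
  by rewrite big_ord_recl /subst eqxx; congr (_ * _); apply: eq_bigr.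
rewrite mulr_sumr; apply: eq_bigr => k _; rewrite big_ord_recl.
by congr (_ * _); apply: eq_bigr => i _.
Qed.

Lemma deriv_altg n (g : 'I_n -> R) :
  D (altg g) = \sum_k altg (subst g k (D (g k))).
Proof.
rewrite /altg exchange_big /= (lin_sum D_lin).
apply: eq_bigr => s _; rewrite (linZ D_lin) -scaler_sumr deriv_prod; congr (_ *: _).
rewrite [RHS](reindex_inj (@perm_inj _ s)); apply: eq_bigr => k _; apply: eq_bigr => i _.
by rewrite /subst (inj_eq perm_inj).
Qed.

Variable h : nat -> R.

Definition alt (l : seq nat) : R := altg (fun i : 'I_(size l) => h (nth 0%N l i)).

(** If [p] and [q] differ, replacing [h p] by [h q] repeats a factor that is already there, and the
    alternating sum vanishes; only diagonal contributions remain. *)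
Lemma deriv_alt l (p q : nat) (kappa : F) (nu : nat -> F) : uniq l ->
  (forall c, D (h c) = (kappa * (c == p)%:R) *: h q + nu c *: h c) ->
  (p \in l -> q \in l) ->
  D (alt l) = ((if p == q then kappa * (p \in l)%:R else 0) + \sum_(c <- l) nu c) *: alt l.
Proof.
move=> ul Dh pq; rewrite /alt deriv_altg; set g := fun i : 'I_(size l) => h (nth 0%N l i).
have E k : altg (subst g k (D (g k))) =
    ((if p == q then kappa * (nth 0%N l k == p)%:R else 0) + nu (nth 0%N l k)) *: altg g.
  have gk : altg (subst g k (g k)) = altg g.
    by rewrite /altg; apply: eq_bigr => s _; congr (_ *: _); apply: eq_bigr => i _; rewrite /subst; case: eqP => [->|].
  have altZ := linZ (f := fun u => altg (subst g k u)) (altg_subst_lin g k).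
  rewrite {2}/g Dh altg_subst_lin altZ gk scalerDl; congr (_ + _).
  case: (eqVneq (nth 0%N l k) p) => [kp|]; last by rewrite mulr0 !scale0r if_same scale0r.
  rewrite mulr1; case: (eqVneq p q) => [e|npq].
    by rewrite -e -kp gk.
  rewrite scale0r; have ql : q \in l by apply: pq; rewrite -kp mem_nth.
  have qs : (index q l < size l)%N by rewrite index_mem.
  have nk : Ordinal qs != k.
    apply: contra npq => /eqP e; rewrite -kp -e /= nth_index//.
  by rewrite (@altg_alternate _ _ (Ordinal qs) k) ?scaler0// /subst eqxx (negPf nk) /g /= nth_index.
rewrite (eq_bigr _ (fun k _ => E k)) -scaler_suml big_split /=; congr ((_ + _) *: _); last first.
  by rewrite -(big_mkord xpredT (fun i => nu (nth 0%N l i))) -(big_nth 0%N xpredT nu).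
case: eqP => [->|_]; last by rewrite big1.
rewrite -mulr_sumr; congr (_ * _).
rewrite -(big_mkord xpredT (fun i => (nth 0%N l i == q)%:R)) -(big_nth 0%N xpredT (fun c => (c == q)%:R)).
elim: l ul {pq g E} => [|c l IH] /=; first by rewrite big_nil.
move=> /andP[cl ul]; rewrite big_cons IH// inE eq_sym; case: eqP => [e|_]; last by rewrite add0r.
by rewrite e (negPf cl) addr0.
Qed.

Lemma deriv_prod_eig (I : eqType) (r : seq I) (f : I -> R) (nu : I -> F) :
  (forall i, i \in r -> D (f i) = nu i *: f i) ->
  D (\prod_(i <- r) f i) = (\sum_(i <- r) nu i) *: \prod_(i <- r) f i.
Proof.
elim: r => [|i r IH] Df; first by rewrite !big_nil D1 scale0r.
rewrite !big_cons DM Df ?mem_head// IH => [|j jr]; last by rewrite Df// inE jr orbT.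
by rewrite -scalerAl -scalerAr -scalerDl.
Qed.

End Alternating.

Section TensorVectors.
Variables (F : closedFieldType) (charF : [pchar F] =i pred0).
Local Notation sl := (slInf F).
Local Notation W := (sumMod (Vinf F) (Vinf_dual F)).
Local Notation T := (tensorMod W).
Local Notation TA := (tensorAlg W).

Lemma locfin_T : locfin T.
Proof.
by apply: locfin_tensor; apply: locfin_sum; [exact: (locfin_Vinf F).1|exact: (locfin_Vinf F).2].
Qed.

Definition evec (i : nat) : W := (unitvec F i, 0).
Definition fvec (i : nat) : W := (0, unitvec F i).

Lemma tr_dmx m a b : (a < m)%N -> \tr (dmx F m a b) = (a == b)%:R.
Proof.
move=> am; rewrite /mxtrace (bigD1 (Ordinal am))//= big1 ?addr0; first by rewrite mxE /= eqxx.
by move=> k; rewrite -val_eqE /= mxE => /negPf->.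
Qed.

Lemma mx_of_el m a b i j : (a < m)%N -> (b < m)%N -> mx_of (el F m a b) i j =
  ((i == a) && (j == b))%:R - (a == b)%:R / m%:R * ((i == j) && (i < m)%N)%:R.
Proof.
move=> am bm; rewrite (mx_of_slm charF).
have [im|mi] := ltnP i m; last first.
  rewrite supp_corner ?mi// andbF mulr0 subr0; case: eqP => // ia.
  by move: mi; rewrite ia leqNgt am.
have [jm|mj] := ltnP j m; last first.
  rewrite supp_corner ?mj ?orbT//; have -> : (i == j) = false.
    by apply/eqP => ij; move: mj; rewrite -ij leqNgt im.
  rewrite mulr0 subr0; case: (j =P b) => [jb|]; last by rewrite andbF.
  by move: mj; rewrite jb leqNgt bm.
rewrite -[i]/(val (Ordinal im)) -[j]/(val (Ordinal jm)) cornerE /traceless tr_dmx//.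
by rewrite !mxE -val_eqE /= andbT mulr_natr.
Qed.

Lemma vec_of_unit i k : vec_of (unitvec F i) k = (k == i)%:R.
Proof. by []. Qed.

Lemma mulvec_unit (A : infmx F) c i m : supp_below m A ->
  mulvec A (vec_of (unitvec F c)) i = A i c.
Proof.
move=> A0; rewrite (mulvec_trunc _ _ A0).
have [cm|mc] := ltnP c m; last first.
  by rewrite A0 ?mc ?orbT// big1// => k _; rewrite vec_of_unit ltn_eqF ?mulr0// (leq_trans (ltn_ord k)).
rewrite (bigD1 (Ordinal cm))//= vec_of_unit eqxx mulr1 big1 ?addr0// => k.
by rewrite vec_of_unit -val_eqE /= => /negPf->; rewrite mulr0.
Qed.

Lemma mulcovec_unit (A : infmx F) c i m : supp_below m A ->
  mulcovec (vec_of (unitvec F c)) A i = A c i.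
Proof.
move=> A0; rewrite (mulcovec_trunc _ _ A0).
have [cm|mc] := ltnP c m; last first.
  by rewrite A0 ?mc// big1// => k _; rewrite vec_of_unit ltn_eqF ?mul0r// (leq_trans (ltn_ord k)).
rewrite (bigD1 (Ordinal cm))//= vec_of_unit eqxx mul1r big1 ?addr0// => k.
by rewrite vec_of_unit -val_eqE /= => /negPf->; rewrite mul0r.
Qed.

Lemma act_evec m a b c : (a < m)%N -> (b < m)%N ->
  act (el F m a b : sl) (evec c) =
  (c == b)%:R *: evec a - ((a == b)%:R / m%:R * (c < m)%:R) *: evec c.
Proof.
move=> am bm; have E0 := @act0r F sl (Vinf_dual F) (el F m a b).
rewrite /= /sum_act /= [conatural_act _ _]E0 /evec.
have H (x y : F) (u v : finvec F) : x *: ((u, 0) : W) - y *: ((v, 0) : W) = (x *: u - y *: v, 0) :> W.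
  rewrite /GRing.scale /= /scale_pair /= !scaler0 -[in RHS](subr0 (0 : Vinf_dual F)).
  by [].
rewrite H; congr pair; apply: vec_of_inj; rewrite vec_of_natural_act; apply/funext => i.
rewrite (mulvec_unit _ _ (@supp_el _ charF m a b)) mx_of_el//.
rewrite [RHS](_ : _ = (c == b)%:R * (i == a)%:R - ((a == b)%:R / m%:R * (c < m)%:R) * (i == c)%:R)//.
rewrite -[_ * (c < m)%:R * _]mulrA -!natrM !mulnb [(c == b) && _]andbC [c == b]eq_sym; congr (_ - _ * _%:R).
by case: (i =P c) => [->|]; rewrite ?andbT ?andbF.
Qed.

Lemma act_fvec m a b c : (a < m)%N -> (b < m)%N ->
  act (el F m a b : sl) (fvec c) =
  (- (c == a)%:R) *: fvec b + ((a == b)%:R / m%:R * (c < m)%:R) *: fvec c.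
Proof.
move=> am bm; have E0 := @act0r F sl (Vinf F) (el F m a b).
rewrite /= /sum_act /= [natural_act _ _]E0 /fvec.
have H (x y : F) (u v : finvec F) : x *: ((0, u) : W) + y *: ((0, v) : W) = (0, x *: u + y *: v) :> W.
  rewrite /GRing.scale /= /scale_pair /= !scaler0 -[in RHS](addr0 (0 : Vinf F)).
  by [].
rewrite H; congr pair; apply: vec_of_inj; rewrite vec_of_conatural_act; apply/funext => i.
rewrite [LHS](_ : _ = - mulcovec (vec_of (unitvec F c)) (mx_of (el F m a b)) i)//.
rewrite (mulcovec_unit _ _ (@supp_el _ charF m a b)) mx_of_el//.
rewrite [RHS](_ : _ = - (c == a)%:R * (i == b)%:R + ((a == b)%:R / m%:R * (c < m)%:R) * (i == c)%:R)//.
rewrite opprB addrC mulNr -[_ * (c < m)%:R * _]mulrA -!natrM !mulnb; congr (- _ + _ * _%:R).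
by rewrite [i == c]eq_sym andbC.
Qed.

Definition ev (i : nat) : TA := tg (evec i).
Definition fv (i : nat) : TA := tg (fvec i).

Definition tensor_vec (ls ks : seq (seq nat)) : TA :=
  \prod_(l <- ls) alt ev l * \prod_(k <- ks) alt fv k.

(** The weight of an exterior product of basis vectors under [el F m a a]. The identity of sl(m)'s
    natural space fixes the factors with index below [m] and kills the others, hence the count. *)
Definition colwt m (l : seq nat) (a : nat) : F :=
  (a \in l)%:R - (count (fun c => c < m)%N l)%:R / m%:R.

Let D m a b (u : TA) : TA := act (el F m a b : sl) (u : T).

Lemma D_lin m a b (c : F) (u v : TA) : D m a b (c *: u + v) = c *: D m a b u + D m a b v.
Proof. exact: (@actDr F sl T c (el F m a b) u v). Qed.

Lemma DM m a b (u v : TA) : D m a b (u * v) = D m a b u * v + u * D m a b v.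
Proof. exact: (@act_tM F W (el F m a b) u v). Qed.

Lemma D1 m a b : D m a b 1 = 0.
Proof. by have := @act_tC F W (el F m a b : sl) 1; rewrite scale1r. Qed.

Lemma sum_count (P : pred nat) (l : seq nat) : \sum_(c <- l) (P c)%:R = (count P l)%:R :> F.
Proof. by elim: l => [|c l IH]; rewrite ?big_nil// big_cons IH /= natrD. Qed.

Lemma act_alt_ev m a b l : (a < m)%N -> (b < m)%N -> uniq l -> (b \in l -> a \in l) ->
  D m a b (alt ev l) = (if a == b then colwt m l a else 0) *: alt ev l.
Proof.
move=> am bm ul ba.
rewrite (@deriv_alt F charF TA (D m a b) (D_lin m a b) (DM m a b) (D1 m a b) ev l b a 1
  (fun c => - ((a == b)%:R / m%:R * (c < m)%:R)))//.
  congr (_ *: _); rewrite sumrN -mulr_sumr (sum_count (fun c => c < m)%N) eq_sym; case: eqP => [->|_].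
    by rewrite !mul1r mulrC.
  by rewrite !mul0r subr0.
move=> c; rewrite /D /ev act_tg act_evec// -scaleNr mul1r.
by rewrite tg_lin; congr (_ + _); exact: (linZ (@tg_lin F W)).
Qed.

Lemma act_alt_fv m a b l : (a < m)%N -> (b < m)%N -> uniq l -> (a \in l -> b \in l) ->
  D m a b (alt fv l) = (if a == b then - colwt m l a else 0) *: alt fv l.
Proof.
move=> am bm ul ba.
rewrite (@deriv_alt F charF TA (D m a b) (D_lin m a b) (DM m a b) (D1 m a b) fv l a b (-1)
  (fun c => (a == b)%:R / m%:R * (c < m)%:R))//.
  congr (_ *: _); rewrite -mulr_sumr (sum_count (fun c => c < m)%N); case: eqP => [->|_].
    by rewrite mulN1r mul1r opprB addrC mulrC.
  by rewrite !mul0r addr0.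
move=> c; rewrite /D /fv act_tg act_fvec// mulN1r.
by rewrite tg_lin; congr (_ + _); exact: (linZ (@tg_lin F W)).
Qed.

Definition tvwt m ls ks a : F :=
  \sum_(l <- ls) colwt m l a - \sum_(k <- ks) colwt m k a.

Lemma act_tensor_vec m a b ls ks : (a < m)%N -> (b < m)%N ->
  {in ls, forall l, uniq l /\ (b \in l -> a \in l)} ->
  {in ks, forall k, uniq k /\ (a \in k -> b \in k)} ->
  D m a b (tensor_vec ls ks) = (if a == b then tvwt m ls ks a else 0) *: tensor_vec ls ks.
Proof.
move=> am bm hl hk; rewrite /tensor_vec DM.
rewrite (@deriv_prod_eig _ _ _ (DM m a b) (D1 m a b) _ ls (alt ev) (fun l => if a == b then colwt m l a else 0)); last first.
  by move=> l /hl[ul ba]; exact: act_alt_ev.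
rewrite (@deriv_prod_eig _ _ _ (DM m a b) (D1 m a b) _ ks (alt fv) (fun l => if a == b then - colwt m l a else 0)); last first.
  by move=> l /hk[ul ba]; exact: act_alt_fv.
rewrite -scalerAl -scalerAr -scalerDl; congr (_ *: _); rewrite /tvwt.
by case: eqP => _; rewrite ?sumrN//; rewrite !big1 ?addr0.
Qed.

(** A raising operator replaces a basis vector by an earlier one, and a dual basis vector by a later
    one. Each index set contains the replacement already, so every off-diagonal contribution has a
    repeated factor. *)
Lemma tensor_vec_hw m s ls ks : perm_eq s (iota 0 m) ->
  {in ls, forall l, uniq l /\ forall i j, (i < j)%N -> (j < m)%N -> nth 0%N s j \in l -> nth 0%N s i \in l} ->
  {in ks, forall k, uniq k /\ forall i j, (i < j)%N -> (j < m)%N -> nth 0%N s i \in k -> nth 0%N s j \in k} ->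
  hwT m s (fun i => tvwt m ls ks (nth 0%N s i)) (tensor_vec ls ks : T).
Proof.
move=> sP hl hk; have ss : size s = m by rewrite (perm_size sP) size_iota.
have sm i : (i < m)%N -> (nth 0%N s i < m)%N.
  move=> im; have : nth 0%N s i \in s by rewrite mem_nth ?ss.
  by rewrite (perm_mem sP) mem_iota.
split=> [i im|i j ij jm].
  have := @act_tensor_vec m (nth 0%N s i) (nth 0%N s i) ls ks; rewrite eqxx; apply; rewrite ?sm//.
    by move=> l /hl[].
  by move=> k /hk[].
have im := ltn_trans ij jm.
have := @act_tensor_vec m (nth 0%N s i) (nth 0%N s j) ls ks.
rewrite nth_uniq ?ss// ?(perm_uniq sP) ?iota_uniq// (ltn_eqF ij) scale0r; apply; rewrite ?sm//.
  by move=> l /hl[ul H]; split=> //; exact: H.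
by move=> k /hk[uk H]; split=> //; exact: H.
Qed.

(** Contracting successively with the functionals dual to the entries of [l] kills every summand of
    the alternating sum except that of the identity permutation, and returns [x]. *)
Lemma contr_alt (h : nat -> W) (phi : nat -> W -> F) l (x : TA) : uniq l ->
  (forall i (c : F) v w, phi i (c *: v + w) = c * phi i v + phi i w) ->
  (forall i j, phi i (h j) = (i == j)%:R) ->
  alt (fun i => tg (h i) : TA) l * x = 0 -> x = 0.
Proof.
move=> ul pl ph.
pose C (is_ : seq nat) (u : TA) := foldl (fun a i => contr (phi i) a) u is_.
have C_lin is_ c u v : C is_ (c *: u + v) = c *: C is_ u + C is_ v.
  by elim: is_ u v => //= i is_ IH u v; rewrite contr_lin ?IH//; exact: pl.
have Cw n (f g : nat -> nat) : C (map f (iota 0 n)) (\prod_(i < n) (tg (h (g i)) : TA) * x) =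
    (\prod_(i < n) (f i == g i)%:R) *: x.
  have Ccons i is_ u : C (i :: is_) u = C is_ (contr (phi i) u) by [].
  elim: n f g => [|n IH] f g; first by rewrite !big_ord0 mul1r scale1r.
  rewrite !big_ord_recl [iota 0 n.+1]/= map_cons Ccons -mulrA (contr_gen (pl (f 0%N))) ph.
  rewrite (linZ (C_lin _)).
  rewrite (iotaDl 1 0 n) -map_comp.
  by rewrite (IH (f \o (addn 1)) (fun i => g i.+1)) scalerA.
rewrite /alt /altg mulr_suml; under eq_bigr do rewrite -scalerAl.
move/(congr1 (C l)); rewrite (lin0 (C_lin l)) (lin_sum (C_lin l)).
have lE : l = map (nth 0%N l) (iota 0 (size l)) by rewrite map_nth_iota0// take_size.
have E (s : 'S_(size l)) : C l (\prod_(i < size l) (tg (h (nth 0%N l (s i))) : TA) * x) = (s == 1%g)%:R *: x.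
  pose g i := if insub i is Some i' then nth 0%N l (s i') else 0%N.
  have -> : \prod_(i < size l) (tg (h (nth 0%N l (s i))) : TA) = \prod_(i < size l) (tg (h (g i)) : TA).
    by apply: eq_bigr => i _; rewrite /g valK.
  rewrite {1}lE Cw; congr (_ *: _); case: eqP => s1.
    by rewrite big1// => i _; rewrite /g valK s1 perm1 eqxx.
  have [i si] : exists i, s i <> i.
    apply/existsNP => si; apply: s1; apply/permP => i; rewrite perm1; exact: si.
  rewrite (bigD1 i)//= /g valK nth_uniq// (_ : (i == s i :> nat) = false) ?mul0r//.
  by apply/eqP => /val_inj/esym.
under eq_bigr do rewrite (linZ (C_lin l)) E; rewrite (bigD1 (1%g : 'S_(size l)))//= eqxx odd_perm1 expr0 !scale1r.
by rewrite big1 ?addr0// => s /negPf->; rewrite scale0r scaler0.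
Qed.

Lemma alt_ev_inj l (x : TA) : uniq l -> alt ev l * x = 0 -> x = 0.
Proof.
move=> ul e0; refine (@contr_alt evec (fun i v => vec_of v.1 i) l x ul _ _ e0).
  by move=> i c v w; rewrite (vec_ofP c v.1 w.1).
by move=> i j; exact: vec_of_unit.
Qed.

Lemma alt_fv_inj l (x : TA) : uniq l -> alt fv l * x = 0 -> x = 0.
Proof.
move=> ul e0; refine (@contr_alt fvec (fun i v => vec_of v.2 i) l x ul _ _ e0).
  by move=> i c v w; rewrite (vec_ofP c v.2 w.2).
by move=> i j; exact: vec_of_unit.
Qed.

Lemma tensor_vec_neq0 ls ks : {in ls, forall l, uniq l} -> {in ks, forall k, uniq k} ->
  tensor_vec ls ks != 0.
Proof.
move=> ul uk; rewrite /tensor_vec.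
have k0 : \prod_(k <- ks) alt fv k != 0.
  elim: ks uk => [|k ks IH] uk; first by rewrite big_nil oner_neq0.
  rewrite big_cons; apply: contra_neq (IH _) => [|k' k'k]; last by apply: uk; rewrite inE k'k orbT.
  by apply: alt_fv_inj; apply: uk; rewrite mem_head.
elim: ls ul => [|l ls IH] ul; first by rewrite big_nil mul1r.
rewrite big_cons -mulrA; apply: contra_neq (IH _) => [|l' l'l]; last by apply: ul; rewrite inE l'l orbT.
by apply: alt_ev_inj; apply: ul; rewrite mem_head.
Qed.

End TensorVectors.

(** * Higman's lemma *)

Section Higman.
Variables (A : Type) (R : A -> A -> Prop).

Inductive emb : seq A -> seq A -> Prop :=
| emb_nil : emb [::] [::]
| emb_skip y s t of emb s t : emb s (y :: t)
| emb_cons x y s t of R x y & emb s t : emb (x :: s) (y :: t).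

Lemma emb0s t : emb [::] t.
Proof. by elim: t => [|y t IH]; [exact: emb_nil|exact: emb_skip]. Qed.

Definition wqo := forall f : nat -> A, exists g : nat -> nat,
  forall i j, (i < j)%N -> (g i < g j)%N /\ R (f (g i)) (f (g j)).

Let bad (f : nat -> seq A) := forall i j, (i < j)%N -> ~ emb (f i) (f j).

Let bad_prefix (p : seq (seq A)) :=
  exists2 f, bad f & forall i, (i < size p)%N -> f i = nth [::] p i.

Let minimal_next p x :=
  bad_prefix (rcons p x) /\ forall y, bad_prefix (rcons p y) -> (size x <= size y)%N.

Let minimal_ex p : exists x, bad_prefix p -> minimal_next p x.
Proof.
have [[f bf fp]|nb] := pselect (bad_prefix p); last by exists [::].
pose Q n := `[< exists2 x, bad_prefix (rcons p x) & size x = n >].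
have exQ : exists n, Q n.
  exists (size (f (size p))); apply/asboolP; exists (f (size p)) => //.
  exists f => // i; rewrite size_rcons ltnS nth_rcons => ip.
  by case: ltngtP ip => // [ip _|-> _ //]; exact: fp.
case: (ex_minnP exQ) => n /asboolP[x bx xn] minn.
exists x => _; split=> // y by_; rewrite xn; apply: minn.
by apply/asboolP; exists y.
Qed.

(* Nash-Williams: [f] is a bad sequence whose entries are chosen one after the
   other of minimal length; removing heads along a monotone subsequence of the
   heads contradicts minimality. *)
Theorem higman : wqo -> forall f : nat -> seq A,
  exists i j, (i < j)%N /\ emb (f i) (f j).
Proof.
move=> wR f0; apply: contrapT => nf.
have bf0 : bad f0 by move=> i j ij e; apply: nf; exists i, j.
have /choice[next nextP] := minimal_ex.
pose p := fix p n := if n is k.+1 then rcons (p k) (next (p k)) else [::].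
have pS n : p n.+1 = rcons (p n) (next (p n)) by [].
have size_p n : size (p n) = n by elim: n => // n IH; rewrite pS size_rcons IH.
have bp n : bad_prefix (p n).
  by elim: n => [|n IH]; [exists f0|have [] := nextP _ IH].
pose f n := next (p n).
have fE n i : (i < n)%N -> nth [::] (p n) i = f i.
  elim: n => // n IH; rewrite ltnS pS nth_rcons size_p => ip.
  by case: ltngtP ip => // [ip _|-> _ //]; [exact: IH].
have bf : bad f.
  (* Positions [i] and [j] both belong to the prefix of length [j.+1], which extends to a bad
     sequence. *)
  move=> i j ij; have [g bg gp] := bp j.+1.
  have := bg i j ij; rewrite !gp ?size_p ?fE//; exact: ltn_trans ij _.
have fmin n y : bad_prefix (rcons (p n) y) -> (size (f n) <= size y)%N.
  by have [_] := nextP _ (bp n); apply.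
have ht n : exists ht : A * seq A, f n = ht.1 :: ht.2.
  case E : (f n) => [|x s]; last by exists (x, s).
  by case: (bf n n.+1 (ltnSn n)); rewrite E; exact: emb0s.
have {ht}/choice[ht htE] := ht.
have [g gP] := wR (fun n => (ht n).1).
pose h i := if (i < g 0%N)%N then f i else (ht (g (i - g 0%N)%N)).2.
have ghom i j : (i <= j)%N -> (g i <= g j)%N.
  by rewrite leq_eqVlt => /orP[/eqP->//|/gP[/ltnW]].
have bh : bad h.
  move=> i j ij; rewrite /h; case: ltnP => i0; case: ltnP => j0.
  - exact: bf.
  - move=> e; have k0 : (i < g (j - g 0%N)%N)%N by rewrite (leq_trans i0)// ghom.
    by apply: (bf _ _ k0); rewrite (htE (g _)); exact: emb_skip.
  - lia.
  - have lt : (i - g 0 < j - g 0)%N by lia.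
    have [lg r] := gP _ _ lt.
    by move=> e; apply: (bf _ _ lg); rewrite !(htE (g _)); exact: emb_cons.
have : (size (f (g 0%N)) <= size (ht (g 0%N)).2)%N.
  apply: fmin; exists h => // i; rewrite size_rcons size_p ltnS nth_rcons size_p /h => ip.
  by case: ltngtP ip => // [ip _|-> _ //]; rewrite ?fE// subnn.
by rewrite htE /= ltnn.
Qed.

End Higman.

(** The next index is always one where [f] is minimal among all later indices. *)
Lemma nat_monotone_subseq (f : nat -> nat) : exists g : nat -> nat,
  forall i j, (i < j)%N -> (g i < g j)%N /\ (f (g i) <= f (g j))%N.
Proof.
have nx n : exists k, (n < k)%N /\ forall l, (n < l)%N -> (f k <= f l)%N.
  pose Q v := `[< exists2 k, (n < k)%N & f k = v >].
  have exQ : exists v, Q v by exists (f n.+1); apply/asboolP; exists n.+1.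
  case: (ex_minnP exQ) => v /asboolP[k nk fk] minv; exists k; split=> // l nl.
  by rewrite fk; apply: minv; apply/asboolP; exists l.
have /choice[nxt nP] := nx.
pose g := fix g n := if n is k.+1 then nxt (g k) else nxt 0%N.
exists g; have gS n : (g n < g n.+1)%N by have [] := nP (g n).
have gm i j : (i < j)%N -> (g i < g j)%N by exact: (homo_ltn ltn_trans gS).
move=> i j ij; split; first exact: gm.
case: i ij => [|i] ij /=.
  by have [_] := nP 0%N; apply; apply: leq_ltn_trans (gm _ _ ij).
by have [_] := nP (g i); apply; apply: gm; exact: ltnW.
Qed.

Lemma wqo_pair : wqo (fun a b : nat * nat => (a.1 <= b.1)%N /\ (a.2 <= b.2)%N).
Proof.
move=> f; have [g gP] := nat_monotone_subseq (fun n => (f n).1).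
have [h hP] := nat_monotone_subseq (fun n => (f (g n)).2).
exists (g \o h) => i j ij /=; have [hij f2] := hP _ _ ij.
by have [gij f1] := gP _ _ hij.
Qed.

(** The conjugate partition: the last value of [f] is the number of columns of full length, and
    subtracting it leaves a shorter sequence. *)
Lemma dec_columns n (f : nat -> nat) :
  (forall i j, (i < j)%N -> (j < n)%N -> (f j <= f i)%N) ->
  exists cs : seq nat, all (fun c => c <= n)%N cs /\
    forall a, (a < n)%N -> f a = count (fun c => a < c)%N cs.
Proof.
elim: n f => [|n IH] f fdec; first by exists [::].
have [|cs [csn fcs]] := IH (fun a => f a - f n)%N.
  by move=> i j ij jn; rewrite leq_sub2r// fdec// ltnW.
exists (nseq (f n) n.+1 ++ cs); split=> [|a].
  rewrite all_cat all_nseq leqnn orbT /=.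
  by apply/allP => c /(allP csn)/leqW.
rewrite ltnS count_cat count_nseq leq_eqVlt => /orP[/eqP->|an].
  rewrite ltnSn mul1n (eq_in_count (a2 := pred0)) ?count_pred0 ?addn0// => c /(allP csn).
  by rewrite leqNgt => /negPf.
rewrite -fcs// ltnS ltnW// mul1n subnKC//; exact: fdec.
Qed.

(** * Dominant weights as lists of column lengths *)

Section Types.
Variables (F : closedFieldType) (charF : [pchar F] =i pred0).
Local Notation sl := (slInf F).
Local Notation W := (sumMod (Vinf F) (Vinf_dual F)).
Local Notation T := (tensorMod W).
Local Notation TA := (tensorAlg W).

Lemma hwT_ext m s (lam mu : nat -> F) (X : lieModule sl) (x : X) :
  (forall i, (i < m)%N -> lam i = mu i) -> hwT m s lam x -> hwT m s mu x.
Proof. by move=> e [wx hx]; split=> // i im; rewrite wx// e. Qed.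

Lemma hwT_scale m s lam (X : lieModule sl) (x : X) c :
  hwT m s lam x -> hwT m s lam (c *: x).
Proof.
move=> [wx hx]; split=> [i im|i j ij jm]; first by rewrite actZr wx// !scalerA mulrC.
by rewrite actZr hx// scaler0.
Qed.

(* A dominant weight of sl(m) is encoded by the lengths [cs] of the columns of
   its Young diagram. *)
Definition wcol (cs : seq nat) : T := tensor_vec F [seq iota 0 c | c <- cs] [::].

Definition wwt m (cs : seq nat) (a : nat) : F := \sum_(c <- cs) colwt F m (iota 0 c) a.

Lemma wcol_neq0 cs : wcol cs != 0.
Proof.
apply: tensor_vec_neq0 => // l /mapP[c _ ->]; exact: iota_uniq.
Qed.

Lemma wcol_hw m cs : hwT m (iota 0 m) (wwt m cs) (wcol cs).
Proof.
apply: (hwT_ext _ (@tensor_vec_hw F charF m (iota 0 m) _ [::] (perm_refl _) _ _)) => //.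
  by move=> i im; rewrite nth_iota// /tvwt big_nil subr0 big_map.
move=> l /mapP[c _ ->]; split; first exact: iota_uniq.
move=> i j ij jm; rewrite !nth_iota ?(ltn_trans ij)// !mem_iota.
exact: ltn_trans.
Qed.

Lemma colwt_iota m c a : (c <= m)%N -> (a < m)%N ->
  colwt F m (iota 0 c) a = (a < c)%:R - c%:R / m%:R.
Proof.
move=> cm am; rewrite /colwt mem_iota; congr (_ - _%:R / _).
rewrite (eq_in_count (a2 := predT)) ?count_predT ?size_iota// => k.
by rewrite mem_iota => /andP[_ kc]; rewrite (leq_trans kc).
Qed.

Lemma const_sum0 m (K : F) : (0 < m)%N -> \sum_(i < m) K = 0 -> K = 0.
Proof.
move=> m0; rewrite sumr_const card_ord => /eqP; rewrite -mulr_natr mulf_eq0.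
by case/orP => /eqP// h; move: m0; rewrite (natF_inj charF (h : m%:R = 0%:R)).
Qed.

(** The differences to the last weight are decreasing natural numbers and give the columns. This
    fixes [lam] up to a constant, which is 0 because both weights have sum 0. *)
Lemma type_ex m lam (X : lieModule sl) (lfX : locfin X) (x : X) : (0 < m)%N ->
  hwT m (iota 0 m) lam x -> x != 0 -> exists cs, all (fun c => c <= m)%N cs /\
    forall a, (a < m)%N -> lam a = wwt m cs a.
Proof.
move=> m0 hx x0; have sP := perm_refl (iota 0 m).
have dm i : exists n : nat, (i < m)%N -> lam i - lam m.-1 = n%:R.
  have [im|] := ltnP i m.-1; last first.
    move=> mi; exists 0%N => im; have -> : i = m.-1 by lia.
    by rewrite subrr.
  have [|n nE] := hwT_dominant charF sP lfX hx x0 im; first by rewrite prednK.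
  by exists n.
have /choice[f fE] := dm.
have fdec i j : (i < j)%N -> (j < m)%N -> (f j <= f i)%N.
  move=> ij jm; have [n nE] := hwT_dominant charF sP lfX hx x0 ij jm.
  have : (f i)%:R = (f j + n)%:R :> F.
    by rewrite natrD -nE -!fE// ?(ltn_trans ij)// [RHS]addrC addrA subrK.
  by move/(natF_inj charF) => ->; exact: leq_addr.
have [cs [csm fcs]] := dec_columns fdec; exists cs; split=> // a am.
pose K : F := lam m.-1 + \sum_(c <- cs) c%:R / m%:R.
have wE i : (i < m)%N -> lam i = wwt m cs i + K.
  move=> im; have wwE : wwt m cs i = (f i)%:R - \sum_(c <- cs) c%:R / m%:R.
    rewrite fcs// -(sum_count F (fun c => i < c)%N) -sumrB; apply: eq_big_seq => c /(allP csm) cm.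
    by rewrite colwt_iota// ltnNge.
  have /eqP := fE i im; rewrite subr_eq => /eqP ->; rewrite wwE /K.
  by rewrite [X in _ = _ + X]addrC addrA subrK.
have s0 := wtT_sum charF sP lfX hx.1 x0.
have s1 := wtT_sum charF sP (@locfin_T F) (wcol_hw m cs).1 (wcol_neq0 cs).
rewrite wE//; suff -> : K = 0 by rewrite addr0.
apply: (const_sum0 m0).
have := s0; rewrite (eq_bigr _ (fun (i : 'I_m) _ => wE i (ltn_ord i))) big_split s1 /= add0r.
by [].
Qed.

Lemma wwt_triv m c cs a : (0 < m)%N -> (a < m)%N -> (c == 0%N) || (c == m) ->
  colwt F m (iota 0 c) a + wwt m cs a = wwt m cs a.
Proof.
move=> m0 am cm; rewrite colwt_iota//; last by case/orP: cm => /eqP->.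
have mF : (m%:R : F) != 0.
  by apply/eqP => h; move: m0; rewrite (natF_inj charF (h : m%:R = 0%:R)).
by case/orP: cm => /eqP->; rewrite ?mul0r ?subr0 ?ltn0 ?add0r// am divff// subrr add0r.
Qed.

End Types.

(** * Embeddings between simple modules *)

Section Embedding.
Variables (F : closedFieldType) (charF : [pchar F] =i pred0).
Local Notation sl := (slInf F).
Local Notation W := (sumMod (Vinf F) (Vinf_dual F)).
Local Notation T := (tensorMod W).
Local Notation TA := (tensorAlg W).

Lemma act_TM (z : sl) (a b : TA) : @act F sl T z (a * b : TA) =
  (@act F sl T z a : TA) * b + a * (@act F sl T z b : TA).
Proof. exact: act_tM. Qed.

(** Equivalently, some sl(m)-homomorphism from the module generated by [x] to that of [y] sends [x]
    to [y]. *)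
Definition inherits m (X Y : lieModule sl) (x : X) (y : Y) :=
  forall t, level m t -> term_act t x = 0 -> term_act t y = 0.

Lemma inherits_eq m (X Y : lieModule sl) (x : X) (y : Y) (z : sl) c :
  supp_below m (mx_of z) -> inherits m x y -> act z x = c *: x -> act z y = c *: y.
Proof.
move=> mz xy zx; apply/eqP; rewrite -subr_eq0 -scaleNr; apply/eqP.
have := xy (Add (Gen F z) (Cst sl (- c))); apply => //=.
by rewrite zx scaleNr subrr.
Qed.

Lemma inherits_hwT m n s lam (X Y : lieModule sl) (x : X) (y : Y) : (n <= m)%N ->
  inherits m x y -> hwT n s lam x -> hwT n s lam y.
Proof.
move=> nm xy [wx hx].
have S a b : supp_below m (mx_of (el F n a b)) := supp_below_le nm (@supp_el F charF n a b).
split=> [i im|i j ij jm]; first by apply: inherits_eq xy _ => //; exact: wx.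
have := @inherits_eq _ _ _ x y _ 0 (S _ _) xy; rewrite scale0r => ->; rewrite ?scale0r//.
exact: hx.
Qed.

Lemma inherits_wtT m n s lam (X Y : lieModule sl) (x : X) (y : Y) : (n <= m)%N ->
  inherits m x y -> wtT n s lam x -> wtT n s lam y.
Proof.
move=> nm xy wx i im; apply: inherits_eq xy (wx i im).
exact: supp_below_le nm (@supp_el F charF n _ _).
Qed.

(* [y] corresponds, in the module generated by [w], to the projection of [u] onto
   the isomorphic module generated by [z0]. *)
Lemma project_simple m s (sP : perm_eq s (iota 0 m)) (X Y : lieModule sl) (lX : locfin X)
    (lY : locfin Y) lam (u z0 : X) (w : Y) :
  hwT m s lam z0 -> z0 != 0 -> gen m u z0 -> hwT m s lam w -> w != 0 ->
  exists y, [/\ gen m w y, y != 0 & inherits m u y].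
Proof.
move=> hz z00 uz hw w0.
have [Z [z [[sZ ZE] nZ zz Zuz]]] := hwT_complement charF sP lX u hz z00.
have zn0 : z != 0.
  apply/eqP => z0E; apply: nZ; apply: (gen_min sZ ZE _ uz).
  by move: Zuz; rewrite z0E subr0.
have uz' : inherits m u z.
  move=> t mt tu; apply/eqP; apply: contraT => tz.
  have Zt : Z (term_act t z).
    have : Z (term_act t (u - z)) by apply: (gen_min sZ ZE Zuz); exists t.
    rewrite term_actB tu sub0r => h.
    by rewrite -[term_act t z]opprK -scaleN1r; exact: subspaceZ.
  case: nZ; apply: (gen_min sZ ZE Zt).
  by apply: (hwT_simple charF sP lX hz) => //; apply: gen_trans zz _; exists t.
have [b mb zb] := zz; exists (term_act b w); split.
- by exists b.
- apply/eqP => /(hwT_ann charF sP lX lY hz hw z00 w0 mb).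
  by rewrite -zb; apply/eqP.
- move=> t mt tu; apply: (hwT_ann charF sP lX lY hz hw z00 w0 (t := Mul t b) (conj mt mb)).1.
  by rewrite /= -zb; exact: uz'.
Qed.

(* The vector sought is a projection of [p * q], where [p] is the exterior
   product of the basis vectors with indices in [C]: the first [c] indices below
   [m] and [c' - c] indices above. The product of [p] and a highest weight vector
   for an order starting with [C] is a highest weight vector for that order. *)
Lemma emb_step m m' c c' k lam mu (q : T) : (0 < m)%N -> (m <= m')%N ->
  (c <= m)%N -> (c <= c')%N -> (c' <= m')%N -> (m - c <= m' - c')%N ->
  gen m' (wcol F k) q -> q != 0 -> hwT m (iota 0 m) lam q -> wtT m' (iota 0 m') mu q ->
  exists y mu', [/\ gen m' (wcol F (c' :: k)) y, y != 0,
    hwT m (iota 0 m) (fun a => colwt F m (iota 0 c) a + lam a) y & wtT m' (iota 0 m') mu' y].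
Proof.
move=> m0 mm' cm cc' cm' mc kq q0 hq wq.
have lT := @locfin_T F.
(* Over sl(m) only the first [c] indices count, over sl(m') all [c'] of them. There is room because
   [c' - c <= m' - m]. *)
pose C := iota 0 c ++ iota m (c' - c).
have uC : uniq C.
  rewrite cat_uniq !iota_uniq andbT /=; apply/hasPn => i; rewrite !mem_iota => /andP[mi _].
  by rewrite /= -leqNgt (leq_trans cm).
have Cm' : {in C, forall i, i < m'}%N.
  by move=> i; rewrite mem_cat !mem_iota => /orP[]; lia.
have sC : size C = c' by rewrite size_cat !size_iota subnKC.
pose s := C ++ [seq i <- iota 0 m' | i \notin C].
have sP : perm_eq s (iota 0 m').
  apply: uniq_perm; rewrite ?iota_uniq//.
    rewrite cat_uniq uC filter_uniq ?iota_uniq// andbT.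
    by apply/hasPn => i; rewrite mem_filter => /andP[].
  move=> i; rewrite mem_cat mem_filter mem_iota /=.
  by have [/Cm'|] := boolP (i \in C).
have ss : size s = m' by rewrite (perm_size sP) size_iota.
have s_lt i : (i < m')%N -> (nth 0%N s i < m')%N.
  move=> im; have : nth 0%N s i \in s by rewrite mem_nth ?ss.
  by rewrite (perm_mem sP) mem_iota.
have sCi i : (i < m')%N -> (nth 0%N s i \in C) = (i < c')%N.
  move=> im; rewrite /s nth_cat sC; case: ltnP => ic; first by rewrite mem_nth ?sC.
  apply/negbTE; have : nth 0%N [seq i <- iota 0 m' | i \notin C] (i - c')%N \in [seq i <- iota 0 m' | i \notin C].
    by rewrite mem_nth// -(ltn_add2l (size C)) -size_cat ss sC subnKC.
  by rewrite mem_filter => /andP[].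
pose p : TA := alt (ev F) C.
have Dp n a b : (a < n)%N -> (b < n)%N -> (b \in C -> a \in C) ->
    @act F sl T (el F n a b) p = (if a == b then colwt F n C a else 0) *: p.
  by move=> an bn ba; exact: (act_alt_ev charF).
have pq0 (x : TA) : x != 0 -> p * x != 0.
  by apply: contra_neq => h; exact: (@alt_ev_inj F C x uC h).
pose pq : T := p * (q : TA).
have iota_nth n i : (i < n)%N -> nth 0%N (iota 0 n) i = i by move=> ?; rewrite nth_iota.
have hpq : hwT m (iota 0 m) (fun a => colwt F m (iota 0 c) a + lam a) pq.
  have colE a : (a < m)%N -> colwt F m C a = colwt F m (iota 0 c) a.
    move=> am; rewrite /colwt mem_cat [a \in iota m _]mem_iota leqNgt am orbF.
    congr (_ - _%:R / _); rewrite count_cat [X in (_ + X)%N](_ : _ = 0%N) ?addn0//.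
    rewrite (eq_in_count (a2 := pred0)) ?count_pred0// => i.
    by rewrite mem_iota => /andP[mi _]; rewrite ltnNge mi.
  split=> [i im|i j ij jm].
    rewrite /pq act_TM hq.1// !iota_nth// Dp// eqxx colE// -scalerAl -scalerAr.
    by rewrite -scalerDl.
  have im := ltn_trans ij jm.
  rewrite /pq act_TM hq.2// mulr0 addr0 !iota_nth// Dp//.
    by rewrite (ltn_eqF ij) scale0r mul0r.
  by rewrite !mem_cat !mem_iota; lia.
have wpq : wtT m' (iota 0 m') (fun a => colwt F m' C a + mu a) pq.
  move=> i im; rewrite /pq act_TM wq// !iota_nth// Dp// eqxx -scalerAl -scalerAr.
  by rewrite -scalerDl.
have [x0 [kx x00 hx]] := hwT_reorder charF lT (perm_refl _) sP (wcol_hw charF m' k) (wcol_neq0 F k).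
have wq' : wtT m' s (fun i => mu (nth 0%N s i)) q.
  by move=> i im; have := wq _ (s_lt i im); rewrite iota_nth// s_lt.
(* Raising operators for the order [s] kill [p], so raising [q] amounts to raising [p * q], and the
   product stays in the module generated by [pq]. *)
have [||y1 [nu [hy1 y10 [ky1 pqy1]]]] := @hwT_raise F charF m' s sP T lT
  (fun y => gen m' (wcol F k) y /\ gen m' pq (p * (y : TA) : T)) _ q wq' q0.
- by split=> //; exact: gen_refl.
- move=> i j y ij jm [ky pqy]; have im := ltn_trans ij jm.
  have mz := @supp_el F charF m' (nth 0%N s i) (nth 0%N s j).
  split; first exact: gen_act.
  have := gen_act mz pqy; rewrite act_TM Dp ?s_lt// ?sCi//; last exact: ltn_trans.
  by rewrite nth_uniq ?ss// ?(perm_uniq sP) ?iota_uniq// (ltn_eqF ij) scale0r mul0r add0r.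
have x0y1 : gen m' x0 y1.
  by apply: gen_trans ky1; exact: (hwT_simple charF (perm_refl _) lT (wcol_hw charF m' k)).
(* The simple module of [wcol F k] has one highest weight line for the order [s]; this identifies
   the weight of [y1]. *)
have [d y1E] := hwT_unique charF sP lT hx hy1 x0y1 y10.
have {}hy1 : hwT m' s (wwt F m' k) y1 by rewrite y1E; exact: hwT_scale.
have hpy : hwT m' s (wwt F m' (c' :: k)) (p * (y1 : TA) : T).
  have colE i : (i < m')%N -> colwt F m' C (nth 0%N s i) = colwt F m' (iota 0 c') i.
    move=> im; rewrite colwt_iota// /colwt sCi//; congr (_ - _%:R / _).
    by rewrite (eq_in_count (a2 := predT)) ?count_predT ?sC// => a /Cm' ->.
  split=> [i im|i j ij jm].
    rewrite act_TM hy1.1// Dp ?s_lt// eqxx colE// -scalerAl -scalerAr -scalerDl.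
    by rewrite /wwt big_cons.
  have im := ltn_trans ij jm.
  rewrite act_TM hy1.2// mulr0 addr0 Dp ?s_lt// ?sCi//; last exact: ltn_trans.
  by rewrite nth_uniq ?ss// ?(perm_uniq sP) ?iota_uniq// (ltn_eqF ij) scale0r mul0r.
have [z0 [pz z00 hz]] := hwT_reorder charF lT sP (perm_refl (iota 0 m')) hpy (pq0 _ y10).
have [y [wy y0 iy]] := project_simple (perm_refl _) lT lT hz z00 (gen_trans pqy1 pz)
  (wcol_hw charF m' (c' :: k)) (wcol_neq0 F _).
exists y, (fun a => colwt F m' C a + mu a); split=> //.
  exact: inherits_hwT mm' iy hpq.
exact: inherits_wtT (leqnn _) iy wpq.
Qed.

(** Splitting F^m' as F^m + F^(m'-m), the c'-th exterior power of F^m' has the c-th one of F^m as a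
    summand when 0 <= c' - c <= m' - m; this is the componentwise comparison of the two pairs. *)
Definition collab m c := (c, m - c)%N.
Definition lab_le (a b : nat * nat) := (a.1 <= b.1)%N /\ (a.2 <= b.2)%N.

(* A column that is skipped by the embedding is treated as an extension of a
   column of length 0 or m, whose weight is trivial. *)
Lemma emb_type m m' cs cs' : (0 < m)%N -> (m.*2 <= m')%N ->
  all (fun c => c <= m)%N cs -> all (fun c => c <= m')%N cs' ->
  emb lab_le (map (collab m) cs) (map (collab m') cs') ->
  exists y mu, [/\ gen m' (wcol F cs') y, y != 0, hwT m (iota 0 m) (wwt F m cs) y
    & wtT m' (iota 0 m') mu y].
Proof.
move=> m0 mm' csm csm' e.
have lm : (m <= m')%N by lia.
elim: cs' cs csm csm' e => [|c' k IH] cs csm csm' e.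
  case: cs csm e => [|c cs] csm e; last by inversion e.
  exists (wcol F [::]), (wwt F m' [::]); split; [exact: gen_refl|exact: wcol_neq0|exact: wcol_hw|].
  by case: (wcol_hw charF m' [::]).
move: csm' => /= /andP[cm' km'].
have skip : emb lab_le (map (collab m) cs) (map (collab m') k) ->
  exists y mu, [/\ gen m' (wcol F (c' :: k)) y, y != 0, hwT m (iota 0 m) (wwt F m cs) y
    & wtT m' (iota 0 m') mu y].
  move=> e'; have [q [mu [kq q0 hq wq]]] := IH cs csm km' e'.
  (* Length 0 fits when [c' <= m' - m]. Otherwise [c' > m' - m >= m], by the assumption that [m'] is
     at least [2 m], and length [m] fits. *)
  have [c [ct cm cc' mc]] : exists c, [/\ (c == 0%N) || (c == m), (c <= m)%N, (c <= c')%N & (m - c <= m' - c')%N].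
    by have [h|h] := leqP c' (m' - m); [exists 0%N|exists m]; split=> //; lia.
  have [y [mu' [wy y0 hy wy']]] := emb_step m0 lm cm cc' cm' mc kq q0 hq wq.
  exists y, mu'; split=> //; apply: hwT_ext hy => a am; exact: wwt_triv.
case: cs csm e skip => [|c cs] csm e skip.
  by apply: skip; exact: emb0s.
move: csm => /= /andP[cm csm]; inversion e as [|? ? ? e'|? ? ? ? r e']; subst.
  by apply: skip.
have [q [mu [kq q0 hq wq]]] := IH cs csm km' e'.
have [y [mu' [wy y0 hy wy']]] := emb_step m0 lm cm r.1 cm' r.2 kq q0 hq wq.
by exists y, mu'; split=> //; apply: hwT_ext hy => a am; rewrite /wwt big_cons.
Qed.

End Embedding.

(** * Quotients and cyclic modules *)

Section Quotient.
Variables (F : fieldType) (g : lieAlgebra F) (X : lieModule g) (S : submodule X).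
Local Notation Sp := (submod_pred S).

Let Sp0 : 0 \in Sp. Proof. by case: (submod_closedP S). Qed.
Let SpL c x y : x \in Sp -> y \in Sp -> c *: x + y \in Sp.
Proof. by case: (submod_closedP S) => _; apply. Qed.
Let SpD x y : x \in Sp -> y \in Sp -> x + y \in Sp.
Proof. by move=> xS yS; rewrite -[x]scale1r; exact: SpL. Qed.
Let SpZ c x : x \in Sp -> c *: x \in Sp.
Proof. by move=> xS; rewrite -[_ *: _]addr0; exact: SpL. Qed.

Definition qrel (x y : X) := x - y \in Sp.

Lemma qrel_refl : reflexive qrel. Proof. by move=> x; rewrite /qrel subrr. Qed.
Lemma qrel_sym : symmetric qrel.
Proof. by move=> x y; apply/idP/idP => h; rewrite /qrel -opprB -scaleN1r; exact: SpZ. Qed.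
Lemma qrel_trans : transitive qrel.
Proof. by move=> y x z xy yz; rewrite /qrel -(subrK y x) -addrA; exact: SpD. Qed.

Canonical qrel_equiv := EquivRel qrel qrel_refl qrel_sym qrel_trans.

Definition quot := {eq_quot qrel_equiv}%qT.
HB.instance Definition _ := Choice.on quot.

Definition qpi (x : X) : quot := (\pi_quot x)%qT.

Lemma qpiP x y : qpi x = qpi y <-> x - y \in Sp.
Proof. by split=> [/eqmodP//|h]; apply/eqmodP. Qed.

Lemma reprE (a : quot) : qpi (repr a) = a. Proof. exact: reprK. Qed.

Let repr_qpi x : repr (qpi x) - x \in Sp. Proof. by apply/qpiP; rewrite reprE. Qed.

Definition qadd (a b : quot) := qpi (repr a + repr b).
Definition qopp (a : quot) := qpi (- repr a).
Definition qscale (c : F) (a : quot) := qpi (c *: repr a).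
Definition qact (x : g) (a : quot) := qpi (act x (repr a)).

Let qaddE x y : qadd (qpi x) (qpi y) = qpi (x + y).
Proof. by apply/qpiP; rewrite opprD addrACA; apply: SpD. Qed.

Let qoppE x : qopp (qpi x) = qpi (- x).
Proof. by apply/qpiP; rewrite -opprD -[X in X \in _]scaleN1r; apply: SpZ. Qed.

Let qscaleE c x : qscale c (qpi x) = qpi (c *: x).
Proof. by apply/qpiP; rewrite -scalerBr; apply: SpZ. Qed.

Let qactE z x : qact z (qpi x) = qpi (act z x).
Proof.
apply/qpiP; rewrite -scaleN1r addrC -actDr addrC scaleN1r; apply: submod_act.
exact: repr_qpi.
Qed.

Let qind (Q : quot -> Prop) : (forall x, Q (qpi x)) -> forall a, Q a.
Proof. by move=> h a; rewrite -[a]reprE. Qed.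

Let qaddA : associative qadd.
Proof. by elim/qind=> x; elim/qind=> y; elim/qind=> z; rewrite !qaddE addrA. Qed.
Let qaddC : commutative qadd.
Proof. by elim/qind=> x; elim/qind=> y; rewrite !qaddE addrC. Qed.
Let qadd0 : left_id (qpi 0) qadd.
Proof. by elim/qind=> x; rewrite !qaddE add0r. Qed.
Let qaddN : left_inverse (qpi 0) qopp qadd.
Proof. by elim/qind=> x; rewrite qoppE qaddE addNr. Qed.

HB.instance Definition _ := GRing.isZmodule.Build quot qaddA qaddC qadd0 qaddN.

Let qscaleA a b v : qscale a (qscale b v) = qscale (a * b) v.
Proof. by elim/qind: v => x; rewrite !qscaleE scalerA. Qed.
Let qscale1 : left_id 1 qscale.
Proof. by elim/qind=> x; rewrite qscaleE scale1r. Qed.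
Let qscaleDr : right_distributive qscale +%R.
Proof.
by move=> c; elim/qind=> x; elim/qind=> y; rewrite /+%R /= qaddE !qscaleE qaddE scalerDr.
Qed.
Let qscaleDl v : {morph qscale^~ v : a b / a + b}.
Proof. by elim/qind: v => x a b; rewrite !qscaleE [RHS]qaddE scalerDl. Qed.

HB.instance Definition _ := GRing.Zmodule_isLmodule.Build F quot
  qscaleA qscale1 qscaleDr qscaleDl.

Lemma qpi_lin c x y : qpi (c *: x + y) = c *: qpi x + qpi y.
Proof. by rewrite /+%R /= /GRing.scale /= qscaleE qaddE. Qed.

Let qactDl c x y v : qact (c *: x + y) v = c *: qact x v + qact y v.
Proof. by elim/qind: v => v; rewrite !qactE -qpi_lin actDl. Qed.
Let qactDr c x v w : qact x (c *: v + w) = c *: qact x v + qact x w.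
Proof. by elim/qind: v => v; elim/qind: w => w; rewrite -qpi_lin !qactE -qpi_lin actDr. Qed.
Let qact_bracket x y v : qact (bracket x y) v = qact x (qact y v) - qact y (qact x v).
Proof.
elim/qind: v => v; rewrite !qactE act_bracket addrC -scaleN1r [RHS]addrC -scaleN1r.
exact: qpi_lin.
Qed.

Definition quotMod : lieModule g := @LieModule F g quot qact qactDl qactDr qact_bracket.

Lemma qpi_act z x : @act F g quotMod z (qpi x) = qpi (act z x).
Proof. exact: qactE. Qed.

Lemma qpi0 x : qpi x = 0 <-> x \in Sp.
Proof. by rewrite [0]/(qpi 0) qpiP subr0. Qed.

Lemma qpi_term t x : @term_act F g quotMod t (qpi x) = qpi (term_act t x).
Proof.
elim: t x => [z|c|t1 IH1 t2 IH2|t1 IH1 t2 IH2] x /=.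
- exact: qpi_act.
- by rewrite (linZ qpi_lin).
- by rewrite IH1 IH2; rewrite (linD qpi_lin).
- by rewrite IH2 IH1.
Qed.

End Quotient.

Section Regular.
Variables (F : fieldType) (g : lieAlgebra F).
Local Notation P := (Presentation (@env_augment F g)).

Let G (x : g) : envAlg g := cls P (Gen F x).

Definition reg_act (x : g) (a : envAlg g) : envAlg g := G x * a.

Let reg_actDl c x y a : reg_act (c *: x + y) a = c *: reg_act x a + reg_act y a.
Proof. by rewrite /reg_act /G env_gen_lin mulrDl scalerAl. Qed.

Let reg_actDr c x a b : reg_act x (c *: a + b) = c *: reg_act x a + reg_act x b.
Proof. by rewrite /reg_act mulrDr scalerAr. Qed.

Let reg_act_bracket x y a :
  reg_act (bracket x y) a = reg_act x (reg_act y a) - reg_act y (reg_act x a).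
Proof.
rewrite /reg_act !mulrA -mulrBl; congr (_ * _).
rewrite /G -!clsM -[X in _ = _ + X]scaleN1r -clsZ -clsD.
by apply/cls_eqP/cong_rel; exact: env_bracket.
Qed.

Definition regMod : lieModule g :=
  @LieModule F g (envAlg g) reg_act reg_actDl reg_actDr reg_act_bracket.

Lemma term_act_reg t : @term_act F g regMod t (1 : envAlg g) = cls P t.
Proof.
have H (a : envAlg g) : @term_act F g regMod t a = cls P t * a.
  elim: t a => [z|c|t1 IH1 t2 IH2|t1 IH1 t2 IH2] a //=.
  - by rewrite clsC mulr_algl.
  - by rewrite IH1 IH2 clsD mulrDl.
  - by rewrite IH2 IH1 clsM mulrA.
by rewrite H mulr1.
Qed.

End Regular.

Section Cyclic.
Variables (F : fieldType) (g : lieAlgebra F).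
Implicit Types (X Y : lieModule g).

Definition cyclic_on X (u : X) := forall x, exists t, x = term_act t u.

Lemma kills_cyclic X (u : X) t : cyclic_on u ->
  (forall v : X, term_act t v = 0) <-> forall r, term_act (Mul t r) u = 0.
Proof.
move=> cu; split=> [h r|h v]; first exact: h.
by have [r ->] := cu v; exact: h.
Qed.

Lemma cyclic_simple X (u : X) : cyclic_on u -> u != 0 ->
  (forall t, term_act t u != 0 -> exists r, term_act r (term_act t u) = u) -> mod_simple X.
Proof.
move=> cu u0 ru; split=> [|S]; first by exists u.
have [S0 SL] := submod_closedP S.
have [[v vS v0]|nS] := pselect (exists2 v, v \in submod_pred S & v != 0); last first.
  by left=> v vS; apply/eqP; apply: contraT => v0; case: nS; exists v.
right=> w; have St t x : x \in submod_pred S -> term_act t x \in submod_pred S.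
  elim: t x => [z|c|t1 IH1 t2 IH2|t1 IH1 t2 IH2] x xS /=.
  - exact: submod_act.
  - by rewrite -[_ *: _]addr0; exact: SL.
  - by rewrite -[term_act t1 x]scale1r; apply: SL; [exact: IH1|exact: IH2].
  - by apply: IH1; exact: IH2.
have [t vt] := cu v; have [|r rv] := ru t; first by rewrite -vt.
have [s ->] := cu w; apply: (St); rewrite -rv -vt; exact: St.
Qed.

Lemma ann_eq X Y : (forall t, (forall v : X, term_act t v = 0) <-> (forall v : Y, term_act t v = 0)) ->
  ann X = ann Y.
Proof.
by move=> h; apply/seteqP; split=> u; [exact: (h (repr u)).1|exact: (h (repr u)).2].
Qed.

Lemma ann_term X t : (forall v : X, term_act t v = 0) <-> ann X (cls _ t).
Proof. by split=> h v; have := h v; rewrite env_act_cls. Qed.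

Lemma mod_iso_sym X Y : mod_iso X Y -> mod_iso Y X.
Proof.
move=> [f [[h hf fh] fact]].
have h_lin : linear h.
  by move=> c x y; apply: (can_inj hf); rewrite linearP !fh.
pose h' : {linear Y -> X} := HB.pack h (GRing.isLinear.Build F Y X *:%R h h_lin).
exists h'; split; first by exists f.
by move=> z x; apply: (can_inj hf); rewrite /= fact !fh.
Qed.

Lemma mod_iso_trans X Y Z : mod_iso X Y -> mod_iso Y Z -> mod_iso X Z.
Proof.
move=> [f [bf fact]] [h [bh hact]].
exists (h \o f); split; first exact: bij_comp.
by move=> z x; rewrite /= fact hact.
Qed.

Lemma mod_iso_refl X : mod_iso X X.
Proof. by exists idfun; split=> //; exists id. Qed.

End Cyclic.

Section Generated.
Variables (F : fieldType) (g : lieAlgebra F) (X : lieModule g) (x : X).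

Definition genU : {pred X} := [pred w | `[< exists t, w = term_act t x >]].

Lemma genUP (w : X) : reflect (exists t, w = term_act t x) (w \in genU).
Proof. exact: asboolP. Qed.

Lemma genU_closed : submod_closed genU.
Proof.
split; first by apply/genUP; exists (Cst _ 0); rewrite /= scale0r.
move=> c a b /genUP[r ->] /genUP[r' ->]; apply/genUP.
by exists (Add (Mul (Cst _ c) r) r').
Qed.

Lemma genU_act (z : g) w : w \in genU -> act z w \in genU.
Proof. by move=> /genUP[r ->]; apply/genUP; exists (Mul (Gen F z) r). Qed.

Definition genS := Submodule genU_closed genU_act.

Lemma simple_cyclic : mod_simple X -> x != 0 -> cyclic_on x.
Proof.
move=> [_ /(_ genS)[A0|A1]] x0 w; last exact/genUP/A1.
by case/eqP: x0; apply: A0; apply/genUP; exists (Cst _ 1); rewrite /= scale1r.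
Qed.

Lemma genU_mem : x \in submod_pred genS.
Proof. by apply/genUP; exists (Cst _ 1); rewrite /= scale1r. Qed.

Definition gen_vec : subMod genS := exist _ x genU_mem.

Lemma sub_term_act t (v : subMod genS) : val (term_act t v) = term_act t (val v).
Proof.
elim: t v => [z|c|t1 IH1 t2 IH2|t1 IH1 t2 IH2] v /=.
- exact: erefl.
- have := linearP (val : submod_sort genS -> X) c v 0.
  by rewrite addr0 (raddf0 (val : submod_sort genS -> X)) addr0 => h; exact: h.
- by rewrite -IH1 -IH2; exact: (raddfD (val : submod_sort genS -> X)).
- by rewrite IH1 IH2.
Qed.

Lemma gen_vec_kill t : term_act t gen_vec = 0 <-> term_act t x = 0.
Proof.
have v0 : val (0 : subMod genS) = 0 := raddf0 (val : submod_sort genS -> X).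
have E : val (term_act t gen_vec) = term_act t x := sub_term_act t gen_vec.
by rewrite -E; split=> [->|h] //; apply: val_inj; rewrite h v0.
Qed.

Lemma gen_vec_cyclic : cyclic_on gen_vec.
Proof.
by move=> v; have [t vt] := genUP _ (valP v); exists t; apply: val_inj; rewrite sub_term_act.
Qed.

End Generated.

(** A cyclic module is U modulo the annihilator of its generator, so both modules are the same
    quotient; simplicity and annihilator are transferred through terms, without a map. *)
Lemma same_ann_simple (F : fieldType) (g : lieAlgebra F) (X Y : lieModule g) (x : X) (y : Y) :
  mod_simple X -> x != 0 -> cyclic_on y -> (forall t, term_act t x = 0 <-> term_act t y = 0) ->
  mod_simple Y /\ ann Y = ann X.
Proof.
move=> sX x0 cy xy; have cx := simple_cyclic sX x0.
split; last first.
  by apply: ann_eq => t; rewrite (kills_cyclic t cx) (kills_cyclic t cy); split=> h r; apply/xy.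
apply: (cyclic_simple cy) => [|t ty].
  by apply: contra_neq x0 => h; have := (xy (Cst g 1)).2; rewrite /= !scale1r; exact.
have tx : term_act t x != 0 by apply: contra_neq ty => /xy.
(* That [r] leads back from [t x] to [x] means that the single term [r t - 1] kills [x], hence also
   [y]. *)
have [r rx] := simple_cyclic sX tx x; exists r; apply/eqP; rewrite -subr_eq0 -scaleN1r; apply/eqP.
apply: (xy (Add (Mul r t) (Cst g (-1)))).1.
by rewrite /= -rx scaleN1r subrr.
Qed.

(** * A chain of types *)

Section Chain.
Variables (F : closedFieldType) (charF : [pchar F] =i pred0).
Local Notation sl := (slInf F).
Local Notation W := (sumMod (Vinf F) (Vinf_dual F)).
Local Notation T := (tensorMod W).
Local Notation tp := (nat * seq nat)%type.
Implicit Types (t r : term F sl) (x y z : tp) (S : tp -> Prop).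

Definition kills t (X : lieModule sl) := forall v : X, term_act t v = 0.

Definition valid z := (0 < z.1)%N /\ all (fun c => c <= z.1)%N z.2.

Definition tle x y :=
  (x.1.*2 <= y.1)%N /\ emb lab_le (map (collab x.1) x.2) (map (collab y.1) y.2).

Definition kill_type t z := forall u : T, gen z.1 (wcol F z.2) u -> term_act t u = 0.

(** The bound [m0] may be taken as large as desired, so only the types of large level in [S]
    matter. *)
Definition annS S t :=
  exists2 m0, level m0 t & forall z, S z -> (m0 <= z.1)%N -> kill_type t z.

(** Restricted to the smaller sl(m), the module of type [y] contains a copy of the module of type
    [x]. *)
Lemma tle_kill x y t : valid x -> valid y -> tle x y -> level x.1 t ->
  kill_type t y -> kill_type t x.
Proof.
move=> [x0 xv] [_ yv] [xy e] tx ky u [b bx ->].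
have [w [mu [yw w0 hw _]]] := emb_type charF x0 xy xv yv e.
have xy' : (x.1 <= y.1)%N by lia.
apply: (hwT_ann charF (perm_refl _) (@locfin_T F) (@locfin_T F) (wcol_hw charF x.1 x.2) hw
  (wcol_neq0 F _) w0 (t := Mul t b) (conj tx bx)).2.
apply: ky; apply: gen_trans yw _; exists b => //; exact: level_le bx.
Qed.

Variables (M N : lieModule sl).
Hypotheses (simpleM : mod_simple M) (lN : locfin N).
Hypothesis MN : forall t, kills t M <-> kills t N.

Lemma simple_prime t t' : (forall r, kills (Mul t (Mul r t')) M) -> ~ kills t' M -> kills t M.
Proof.
move=> tt' nt'; have [v tv] : exists v : M, term_act t' v <> 0 by apply/existsNP.
have cv := simple_cyclic simpleM (introN eqP tv).
by move=> w; have [r ->] := cv w; exact: (tt' r v).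
Qed.

Definition occurs z := valid z /\
  exists2 x : N, x != 0 & hwT z.1 (iota 0 z.1) (wwt F z.1 z.2) x.

Lemma annS_occurs t : annS occurs t <-> kills t N.
Proof.
split=> [[m0 tm tk]|tN]; last first.
  have [m0 tm] := level_ex t; exists m0 => // z [_ [x x0 hx]] m0z u [b bz ->].
  apply: (hwT_ann charF (perm_refl _) (@locfin_T F) lN (wcol_hw charF z.1 z.2) hx
    (wcol_neq0 F _) x0 (t := Mul t b) (conj (level_le m0z tm) bz)).2.
  exact: tN.
have tm' := level_le (leq_maxl m0 1) tm.
apply: (hwT_kill charF (perm_refl (iota 0 (maxn m0 1))) lN tm') => lam w hw w0 u [b bm ->].
have [|cs [csm lamE]] := type_ex charF lN _ hw w0; first by lia.
have hw' : hwT (maxn m0 1) (iota 0 (maxn m0 1)) (wwt F (maxn m0 1) cs) w.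
  exact: hwT_ext lamE hw.
apply: (hwT_ann charF (perm_refl _) (@locfin_T F) lN (wcol_hw charF _ cs) hw'
    (wcol_neq0 F _) w0 (t := Mul t b) (conj tm' bm)).1.
apply: (tk (maxn m0 1, cs)) => /=; last by exists b.
  by split; [split=> //=; lia|exists w].
exact: leq_maxl.
Qed.

Lemma annS_sub S S' t : (forall z, S z -> S' z) -> annS S' t -> annS S t.
Proof. by move=> SS [m0 tm tk]; exists m0 => // z /SS; exact: tk. Qed.

Definition good S := (forall z, S z -> occurs z) /\ forall t, annS S t -> kills t M.

Lemma good_ann S t : good S -> annS S t <-> kills t M.
Proof.
move=> [So SM]; split; first exact: SM.
by move=> /MN/annS_occurs; exact: annS_sub.
Qed.

(** Otherwise some [t] vanishes on [S1], some [t'] on [S2], and neither kills [M]. Every [t r t']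
    then vanishes on all of [S] at large levels, hence on [M], and the annihilator of [M] would not
    be prime. *)
Lemma good_split S S1 S2 : good S -> (forall z, S1 z -> S z) -> (forall z, S2 z -> S z) ->
  (forall z, S z -> S1 z \/ S2 z) -> good S1 \/ good S2.
Proof.
move=> [So SM] s1 s2 s12; apply/or_asboolP; rewrite -[X in is_true X]negbK negb_or.
apply/negP => /andP[/asboolPn n1 /asboolPn n2].
have H S' : (forall z, S' z -> S z) -> ~ good S' -> exists2 t, annS S' t & ~ kills t M.
  move=> s' ng; apply: contrapT => h; apply: ng; split; first by move=> z /s' /So.
  by move=> t ts; apply: contrapT => tM; apply: h; exists t.
have [t [m tm tk] tM] := H _ s1 n1; have [t' [m' tm' tk'] tM'] := H _ s2 n2.
apply: tM; apply: simple_prime tM' => r; apply: SM.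
have [n rn] := level_ex r; exists (maxn m (maxn n m')).
  by split; [|split]; [apply: level_le tm|apply: level_le rn|apply: level_le tm']; lia.
move=> z /s12[] Sz zm u zu /=.
  apply: (tk z) => //; first by lia.
  apply: gen_trans zu _; exists (Mul r t') => //; split; [apply: level_le rn|apply: level_le tm']; lia.
by rewrite (tk' z) ?term_act0//; lia.
Qed.

Definition directed S := exists L, forall x y, S x -> S y -> (L <= x.1)%N -> (L <= y.1)%N ->
  exists z, [/\ S z, tle x z & tle y z].

(* Otherwise [good_split] yields, again and again, a type [x] such that the types
   not above [x] still determine the annihilator; the sequence of these [x]
   contradicts Higman's lemma. *)
Lemma good_directed : exists2 S, good S & directed S.
Proof.
apply: contrapT => nS.
have step S L : exists x, good S -> [/\ S x, (L <= x.1)%N & good (fun z => S z /\ ~ tle x z)].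
  have [gS|nG] := pselect (good S); last by exists (0, [::]).
  have /existsNP[x] : ~ (forall x y, S x -> S y -> (L <= x.1)%N -> (L <= y.1)%N ->
    exists z, [/\ S z, tle x z & tle y z]).
    by move=> h; apply: nS; exists S => //; exists L.
  move=> /existsNP[y /not_implyP[Sx /not_implyP[Sy /not_implyP[Lx /not_implyP[Ly nz]]]]].
  have [z []|z []|z Sz|g1|g2] // := @good_split S (fun z => S z /\ ~ tle x z) (fun z => S z /\ ~ tle y z) gS.
  - have [xz|] := pselect (tle x z); last by left.
    by right; split=> // yz; apply: nz; exists z.
  - by exists x.
  - by exists y.
have /choice[nx nxP] : forall SL : (tp -> Prop) * nat, exists x, good SL.1 ->
    [/\ SL.1 x, (SL.2 <= x.1)%N & good (fun z => SL.1 z /\ ~ tle x z)].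
  by move=> [S L]; exact: step.
(* A state holds the remaining types and a lower bound for the level of the next one. As the bound
   doubles, [tle (x i) (x j)] for [i < j] can fail only through [emb]. *)
pose st := fix st n : (tp -> Prop) * nat := if n is k.+1 then
   ((fun z => (st k).1 z /\ ~ tle (nx (st k)) z), (nx (st k)).1.*2) else (occurs, 1%N).
have stS n : st n.+1 = ((fun z => (st n).1 z /\ ~ tle (nx (st n)) z), (nx (st n)).1.*2) by [].
have gst n : good (st n).1.
  elim: n => [|n IH]; last by have [] := nxP _ IH.
  by split=> // t /annS_occurs/MN.
pose x n := nx (st n).
have xS n : (st n).1 (x n) by have [] := nxP _ (gst n).
have xL n : ((st n).2 <= (x n).1)%N by have [] := nxP _ (gst n).
have sub i j z : (i <= j)%N -> (st j).1 z -> (st i).1 z.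
  elim: j => [|j IH]; first by rewrite leqn0 => /eqP->.
  rewrite leq_eqVlt => /orP[/eqP->//|ij]; rewrite stS => -[Sz _]; exact: IH.
have dbl i j : (i < j)%N -> ((x i).1.*2 <= (x j).1)%N.
  elim: j => // j IH; rewrite ltnS leq_eqVlt => /orP[/eqP->|/IH h].
    by have := xL j.+1; rewrite stS.
  by have := xL j.+1; rewrite stS /= -/(x j) => h'; lia.
have [i [j [ij e]]] := higman wqo_pair (fun n => map (collab (x n).1) (x n).2).
have := sub i.+1 j (x j) ij (xS j); rewrite stS => -[_]; apply.
by split; [exact: dbl|exact: e].
Qed.

Lemma chain_exists : exists z : nat -> tp, [/\ forall k, valid (z k),
  forall k, tle (z k) (z k.+1) &
  forall t, kills t M <-> exists2 m0, level m0 t & forall k, (m0 <= (z k).1)%N -> kill_type t (z k)].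
Proof.
have [S gS [L dL]] := good_directed.
pose SL x := S x /\ (L <= x.1)%N.
have vS x : S x -> valid x by case: gS => So _ /So[].
have [x0 Sx0] : exists x, SL x.
  apply: contrapT => nx; have [[v /eqP v0] _] := simpleM.
  have : kills (Cst _ 1) M.
    by apply/(good_ann _ gS); exists L => // z Sz Lz; case: nx; exists z.
  by move/(_ v); rewrite /= scale1r.
have ub x y : SL x -> SL y -> exists z, [/\ SL z, tle x z & tle y z].
  move=> [Sx Lx] [Sy Ly]; have [z [Sz xz yz]] := dL x y Sx Sy Lx Ly; exists z; split=> //.
  by split=> //; apply: leq_trans Lx _; case: xz => h _; lia.
have /choice[nx nxP] : forall xy : tp * tp, exists z, SL xy.1 -> [/\ SL z, tle xy.1 z & SL xy.2 -> tle xy.2 z].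
  move=> [x y] /=; have [Sx|] := pselect (SL x); last by exists x.
  have [Sy|nSy] := pselect (SL y); first by have [z [? ? ?]] := ub _ _ Sx Sy; exists z.
  by have [z [? ? ?]] := ub _ _ Sx Sx; exists z.
(* Types are countable: step [k] passes above the type with code [k], so the chain is cofinal in the
   directed set, and vanishing along it implies vanishing on every type below. *)
pose z := fix z n := if n is k.+1 then nx (z k, odflt x0 (unpickle k)) else x0.
have zS n : z n.+1 = nx (z n, odflt x0 (unpickle n)) by [].
have Sz n : SL (z n).
  by elim: n => // n IH; rewrite zS; have [] := nxP (z n, odflt x0 (unpickle n)) IH.
exists z; split=> [k|k|t]; first by apply: vS; case: (Sz k).
  by rewrite zS; have [] := nxP (z k, odflt x0 (unpickle k)) (Sz k).
rewrite -(good_ann t gS); split=> -[m0 tm tk].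
  by exists m0 => // k mk; apply: tk => //; case: (Sz k).
exists (maxn m0 L); first by apply: level_le tm; exact: leq_maxl.
move=> y Sy my; have Ly : SL y by split=> //; lia.
have yz : tle y (z (pickle y).+1).
  rewrite zS; have [_ _] := nxP (z (pickle y), odflt x0 (unpickle (pickle y))) (Sz _).
  by rewrite pickleK /=; apply.
have m0y : (m0 <= y.1)%N by lia.
apply: (tle_kill (vS _ Sy) _ yz (level_le m0y tm)); first by apply: vS; case: (Sz (pickle y).+1).
by apply: tk; case: yz => h _; lia.
Qed.

End Chain.

(** * Limits *)

Section Limit.
Variables (F : closedFieldType) (charF : [pchar F] =i pred0).
Local Notation sl := (slInf F).
Implicit Types (X Y L : lieModule sl) (t r : term F sl).

Definition unbounded (lev : nat -> nat) := forall n, exists k, (n <= lev k)%N.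

Definition same_kill m X Y (x : X) (y : Y) :=
  forall t, level m t -> term_act t x = 0 <-> term_act t y = 0.

Lemma env_act_mul X (a b : envAlg sl) (v : X) : env_act (a * b) v = env_act a (env_act b v).
Proof. by rewrite -[a]reprP -[b]reprP -clsM !env_act_cls. Qed.

(* The quotient of the enveloping algebra by the elements that kill [v k] for all
   large [k]. *)
Lemma lim_module X (v : nat -> X) (lev : nat -> nat) :
  (forall k, (lev k <= lev k.+1)%N) -> unbounded lev ->
  (forall k, same_kill (lev k) (v k) (v k.+1)) ->
  exists L (u : L), cyclic_on u /\ forall k, same_kill (lev k) u (v k).
Proof.
move=> levS unb same.
pose A : {pred regMod sl} := [pred a : envAlg sl |
  `[< exists k0, forall k, (k0 <= k)%N -> env_act a (v k) = 0 >]].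
have AP (a : envAlg sl) : reflect (exists k0, forall k, (k0 <= k)%N -> env_act a (v k) = 0) (a \in A).
  exact: asboolP.
have A_closed : submod_closed A.
  split=> [|c a b /AP[k ka] /AP[l lb]].
    apply/AP; exists 0%N => k _.
    exact: (lin0 (f := fun u => env_act u (v k)) (fun c u w => env_act_lin c u w (v k))).
  apply/AP; exists (maxn k l) => n; rewrite geq_max => /andP[kn ln].
  by rewrite env_act_lin ka// lb// scaler0 addr0.
have A_act (z : sl) (a : regMod sl) : a \in A -> act z a \in A.
  move=> /AP[k ka]; apply/AP; exists k => n kn.
  rewrite /= /reg_act env_act_mul ka// /env_act.
  exact: term_act0.
pose S := Submodule A_closed A_act.
exists (quotMod S), (@qpi F sl (regMod sl) S 1).
split=> [x|k t kt].
  exists (repr (repr x)); rewrite (@qpi_term F sl (regMod sl) S) term_act_reg reprP.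
  by rewrite (@reprE F sl (regMod sl) S).
rewrite (@qpi_term F sl (regMod sl) S) term_act_reg (@qpi0 F sl (regMod sl) S).
have chain n : term_act t (v k) = 0 <-> term_act t (v (k + n)%N) = 0.
  elim: n => [|n IH]; first by rewrite addn0.
  rewrite IH addnS; apply: same; apply: level_le kt.
  by elim: n {IH} => [|n IH]; rewrite ?addn0// addnS (leq_trans IH).
split=> [/AP[k0 h]|tv].
  apply/(chain k0); rewrite -env_act_cls; apply: h; exact: leq_addl.
apply/AP; exists k => n kn; rewrite env_act_cls.
by rewrite -(subnKC kn); apply/chain.
Qed.

Lemma term_act_big (I : Type) (s : seq I) X (f : I -> term F sl) (x : X) :
  term_act (\big[@Add F sl/Cst sl 0]_(i <- s) f i) x = \sum_(i <- s) term_act (f i) x.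
Proof.
by elim: s => [|i s IH]; rewrite ?big_nil /= ?scale0r// !big_cons /= IH.
Qed.

Lemma level_big (I : Type) (s : seq I) m (f : I -> term F sl) :
  (forall i, level m (f i)) -> level m (\big[@Add F sl/Cst sl 0]_(i <- s) f i).
Proof. by move=> fm; elim: s => [|i s IH]; rewrite ?big_nil// big_cons. Qed.

(** Over sl(lev k) the vectors [u] and [v k] satisfy the same relations. Terms that produce a finite
    spanning family from [v k] therefore do so from [u]. *)
Lemma locfin_lim X L (v : nat -> X) (lev : nat -> nat) (u : L) : unbounded lev ->
  locfin X -> cyclic_on u -> (forall k, same_kill (lev k) u (v k)) -> locfin L.
Proof.
move=> unb lX cu same m y; have [t yE] := cu y; have [n tn] := level_ex t.
have [k] := unb (maxn m n); rewrite geq_max => /andP[mk nk].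
have [d0 [B0 [Bv BE]]] := lX (lev k) (v k).
have gB x : gen (lev k) (v k) x -> spn B0 x.
  by apply: gen_min => //; [exact: subspace_spn|move=> z w mz; exact: BE].
have [d [C [Cg gC]]] := subspace_spanned (gen_subspace (lev k) (v k)) gB.
have /choice[c cP] : forall i, exists c, level (lev k) c /\ C i = term_act c (v k).
  by move=> i; have [c lc ->] : gen (lev k) (v k) (C i); [exact: Cg|exists c].
apply: (@locfin_intro F L m (gen (lev k) u) _ (fun i => term_act (c i) u)).
- exact: gen_subspace.
- by move=> z w mz; apply: gen_act; exact: supp_below_le mz.
- by exists t => //; exact: level_le tn.
move=> w [r kr ->]; have [|a aE] := gC (term_act r (v k)); first by exists r.
exists a; pose r' := \big[@Add F sl/Cst sl 0]_i Mul (Cst sl (a i)) (c i).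
have lr' : level (lev k) r' by apply: level_big => i; split=> //; case: (cP i).
have r'E (Z : lieModule sl) (x : Z) : term_act r' x = \sum_i a i *: term_act (c i) x by rewrite term_act_big.
apply/eqP; rewrite -subr_eq0 -r'E; apply/eqP.
have := (same k (Add r (Mul (Cst sl (-1)) r')) _).2; rewrite /= !scaleN1r; apply=> //.
by rewrite r'E aE; apply/eqP; rewrite subr_eq0; apply/eqP/eq_bigr => i _; have [_ ->] := cP i.
Qed.

Definition gen_simple m X (x : X) := forall y, gen m x y -> y != 0 -> gen m y x.

Lemma gen_simple_same m X Y (x : X) (y : Y) :
  same_kill m x y -> gen_simple m x -> gen_simple m y.
Proof.
move=> xy sx w [t mt ->] ty.
have [||r mr rt] := sx (term_act t x).
- by exists t.
- by apply: contra_neq ty => /(xy t mt).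
exists r => //; apply/eqP; rewrite eq_sym -subr_eq0 -scaleN1r; apply/eqP.
apply: (xy (Add (Mul r t) (Cst sl (-1))) _).1 => //=.
by rewrite -rt scaleN1r subrr.
Qed.

Lemma gen_simple_simple L (lev : nat -> nat) (u : L) : unbounded lev ->
  cyclic_on u -> u != 0 -> (forall k, gen_simple (lev k) u) -> mod_simple L.
Proof.
move=> unb cu u0 su; apply: (cyclic_simple cu u0) => t tu.
have [n nt] := level_ex t; have [k nk] := unb n.
have [|r _ rt] := su k (term_act t u) _ tu; first by exists t => //; exact: level_le nt.
by exists r.
Qed.

(** The trace correction of a diagonal unit depends on the level, so weights at two levels differ;
    the sum over [c < m] is the identity of F^m up to a multiple of that of F^m', which accounts for
    the difference. *)
Lemma el_level m m' a b : (a < m)%N -> (b < m)%N -> (m <= m')%N ->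
  el F m a b = el F m' a b - ((a == b)%:R / m%:R) *: \sum_(c < m) el F m' c c.
Proof.
move=> am bm mm'; apply: mx_of_inj; rewrite -scaleNr addrC mx_ofP.
have mx_sum (I : Type) (s : seq I) (f : I -> slInf F) i j :
    mx_of (\sum_(k <- s) f k) i j = \sum_(k <- s) mx_of (f k) i j.
  elim: s => [|k s IH]; first by rewrite !big_nil mx_of0.
  by rewrite !big_cons mx_ofD -IH.
apply/funext => i; apply/funext => j.
rewrite [RHS](_ : _ = - ((a == b)%:R / m%:R) * mx_of (\sum_(c < m) el F m' c c) i j +
  mx_of (el F m' a b) i j)// mx_sum.
have lm k : (k < m)%N -> (k < m')%N by move=> km; exact: leq_trans mm'.
rewrite (mx_of_el charF i j am bm) (mx_of_el charF i j (lm _ am) (lm _ bm)).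
rewrite (eq_bigr (fun c : 'I_m => ((i == c) && (j == c))%:R - m'%:R^-1 * ((i == j) && (i < m')%N)%:R)); last first.
  by move=> c _; rewrite (mx_of_el charF i j (lm _ (ltn_ord c)) (lm _ (ltn_ord c))) eqxx mul1r.
rewrite sumrB sumr_const card_ord.
have -> : \sum_(c < m) ((i == c :> nat) && (j == c :> nat))%:R = ((i == j) && (i < m)%N)%:R :> F.
  have [im|mi] := ltnP i m; last first.
    by rewrite andbF big1// => c _; rewrite gtn_eqF// (leq_trans (ltn_ord c)).
  rewrite (bigD1 (Ordinal im))//= eqxx big1 ?addr0 ?andbT 1?eq_sym// => c.
  by rewrite -val_eqE /= eq_sym => /negPf->.
have mF n : (0 < n)%N -> (n%:R : F) != 0.
  by move=> n0; apply/eqP => h; move: n0; rewrite (natF_inj charF (h : n%:R = 0%:R)).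
move: ((i == j) && (i < m')%N)%:R ((i == j) && (i < m)%N)%:R => x y.
rewrite -[(_ * x) *+ m]mulr_natr.
have m0 : (m%:R : F) != 0 by apply: mF; lia.
have m0' : (m'%:R : F) != 0 by apply: mF; lia.
by field; rewrite m0 m0'.
Qed.

Lemma far_comm m m' a b X (x : sl) (v : X) : (m <= a)%N -> (m <= b)%N -> (a < m')%N -> (b < m')%N ->
  supp_below m (mx_of x) ->
  act (el F m' a b : sl) (act x v) = act x (act (el F m' a b : sl) v).
Proof.
move=> ma mb am bm mx; have mx' : supp_below m' (mx_of x) by apply: supp_below_le mx; lia.
rewrite (el_span charF mx') !act_suml !act_sumr; apply: eq_bigr => i _.
rewrite !act_suml act_sumr; apply: eq_bigr => j _; rewrite !actZl actZr.
have [im|mi] := ltnP i m; last by rewrite mx ?mi// !scale0r.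
have [jm|mj] := ltnP j m; last by rewrite mx ?mj ?orbT// !scale0r.
rewrite act_comm (bracket_el charF)//.
have -> : (b == i :> nat) = false by apply/eqP; lia.
have -> : (a == j :> nat) = false by apply/eqP; lia.
by rewrite !scale0r subrr act0l addr0.
Qed.

Lemma level_comm m t X (z : sl) (v : X) :
  (forall (x : sl) (w : X), supp_below m (mx_of x) -> act z (act x w) = act x (act z w)) ->
  level m t -> act z (term_act t v) = term_act t (act z v).
Proof.
move=> zc; elim: t v => [x|c|t1 IH1 t2 IH2|t1 IH1 t2 IH2] v /=.
- exact: zc.
- by rewrite actZr.
- by move=> [m1 m2]; rewrite actDrr IH1// IH2.
- by move=> [m1 m2]; rewrite IH1// IH2.
Qed.

(** The diagonal units of level [m'] sum to 0, so the outer eigenvalues [nu] determine the action of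
    the sum over [c < m], and with it the change of level for the inner indices. *)
Lemma wtT_glue m m' X (x : X) mu nu : (m <= m')%N -> wtT m (iota 0 m) mu x ->
  (forall a, (m <= a)%N -> (a < m')%N -> act (el F m' a a : sl) x = nu a *: x) ->
  exists lam, wtT m' (iota 0 m') lam x.
Proof.
move=> mm' wx nx.
exists (fun a => if (a < m)%N then mu a - m%:R^-1 * \sum_(m <= c < m') nu c else nu a).
move=> a am'; rewrite nth_iota//=; case: ltnP => [am|ma]; last exact: nx.
have E : \sum_(c < m) act (el F m' c c : sl) x = - (\sum_(m <= c < m') nu c) *: x.
  have tr0 : \sum_(c < m') act (el F m' c c : sl) x = 0.
    by rewrite -act_suml (el_tr charF) act0l.
  move: tr0; rewrite -!(big_mkord xpredT (fun c => act (el F m' c c : sl) x)).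
  rewrite (big_cat_nat _ mm')//= => /eqP; rewrite addr_eq0 => /eqP->.
  rewrite scaleNr scaler_suml; congr (- _); apply: eq_big_nat => c /andP[mc cm].
  exact: nx.
have := wx a am; rewrite nth_iota// (el_level am am mm') eqxx mul1r.
rewrite -scaleNr addrC actDl act_suml E scalerA mulrNN => h.
by rewrite scalerBl -h [RHS]addrC addKr.
Qed.

Lemma wtT_le m m' X (x : X) lam : (m <= m')%N -> wtT m' (iota 0 m') lam x ->
  exists mu, wtT m (iota 0 m) mu x.
Proof.
move=> mm' wx; exists (fun a => lam a - m%:R^-1 * \sum_(c < m) lam c) => a am.
have lm k : (k < m)%N -> (k < m')%N by move=> km; exact: leq_trans mm'.
have wx' c : (c < m)%N -> act (el F m' c c : sl) x = lam c *: x.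
  by move=> /lm cm; have := wx c cm; rewrite nth_iota.
rewrite nth_iota// (el_level am am mm') eqxx mul1r -scaleNr addrC actDl act_suml wx'//.
rewrite (eq_bigr _ (fun (c : 'I_m) _ => wx' c (ltn_ord c))) -scaler_suml scalerA.
by rewrite -scalerDl mulNr addrC.
Qed.

Section Model.
Variables (M N : lieModule sl).
Hypotheses (simpleM : mod_simple M) (lN : locfin N).
Hypothesis MN : forall t, kills t M <-> kills t N.

Definition allwt X (x : X) := forall m, exists mu, wtT m (iota 0 m) mu x.

Lemma model_exists : exists L (u : L) (lev : nat -> nat),
  [/\ mod_simple L, forall t, kills t L <-> kills t M, locfin L &
   [/\ cyclic_on u, u != 0, allwt u, forall k, (lev k < lev k.+1)%N &
    forall k, gen_simple (lev k) u]].
Proof.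
have [z [zv zle zM]] := chain_exists charF simpleM lN MN.
pose m k := (z k).1; pose w k := wcol F (z k).2.
have m0 k : (0 < m k)%N by case: (zv k).
have mlt k : (m k < m k.+1)%N.
  by have [h _] := zle k; have := m0 k; rewrite /m in h *; lia.
have mle k : (m k <= m k.+1)%N by exact: ltnW.
have unb : unbounded m.
  move=> n; exists n; elim: n => // n IH; exact: leq_ltn_trans IH (mlt n).
have lT := @locfin_T F.
have /choice[b bP] : forall k, exists b, [/\ level (m k.+1) b, term_act b (w k.+1) != 0,
    hwT (m k) (iota 0 (m k)) (wwt F (m k) (z k).2) (term_act b (w k.+1)) &
    exists mu, wtT (m k.+1) (iota 0 (m k.+1)) mu (term_act b (w k.+1))].
  move=> k; have [h e] := zle k; have [_ v1] := zv k; have [_ v2] := zv k.+1.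
  have [y [mu [[b mb ->] y0 hy wy]]] := emb_type charF (m0 k) h v1 v2 e.
  by exists b; split=> //; exists mu.
(* [b k] takes [w k.+1] to a copy of [w k], so [B k] composes the embeddings and [v k] below is the
   image of [w 0] in the k-th module. *)
pose B := fix B k := if k is j.+1 then Mul (B j) (b j) else Cst sl 1.
have BS k : B k.+1 = Mul (B k) (b k) by [].
have Bm k : level (m k) (B k).
  elim: k => // k IH; rewrite BS; split; first exact: level_le (mle k) IH.
  by case: (bP k).
pose v k := term_act (B k) (w k).
have hw k := wcol_hw charF (m k) (z k).2.
have w0 k : w k != 0 := wcol_neq0 F _.
have yw k t : level (m k) t -> term_act t (w k) = 0 <-> term_act t (term_act (b k) (w k.+1)) = 0.
  by case: (bP k) => _ y0 hy _ kt; exact: (hwT_ann charF (perm_refl _) lT lT (hw k) hy (w0 k) y0 kt).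
have same k : same_kill (m k) (v k) (v k.+1).
  by move=> t kt; rewrite /v BS /=; apply: (yw k (Mul t (B k))); split.
have v0 k : v k != 0.
  elim: k => [|k IH]; first by rewrite /v /= scale1r.
  apply: contra_neq IH => h; have := (same k (Cst sl 1) I).2; rewrite /= !scale1r; exact.
have [L [u [cu uv]]] := lim_module mle unb same.
have wv k : gen (m k) (w k) (v k) by exists (B k).
have vw k : gen (m k) (v k) (w k) := hwT_simple charF (perm_refl _) lT (hw k) (wv k) (v0 k).
have sv k : gen_simple (m k) (v k).
  move=> y vy y0; apply: gen_trans (wv k).
  by apply: (hwT_simple charF (perm_refl _) lT (hw k)) => //; exact: gen_trans vy.
have su k : gen_simple (m k) u.
  by apply: gen_simple_same (sv k) => t kt; have := uv k t kt; tauto.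
have u0 : u != 0.
  by apply: contra_neq (v0 0%N) => h; have := (uv 0%N (Cst sl 1) I).1; rewrite /= !scale1r; exact.
have wtv k : exists mu, wtT (m k) (iota 0 (m k)) mu (v k).
  elim: k => [|k [mu wmu]].
    by exists (wwt F (m 0%N) (z 0%N).2); rewrite /v /= scale1r; case: (hw 0%N).
  have [_ _ _ [nu wnu]] := bP k.
  apply: (@wtT_glue (m k) (m k.+1) _ _ mu nu (mle k)).
    by apply: inherits_wtT charF _ _ _ _ _ _ _ _ (leqnn _) _ wmu => t kt /(same k t kt).
  have vS : v k.+1 = term_act (B k) (term_act (b k) (w k.+1)) by rewrite /v BS.
  (* Diagonal units at indices beyond [m k] commute with sl(m k), hence with [B k], and act on
     [v k.+1] as on the weight vector from [emb_type]. *)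
  move=> a ka ak; rewrite vS (level_comm _ _ (Bm k)); last first.
    by move=> x y mx; exact: (far_comm y ka ka ak ak mx).
  have := wnu a ak; rewrite nth_iota// => ->; exact: term_actZ.
exists L, u, m; split.
- exact: gen_simple_simple unb cu u0 su.
- move=> t; rewrite zM /kills (kills_cyclic t cu); split.
    move=> tL; have [n nt] := level_ex t; exists n => // k nk y wy.
    have [r kr ->] := gen_trans (vw k) wy.
    have := tL r; have := uv k (Mul t r) (conj (level_le nk nt) kr); by tauto.
  move=> [n nt tk] r; have [n' rn'] := level_ex r; have [k] := unb (maxn n n').
  rewrite geq_max => /andP[nk n'k].
  apply: (uv k (Mul t r) (conj (level_le nk nt) (level_le n'k rn'))).2.
  apply: (tk k nk); apply: gen_trans (wv k) _; exists r => //; exact: level_le rn'.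
- exact: locfin_lim unb lT cu uv.
- split=> // n; have [k nk] := unb n; have [mu wmu] := wtv k.
  have [lam wlam] : exists lam, wtT (m k) (iota 0 (m k)) lam u.
    exists mu; apply: inherits_wtT charF _ _ _ _ _ _ _ _ (leqnn _) _ wmu => t kt.
    by case: (uv k t kt).
  exact: wtT_le nk wlam.
Qed.

End Model.

End Limit.

(** * Vanishing of far off-diagonal operators *)

Section OffDiagonal.
Variables (F : closedFieldType) (charF : [pchar F] =i pred0).
Local Notation sl := (slInf F).
Implicit Types (X Y L : lieModule sl) (t r : term F sl).

(** Off the diagonal a matrix unit is traceless, so the level chosen here is immaterial. *)
Definition eij (i j : nat) : sl := el F (maxn i j).+1 i j.

Lemma eijE m i j : i != j -> (i < m)%N -> (j < m)%N -> el F m i j = eij i j.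
Proof.
move=> ij im jm; rewrite /eij (el_level charF (m := (maxn i j).+1) (m' := m)) ?ltnS ?leq_maxl ?leq_maxr//.
  by rewrite (negPf ij) mul0r scale0r subr0.
by rewrite gtn_max im.
Qed.

Lemma supp_eij m i j : (i < m)%N -> (j < m)%N -> supp_below m (mx_of (eij i j)).
Proof.
move=> im jm; apply: supp_below_le (@supp_el F charF (maxn i j).+1 i j).
by rewrite gtn_max im.
Qed.

Lemma eij_comm X a b c d (v : X) : a != b -> c != d -> b != c -> a != d ->
  act (eij a b) (act (eij c d) v) = act (eij c d) (act (eij a b) v).
Proof.
move=> ab cd bc ad; pose m := (maxn (maxn a b) (maxn c d)).+1.
rewrite -(@eijE m a b) ?ltnS -1?(@eijE m c d) ?ltnS//; try by lia.
rewrite act_comm (bracket_el charF) ?ltnS; try by lia.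
by rewrite (negPf bc) (negPf ad) !scale0r subrr act0l addr0.
Qed.

Lemma eij_mul X a b d (v : X) : a != b -> b != d -> a != d ->
  act (eij a b) (act (eij b d) v) = act (eij b d) (act (eij a b) v) + act (eij a d) v.
Proof.
move=> ab bd ad; pose m := (maxn (maxn a b) d).+1.
rewrite -(@eijE m a b) ?ltnS -1?(@eijE m b d) -1?(@eijE m a d) ?ltnS//; try by lia.
rewrite act_comm (bracket_el charF) ?ltnS; try by lia.
by rewrite eqxx (negPf ad) scale0r subr0 scale1r.
Qed.

Lemma cartan_eij m X a c d (v : X) : (a < m)%N -> (c < m)%N -> (d < m)%N -> c != d ->
  act (el F m a a : sl) (act (eij c d) v) =
  act (eij c d) (act (el F m a a : sl) v) + ((a == c)%:R - (a == d)%:R) *: act (eij c d) v.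
Proof.
move=> am cm dm cd; rewrite -(@eijE m c d)// act_comm (bracket_el charF)//; congr (_ + _).
rewrite scalerBl act_lin2.
by congr (_ - _); case: eqP => [->|] //; rewrite !scale0r.
Qed.

Lemma allwt_eij X (x : X) c d : c != d -> allwt x -> allwt (act (eij c d) x).
Proof.
move=> cd wx m; pose M := maxn m (maxn c d).+1; have [mu wmu] := wx M.
suff [lam wlam] : exists lam, wtT M (iota 0 M) lam (act (eij c d) x).
  exact: (wtT_le charF (leq_maxl _ _) wlam).
exists (fun a => mu a + ((a == c)%:R - (a == d)%:R)) => a aM.
have := wmu a aM; rewrite nth_iota// => wa.
rewrite cartan_eij//; try by rewrite /M; lia.
by rewrite wa actZr -scalerDl.
Qed.

Section TailVanish.
Variables (L : lieModule sl) (u : L) (lev : nat -> nat).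
Hypotheses (cu : cyclic_on u) (u0 : u != 0) (wu : allwt u).
Hypothesis levS : forall k, (lev k < lev k.+1)%N.
Hypothesis su : forall k, gen_simple (lev k) u.
Hypothesis detL : forall L', mod_simple L' -> (forall t, kills t L' <-> kills t L) -> mod_iso L' L.

(* Otherwise far apart operators [e k] could be applied one after the other. The
   limit of the [w k] is a module with the same annihilator, hence isomorphic to
   [L]; but the weights of its generator differ from those of [u] at every index
   pair [P k], whereas those of any vector of [L] differ from those of [u] at
   finitely many indices only. *)
Lemma tail_vanish : exists n, forall i j, (n <= i)%N -> (n <= j)%N -> i != j ->
  act (eij i j) u = 0.
Proof.
apply: contrapT => nv.
have /choice[p pP] : forall n, exists p : nat * nat,
    [/\ (n <= p.1)%N, (n <= p.2)%N, p.1 != p.2 & act (eij p.1 p.2) u != 0].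
  move=> n; apply: contrapT => np; apply: nv; exists n => i j ni nj ij.
  by apply/eqP; apply: contraT => e0; case: np; exists (i, j).
have lev_ge k : (k <= lev k)%N by elim: k => // k IH; exact: leq_ltn_trans IH (levS k).
(* [q k.+1] exceeds both indices of the pair chosen at step [k], so that pair lies between [n k] and
   [n k.+1] and its operator commutes with sl(n k). *)
pose q := fix q k := if k is j.+1 then
  (maxn (p (lev (q j))).1 (p (lev (q j))).2).+1 else 0%N.
have qS k : q k.+1 = (maxn (p (lev (q k))).1 (p (lev (q k))).2).+1 by [].
pose n k := lev (q k); pose P k := p (n k).
have PP k : [/\ (n k <= (P k).1)%N, (n k <= (P k).2)%N, (P k).1 != (P k).2 &
    act (eij (P k).1 (P k).2) u != 0] := pP (n k).
have Pn k : ((P k).1 < n k.+1)%N /\ ((P k).2 < n k.+1)%N.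
  have h := lev_ge (q k.+1); rewrite {1}qS gtn_max in h.
  by case/andP: h.
have nS k : (n k <= n k.+1)%N.
  by have [h _ _ _] := PP k; have [h' _] := Pn k; exact: leq_trans h (ltnW h').
have unb : unbounded n.
  move=> k; exists k; elim: k => // k IH.
  have [h _ _ _] := PP k; have [h' _] := Pn k.
  exact: leq_trans (leq_ltn_trans (leq_trans IH h) h') _.
pose e k := eij (P k).1 (P k).2.
pose w := fix w k := if k is j.+1 then act (e j) (w j) else u.
have wS k : w k.+1 = act (e k) (w k) by [].
have ecomm k t (v : L) : level (n k) t -> act (e k) (term_act t v) = term_act t (act (e k) v).
  apply: level_comm => x y mx; have [h1 h2 h3 _] := PP k; have [h4 h5] := Pn k.
  by rewrite /e -(eijE h3 h4 h5) (far_comm charF y h1 h2 h4 h5 mx).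
have sun k : gen_simple (n k) u := @su (q k).
have wu_ k : gen (n k) u (w k) /\ w k != 0.
  elim: k => [|k [IH IH0]]; first by split=> //; exact: gen_refl.
  have [h1 h2] := Pn k; rewrite wS; split.
    by apply: gen_act; [exact: supp_eij|exact: gen_le IH].
  have [r kr ur] := sun k _ IH IH0; have [_ _ _ eu] := PP k.
  by apply: contra_neq eu => ew; rewrite -/(e k) ur ecomm// ew term_act0.
(* The kernel of [e k] is an sl(n k)-submodule of the simple module of [u] and does not contain
   [u]. *)
have inj k x : gen (n k) u x -> act (e k) x = 0 -> x = 0.
  move=> ux ex; apply/eqP; apply: contraT => x0; have [r kr ur] := sun k _ ux x0.
  by have [_ _ _ /eqP[]] := PP k; rewrite -/(e k) ur ecomm// ex term_act0.
have same k : same_kill (n k) (w k) (w k.+1).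
  move=> t kt; rewrite wS -ecomm//; split=> [->|]; first exact: act0r.
  by apply: inj; apply: gen_trans (wu_ k).1 _; exists t.
have [L' [u' [cu' uw']]] := lim_module nS unb same.
have u'0 : u' != 0.
  apply: contra_neq (wu_ 0%N).2 => h.
  by have := (uw' 0%N (Cst sl 1) I).1; rewrite /= !scale1r; exact.
have sw k : gen_simple (n k) (w k).
  move=> y wy y0; apply: gen_trans (wu_ k).1; apply: (sun k) => //.
  exact: gen_trans (wu_ k).1 wy.
have su' k : gen_simple (n k) u'.
  by apply: gen_simple_same (sw k) => t kt; have := uw' k t kt; tauto.
have [|f [bf fact]] := detL (gen_simple_simple unb cu' u'0 su').
  (* At level [n k] the vectors [u'] and [w k] satisfy the same relations, while [w k] and [u]
     generate the same sl(n k)-module. *)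
  move=> t; rewrite /kills (kills_cyclic t cu') (kills_cyclic t cu).
  have [a ta] := level_ex t; split=> h r; have [b rb] := level_ex r;
    have [k] := unb (maxn a b); rewrite geq_max => /andP[ak bk].
    have [s ks us] := sun k _ (wu_ k).1 (wu_ k).2.
    rewrite us; have := h (Mul r s) => hk.
    have [] := uw' k (Mul t (Mul r s)).
      by split; [exact: level_le ta|split=> //; exact: level_le rb].
    by move=> + _; apply.
  apply/(uw' k (Mul t r)).
    by split; [exact: level_le ta|exact: level_le rb].
  have [s ks ->] := (wu_ k).1; exact: (h (Mul r s)).
have [t yE] := cu (f u'); have [a ta] := level_ex t; have [K aK] := unb a.
have y0 : f u' != 0.
  have [h hf _] := bf; apply: contra_neq u'0 => h0.
  by apply: (can_inj hf); rewrite h0 linear0.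
have [h1 h2 h3 _] := PP K; have [h4 h5] := Pn K.
set i := (P K).1 in h1 h3 h4; set j := (P K).2 in h2 h3 h5; set m := n K.+1 in h4 h5.
have [mu wmu] := wu m.
have wi := wmu i h4; have wj := wmu j h5; rewrite !nth_iota//= in wi wj.
(* [z] commutes with sl(n K), so it acts on [f u' = t u] by its eigenvalue on [u]; on [w K.+1],
   hence on [u'], the root of [e K] has added 2. *)
pose z : sl := el F m i i - el F m j j.
have zE X (x : X) : act z x = act (el F m i i : sl) x - act (el F m j j : sl) x.
  by have := act_lin2 1 1 (el F m i i : sl) (el F m j j) x; rewrite !scale1r.
have mz : supp_below m (mx_of z).
  have := @supp_lin F m (-1) _ _ (@supp_el F charF m j j) (@supp_el F charF m i i).
  by rewrite scaleN1r addrC.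
have zu : act z u = (mu i - mu j) *: u by rewrite zE wi wj scalerBl.
have zc r (v : L) : level (n K) r -> act z (term_act r v) = term_act r (act z v).
  apply: level_comm => x y mx.
  by rewrite !zE (far_comm charF y h1 h1 h4 h4 mx) (far_comm charF y h2 h2 h5 h5 mx) -scaleN1r -actZr -actDrr scaleN1r.
have zy : act z (f u') = (mu i - mu j) *: f u'.
  by rewrite yE zc ?zu ?term_actZ//; exact: level_le ta.
have zw : act z (w K.+1) = (mu i - mu j + 2%:R) *: w K.+1.
  have zK : act z (w K) = (mu i - mu j) *: w K.
    by have [s ks ->] := (wu_ K).1; rewrite zc// zu term_actZ.
  have ji : (j == i) = false by rewrite eq_sym (negPf h3).
  rewrite wS zE /e -/i -/j !cartan_eij// !eqxx (negPf h3) ji subr0 sub0r.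
  have AB : act (eij i j) (act (el F m i i : sl) (w K)) - act (eij i j) (act (el F m j j : sl) (w K)) =
    (mu i - mu j) *: act (eij i j) (w K).
    by rewrite -actZr -zK zE -scaleN1r -actZr -actDrr scaleN1r.
  by rewrite scale1r scaleN1r opprD opprK addrACA AB [RHS]scalerDl scaler_nat mulr2n.
have zu' : act z u' = (mu i - mu j + 2%:R) *: u'.
  by apply: (inherits_eq mz _ zw) => r mr; case: (uw' K.+1 r mr).
have : act z (f u') = (mu i - mu j + 2%:R) *: f u' by rewrite -fact zu' linearZ.
rewrite zy [(_ + 2%:R) *: _]scalerDl => /eqP; rewrite -subr_eq0 opprD addrA subrr sub0r oppr_eq0 scaler_eq0 (negPf y0) orbF.
by move=> /eqP h; have := natF_inj charF (h : 2%:R = 0%:R).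
Qed.

End TailVanish.

End OffDiagonal.

(** * Highest weight vectors in the limit *)

Section Polarization.
Variables (F : fieldType) (X : lmodType F) (n : nat).
Hypothesis natF : forall k, (k.+1%:R : F) != 0.
Variables (O : 'I_n -> nat -> X -> X) (D : nat -> X -> X) (eps : F) (u : X).
Hypothesis O_lin : forall a b (c : F) (x y : X), O a b (c *: x + y) = c *: O a b x + O a b y.
Hypothesis D_lin : forall d (c : F) (x y : X), D d (c *: x + y) = c *: D d x + D d y.
Hypothesis OC : forall a b a' b' (x : X), O a b (O a' b' x) = O a' b' (O a b x).
Hypothesis eps0 : eps != 0.
Hypothesis Du : forall c, (0 < c)%N -> D c u = 0.
Hypothesis DO0 : forall c a (x : X), (0 < c)%N -> D c (O a 0%N x) = O a 0%N (D c x) + eps *: O a c x.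
Hypothesis DOl : forall c a l (x : X), (0 < c)%N -> (0 < l)%N -> D c (O a l x) = O a l (D c x).
Hypothesis nil0 : forall a, exists N, iter N (O a 0%N) u = 0.
Hypothesis u0 : u != 0.

Let O0 a b : O a b 0 = 0.
Proof. exact: (lin0 (O_lin a b)). Qed.
Let D0 c : D c 0 = 0.
Proof. exact: (lin0 (D_lin c)). Qed.
Let OZ a b (c : F) x : O a b (c *: x) = c *: O a b x.
Proof. exact: (linZ (O_lin a b)). Qed.
Let OD a b x y : O a b (x + y) = O a b x + O a b y.
Proof. exact: (linD (O_lin a b)). Qed.
Let iterO0 a k : iter k (O a 0%N) 0 = 0.
Proof. by elim: k => //= k ->; rewrite O0. Qed.
Let iterOC a k b (x : X) : iter k (O a 0%N) (O a b x) = O a b (iter k (O a 0%N) x).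
Proof. by elim: k => //= k ->; rewrite OC. Qed.

Let row a (J : seq nat) (x : X) := foldr (O a) x J.

Let row0 a J : row a J 0 = 0.
Proof. by elim: J => //= b J ->; rewrite O0. Qed.

Let D_iter c a k (x : X) : (0 < c)%N ->
  D c (iter k.+1 (O a 0%N) x) =
  iter k.+1 (O a 0%N) (D c x) + (k.+1%:R * eps) *: iter k (O a 0%N) (O a c x).
Proof.
move=> c0; elim: k => [|k IH]; first by rewrite /= DO0// mul1r.
have -> : iter k.+2 (O a 0%N) x = O a 0%N (iter k.+1 (O a 0%N) x) by [].
rewrite DO0// IH OD OZ -addrA; congr (_ + _).
rewrite -(iterOC a k.+1) -[O a 0%N _]/(iter k.+1 _ _) -scalerDl.
by rewrite -[X in _ + X]mul1r -mulrDl natr1.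
Qed.

(** [D c] commutes with the factors of positive index and kills [u], so on a vanishing word its only
    effect is to trade one factor [O a 0] for [O a c], with a coefficient that is nonzero in
    characteristic 0. *)
Let row_pos a N J : iter N (O a 0%N) u = 0 -> all (leq 1) J -> (size J <= N)%N ->
  iter (N - size J) (O a 0%N) (row a J u) = 0.
Proof.
move=> Nu; elim: J => [|c J IH] /=; first by rewrite subn0.
move=> /andP[c0 J0] JN; have := IH J0 (ltnW JN).
have -> : (N - size J = (N - (size J).+1).+1)%N by lia.
move: (N - (size J).+1)%N => k /(congr1 (D c)); rewrite D0 D_iter//.
have -> : D c (row a J u) = 0.
  elim: J J0 {IH JN} => [|l J IH] /=; first by rewrite Du.
  by move=> /andP[l0 J0]; rewrite DOl// IH// O0.
rewrite iterO0 add0r => /eqP; rewrite scaler_eq0 mulf_eq0 (negPf eps0) (negPf (natF _)) /=.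
by move/eqP.
Qed.

(** The factors [O a 0] are collected in front; when more than [N] factors of positive index remain,
    already the last [N] of them kill [u]. *)
Let row_kill a N J : iter N (O a 0%N) u = 0 -> (N <= size J)%N -> row a J u = 0.
Proof.
move=> Nu NJ.
have -> : row a J u = iter (count (pred1 0%N) J) (O a 0%N) (row a [seq b <- J | (0 < b)%N] u).
  elim: J {NJ} => //= b J ->; case: b => [|b] //=; by rewrite iterOC.
set J' := [seq b <- J | _]; set c := count _ _.
have J'0 : all (leq 1) J' by exact: filter_all.
have sJ : (c + size J' = size J)%N.
  rewrite /c /J' size_filter -(count_predC (pred1 0%N) J); congr (_ + _)%N.
  by apply: eq_count => b /=; rewrite lt0n.
have [J'N|NJ'] := leqP (size J') N.
  have -> : (c = (c - (N - size J')) + (N - size J'))%N by lia.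
  by rewrite iterD row_pos// iterO0.
have -> : row a J' u = 0; last exact: iterO0.
rewrite -(cat_take_drop (size J' - N) J') /row foldr_cat.
have := @row_pos a N (drop (size J' - N) J') Nu; rewrite size_drop subKn; last exact: ltnW.
by rewrite subnn /row /= => -> //; [exact: row0|apply/allP => b /mem_drop/(allP J'0)].
Qed.

Definition ops (w : seq ('I_n * nat)) (x : X) := foldr (fun i => O i.1 i.2) x w.

Lemma ops_comm (T : X -> X) w x : (forall i y, i \in w -> T (O i.1 i.2 y) = O i.1 i.2 (T y)) ->
  T (ops w x) = ops w (T x).
Proof.
elim: w => //= i w IH h; rewrite h ?mem_head// IH// => j y jw.
by rewrite h// inE jw orbT.
Qed.

Let ops0 w : ops w 0 = 0.
Proof. by elim: w => //= i w ->; rewrite O0. Qed.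

Let ops_row a w : ops w u = ops [seq i <- w | i.1 != a] (row a [seq i.2 | i <- w & i.1 == a] u).
Proof.
elim: w => [|[a' b] w IH] //; rewrite /= IH; case: (eqVneq a' a) => [->|] //=.
by rewrite (ops_comm (T := O a b)).
Qed.

Let size_count w : size w = \sum_(a < n) count (fun i : 'I_n * nat => i.1 == a) w.
Proof.
elim: w => [|i w IH] /=; first by rewrite big1.
by rewrite big_split /= -IH (bigD1 i.1)//= eqxx big1 // => a; rewrite eq_sym => /negPf->.
Qed.

(* Applying the [D c] to [iter N (O a 0) u = 0] replaces factors [O a 0] by
   [O a c] one at a time, so any [N a] factors from row [a] kill [u] and the
   length of the words that do not kill [u] is bounded. *)
Theorem polarize : exists w, ops w u != 0 /\ forall a b, O a b (ops w u) = 0.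
Proof.
have /choice[N NP] := nil0.
pose Q k := `[< exists w, size w = k /\ ops w u != 0 >].
have exQ : exists k, Q k by exists 0%N; apply/asboolP; exists [::].
have ubQ k : Q k -> (k <= \sum_a N a)%N.
  move=> /asboolP[w [<- wu]]; rewrite size_count; apply: leq_sum => a _.
  rewrite leqNgt; apply/negP => /ltnW h; move: wu; rewrite (ops_row a) (@row_kill a (N a)) ?ops0 ?eqxx//.
  by rewrite size_map size_filter.
case: (ex_maxnP exQ ubQ) => k /asboolP[w [sw wu]] kmax; exists w; split=> // a b.
apply/eqP; apply: contraT => h.
have := kmax k.+1; rewrite ltnn; apply.
by apply/asboolP; exists ((a, b) :: w); rewrite /= sw.
Qed.

End Polarization.

Section Stages.
Variables (F : closedFieldType) (charF : [pchar F] =i pred0).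
Local Notation sl := (slInf F).
Variables (L : lieModule sl) (lL : locfin L).
Implicit Types (x y u : L).

Let natF k : (k.+1%:R : F) != 0.
Proof. by apply/eqP => h; have := natF_inj charF (h : k.+1%:R = 0%:R). Qed.

Definition tail n x := forall i j, (n <= i)%N -> (n <= j)%N -> i != j -> act (eij F i j) x = 0.

Lemma eij_nilp x i j : allwt x -> i != j -> exists N, iter N (act (eij F i j)) x = 0.
Proof.
move=> wx ij; pose m := (maxn i j).+1; have [mu wmu] := wx m.
have [||N] := wtT_nilp charF (perm_refl _) lL wmu (i := i) (j := j) _ _ ij; try by rewrite /m; lia.
by rewrite !nth_iota /m /= ?add0n; try lia; exists N.
Qed.

Lemma allwt_ops n (f : 'I_n -> nat -> nat * nat) w x :
  (forall a b, (f a b).1 != (f a b).2) -> allwt x ->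
  allwt (ops (fun a b => act (eij F (f a b).1 (f a b).2) : L -> L) w x).
Proof. by move=> fn wx; elim: w => //= i w IH; apply: allwt_eij. Qed.

Lemma word_bound n (w : seq ('I_n * nat)) : exists B, {in w, forall i, i.2 < B}%N.
Proof.
exists (\max_(i <- w) i.2).+1 => i iw.
by rewrite ltnS (big_rem i iw) /= leq_maxl.
Qed.

(** Polarization with [O a b] = e_(a,n+b) and [D c] = e_(n,n+c); here [D c, O a 0] = - O a c, whence
    the sign -1. The new tail starts behind all columns used in the word, where the operators
    commute with it. *)
Lemma stage1 n u : u != 0 -> allwt u -> tail n u -> exists x m,
  [/\ x != 0, allwt x, (n <= m)%N, tail m x &
   forall i j, (i < n)%N -> (n <= j)%N -> act (eij F i j) x = 0].
Proof.
move=> u0 wu tu.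
pose O (a : 'I_n) b : L -> L := act (eij F a (n + b)).
pose D c : L -> L := act (eij F n (n + c)).
have [|||||||||w [wu0 Ow]] := @polarize F L n natF O D (-1) u.
- by move=> a b c x y; exact: actDr.
- by move=> d c x y; exact: actDr.
- by move=> a b a' b' x; apply: eij_comm => //; have := ltn_ord a; have := ltn_ord a'; lia.
- by rewrite oppr_eq0 oner_eq0.
- by move=> c c0; apply: tu; lia.
- move=> c a x c0; rewrite /D /O scaleN1r addn0 eij_mul ?addrK//; have := ltn_ord a; lia.
- by move=> c a l x c0 l0; apply: eij_comm => //; have := ltn_ord a; lia.
- by move=> a; apply: eij_nilp => //; have := ltn_ord a; lia.
- by [].
have [B wB] := word_bound w.
exists (ops O w u), (n + B)%N; split=> //.
- by apply: (@allwt_ops n (fun a b => (val a, n + b)%N)) => // a b /=; have := ltn_ord a; lia.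
- exact: leq_addr.
- move=> i j ni nj ij; rewrite (ops_comm (T := act (eij F i j))).
    by rewrite tu//; try lia; elim: (w) => //= k w' ->; exact: act0r.
  move=> k y kw; have kB : (k.2 < B)%N := wB k kw; have := ltn_ord k.1.
  by move=> kn; apply: eij_comm => //; lia.
- move=> i j ni nj; have := Ow (Ordinal ni) (j - n)%N; by rewrite /O /= subnKC.
Qed.

(** The dual polarization, for the indices in [n, m) that are to come last. What the first stage
    achieved persists: the commutator of e_ij, i < n <= j, with e_(m+b,n+a) is 0 or e_(i,n+a), an
    operator of the same kind. *)
Lemma stage2 n m u : u != 0 -> allwt u -> (n <= m)%N -> tail m u ->
  (forall i j, (i < n)%N -> (n <= j)%N -> act (eij F i j) u = 0) ->
  exists x m', [/\ x != 0, allwt x, (m <= m')%N &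
   [/\ forall i j, (m <= i)%N -> (m' <= j)%N -> i != j -> act (eij F i j) x = 0,
   forall i j, (i < n)%N -> (n <= j)%N -> act (eij F i j) x = 0 &
   forall i j, (m <= i)%N -> (n <= j)%N -> (j < m)%N -> act (eij F i j) x = 0]].
Proof.
move=> u0 wu nm tu nu.
pose O (a : 'I_(m - n)) b : L -> L := act (eij F (m + b) (n + a)).
pose D c : L -> L := act (eij F (m + c) m).
have [|||||||||w [wu0 Ow]] := @polarize F L (m - n) natF O D 1 u.
- by move=> a b c x y; exact: actDr.
- by move=> d c x y; exact: actDr.
- by move=> a b a' b' x; apply: eij_comm => //; have := ltn_ord a; have := ltn_ord a'; lia.
- exact: oner_neq0.
- by move=> c c0; apply: tu; lia.
- by move=> c a x c0; rewrite /D /O scale1r addn0 eij_mul//; have := ltn_ord a; lia.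
- by move=> c a l x c0 l0; apply: eij_comm => //; have := ltn_ord a; lia.
- by move=> a; apply: eij_nilp => //; have := ltn_ord a; lia.
- by [].
have [B wB] := word_bound w.
exists (ops O w u), (m + B)%N; split=> //.
- by apply: (@allwt_ops (m - n) (fun a b => (m + b, n + a)%N)) => // a b /=; have := ltn_ord a; lia.
- exact: leq_addr.
split.
- move=> i j ni nj ij; rewrite (ops_comm (T := act (eij F i j))).
    by rewrite tu//; try lia; elim: (w) => //= k w' ->; exact: act0r.
  move=> k y kw; have kB : (k.2 < B)%N := wB k kw; have := ltn_ord k.1.
  by move=> kn; apply: eij_comm => //; lia.
- elim: (w) => [|[a b] w' IH] // i j ni nj; have am := ltn_ord a.
  have -> : ops O ((a, b) :: w') u = act (eij F (m + b) (n + a)) (ops O w' u) by [].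
  have [->|jb] := eqVneq j (m + b)%N.
    by rewrite eij_mul ?IH ?act0r ?addr0//; lia.
  by rewrite eij_comm ?IH ?act0r//; lia.
- move=> i j mi nj jm; have jn : (j - n < m - n)%N by lia.
  by have := Ow (Ordinal jn) (i - m)%N; rewrite /O /= !subnKC.
Qed.

(** The vanishing conditions involving far indices survive raising within [P ++ Q]: predecessors of
    elements of [P] lie in [P] and successors of elements of [Q] in [Q], so each commutator is 0 or
    again an operator that kills. *)
Lemma structure n u : u != 0 -> allwt u -> tail n u -> exists P Q m y mu,
  [/\ y != 0, allwt y, perm_eq (P ++ Q) (iota 0 m), hwT m (P ++ Q) mu y &
   [/\ tail m y,
   forall p r, p \in P -> (m <= r)%N -> act (eij F p r) y = 0 &
   forall r q, (m <= r)%N -> q \in Q -> act (eij F r q) y = 0]].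
Proof.
move=> u0 wu tu; have [u1 [m [u10 wu1 nm tu1 nu1]]] := stage1 u0 wu tu.
have [x [M [x0 wx mM [mx nx mnx]]]] := stage2 u10 wu1 nm tu1 nu1.
(* The indices in [m, M) join [P]: for them e_ij is known to kill [x] when [j] is at least [M] or
   lies in [Q]. *)
pose P := iota 0 n ++ iota m (M - m); pose Q := iota n (m - n).
have inP a : (a \in P) = (a < n)%N || (m <= a < M)%N.
  by rewrite mem_cat !mem_iota /= subnKC.
have inQ a : (a \in Q) = (n <= a < m)%N by rewrite mem_iota subnKC.
pose s := P ++ Q.
have sP : perm_eq s (iota 0 M).
  apply: uniq_perm; rewrite ?iota_uniq//.
    rewrite !cat_uniq !iota_uniq /= !andbT; apply/andP; split; apply/hasPn => a.
      by rewrite !mem_iota /= -leqNgt; lia.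
    by rewrite -/P -/Q inP inQ; lia.
  by move=> a; rewrite mem_cat inP inQ mem_iota; lia.
have ss : size s = M by rewrite (perm_size sP) size_iota.
have s_lt i : (i < M)%N -> (nth 0%N s i < M)%N.
  move=> im; have : nth 0%N s i \in s by rewrite mem_nth ?ss.
  by rewrite (perm_mem sP) mem_iota.
have PQ a : a \in P -> a \in Q -> False by rewrite inP inQ; lia.
have ord i j : (i < j)%N -> (j < M)%N ->
    (nth 0%N s j \in P -> nth 0%N s i \in P) /\ (nth 0%N s i \in Q -> nth 0%N s j \in Q).
  have nE k : nth 0%N s k = if (k < size P)%N then nth 0%N P k else nth 0%N Q (k - size P).
    exact: nth_cat.
  move=> ij jM; rewrite !nE.
  case: (ltnP i (size P)) => iP; case: (ltnP j (size P)) => jP.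
  - by split=> [_|h]; [exact: (mem_nth 0%N iP)|case: (PQ _ (mem_nth 0%N iP) h)].
  - split=> [_|_]; first exact: (mem_nth 0%N iP).
    by apply: mem_nth; rewrite -(ltn_add2l (size P)) -size_cat -/s ss subnKC.
  - lia.
  - have Qj : nth 0%N Q (j - size P) \in Q.
      by apply: mem_nth; rewrite -(ltn_add2l (size P)) -size_cat -/s ss subnKC.
    by split=> [h|_] //; case: (PQ _ h Qj).
have PM a : a \in P -> (a < M)%N by rewrite inP; lia.
have QM a : a \in Q -> (a < M)%N by rewrite inQ; lia.
pose Phi y := [/\ allwt y, tail M y,
   forall p r, p \in P -> (M <= r)%N -> act (eij F p r) y = 0 &
   forall r q, (M <= r)%N -> q \in Q -> act (eij F r q) y = 0].
have Px : Phi x.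
  split=> //.
  - by move=> i j Mi Mj; apply: mx => //; lia.
  - move=> p r; rewrite inP => /orP[pn|/andP[mp pM]] Mr; first by apply: nx => //; lia.
    by apply: mx => //; lia.
  - by move=> r q Mr; rewrite inQ => /andP[nq qm]; apply: mnx => //; lia.
have [mu wmu] := wx M.
have wx' : wtT M s (fun i => mu (nth 0%N s i)) x.
  by move=> i im; have := wmu _ (s_lt i im); rewrite nth_iota// s_lt.
have [|y [nu [hy y0 [wy ty py qy]]]] := hwT_raise charF sP lL wx' x0 Px.
  move=> i j y ij jM [wy ty py qy]; have im := ltn_trans ij jM.
  have [oP oQ] := ord i j ij jM; have ai := s_lt i im; have bj := s_lt j jM.
  have ab : nth 0%N s i != nth 0%N s j.
    by rewrite nth_uniq ?ss// ?(perm_uniq sP) ?iota_uniq// (ltn_eqF ij).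
  move: (nth 0%N s i) (nth 0%N s j) oP oQ ai bj ab => a b oP oQ ai bj ab.
  rewrite (eijE charF ab ai bj); split.
  - exact: allwt_eij.
  - move=> k l Mk Ml kl; rewrite eij_comm ?ty ?act0r//; lia.
  - move=> p r pP Mr; have pM := PM p pP; have [pb|pb] := eqVneq p b.
      subst b; have pr : p != r by lia.
      have ar : a != r by lia.
      have := @eij_mul F charF L a p r y ab pr ar.
      by rewrite (py _ _ pP Mr) (py _ _ (oP pP) Mr) act0r addr0 => <-.
    by rewrite eij_comm ?py ?act0r//; lia.
  - move=> r q Mr qQ; have qM := QM q qQ; have [qa|qa] := eqVneq q a.
      by rewrite qa eij_mul -?qa ?qy ?act0r ?add0r ?qy ?oQ -?qa//; lia.
    by rewrite eij_comm ?qy ?act0r//; lia.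
by exists P, Q, M, y, nu; split.
Qed.

End Stages.

(** * Realization in the tensor algebra *)

Lemma mem_take_uniq (s : seq nat) k i : uniq s -> (i < size s)%N ->
  (nth 0%N s i \in take k s) = (i < k)%N.
Proof. by move=> us si; rewrite in_take ?mem_nth// index_uniq. Qed.

Lemma mem_drop_uniq (s : seq nat) k i : uniq s -> (i < size s)%N ->
  (nth 0%N s i \in drop k s) = (k <= i)%N.
Proof.
move=> us si; rewrite leqNgt -(mem_take_uniq k us si).
have := mem_nth 0%N si; rewrite -{2}(cat_take_drop k s) mem_cat.
move: us; rewrite -{1}(cat_take_drop k s) cat_uniq => /and3P[_ /hasPn h _].
have [/h/negPf /= -> //|_] := boolP (nth 0%N s i \in drop k s).
by rewrite orbF => ->.
Qed.

Section TensorRealization.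
Variables (F : closedFieldType) (charF : [pchar F] =i pred0).
Local Notation sl := (slInf F).
Local Notation W := (sumMod (Vinf F) (Vinf_dual F)).
Local Notation T := (tensorMod W).
Variables (L : lieModule sl) (lL : locfin L) (y : L) (y0 : y != 0).
Variables (P Q : seq nat) (m : nat) (mu : nat -> F).
Hypotheses (wy : allwt y) (PQm : perm_eq (P ++ Q) (iota 0 m)) (hy : hwT m (P ++ Q) mu y).
Hypothesis ty : tail m y.
Hypothesis Py : forall p r, p \in P -> (m <= r)%N -> act (eij F p r) y = 0.
Hypothesis Qy : forall r q, (m <= r)%N -> q \in Q -> act (eij F r q) y = 0.

Let p := size P.
Let q := size Q.
Let pq : (p + q = m)%N. Proof. by rewrite -size_cat (perm_size PQm) size_iota. Qed.
Let s M := P ++ iota m (M - m) ++ Q.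

Let s_perm M : (m <= M)%N -> perm_eq (s M) (iota 0 M).
Proof.
move=> mM; rewrite /s perm_catCA -(subnKC mM) iotaD perm_catC subnKC// perm_cat2r.
exact: PQm.
Qed.

Let s_size M : (m <= M)%N -> size (s M) = M.
Proof. by move=> mM; rewrite (perm_size (s_perm mM)) size_iota. Qed.

Let s_uniq M : (m <= M)%N -> uniq (s M).
Proof. by move=> mM; rewrite (perm_uniq (s_perm mM)) iota_uniq. Qed.

Let s_lt M i : (m <= M)%N -> (i < M)%N -> (nth 0%N (s M) i < M)%N.
Proof.
move=> mM iM; have : nth 0%N (s M) i \in s M by rewrite mem_nth ?s_size.
by rewrite (perm_mem (s_perm mM)) mem_iota.
Qed.

Let sP M i : (i < p)%N -> nth 0%N (s M) i = nth 0%N P i.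
Proof. by move=> ip; rewrite /s nth_cat ip. Qed.

Let smid M i : (p <= i)%N -> (i < p + (M - m))%N -> nth 0%N (s M) i = (m + (i - p))%N.
Proof.
move=> pi ip; rewrite /s nth_cat ltnNge -/p pi /= nth_cat size_iota.
have lt : (i - p < M - m)%N by lia.
by rewrite lt nth_iota.
Qed.

Let sQ M i : (p + (M - m) <= i)%N -> nth 0%N (s M) i = nth 0%N Q (i - (p + (M - m))).
Proof.
move=> pi; rewrite /s nth_cat ltnNge -/p (leq_trans _ pi) ?leq_addr//= nth_cat size_iota.
have -> : (i - p < M - m)%N = false by lia.
by rewrite subnDA.
Qed.

Let om M : nat -> F := projT1 (cid (wy M)).

Let omE M a : (a < M)%N -> act (el F M a a : sl) y = om M a *: y.
Proof.
by rewrite /om; case: (cid (wy M)) => /= lam wl aM; have := wl a aM; rewrite nth_iota.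
Qed.

Let scaleyI (a b : F) : a *: y = b *: y -> a = b.
Proof.
move=> /eqP; rewrite -subr_eq0 -scalerBl scaler_eq0 (negPf y0) orbF subr_eq0.
by move/eqP.
Qed.

(** A change of level shifts all weights by one constant, so weights can be compared through their
    differences. *)
Let om_diff M M' a b : (M <= M')%N -> (a < M)%N -> (b < M)%N ->
  om M a - om M b = om M' a - om M' b.
Proof.
move=> MM aM bM.
suff [K KE] : exists K, forall c, (c < M)%N -> om M c = om M' c - K.
  by rewrite !KE// opprD opprK addrACA addNr addr0.
exists (M%:R^-1 * \sum_(c < M) om M' c) => c cM.
apply: scaleyI; rewrite -omE// (el_level charF cM cM MM) eqxx mul1r.
rewrite -scaleNr addrC actDl act_suml (omE (leq_trans cM MM)).
rewrite (eq_bigr (fun i : 'I_M => om M' i *: y)); last first.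
  by move=> i _; apply: omE; exact: leq_trans (ltn_ord i) MM.
by rewrite -scaler_suml scalerA -scalerDl mulNr addrC.
Qed.

(** Both e_ab and e_ba kill [y], hence so does their commutator, the difference of the two diagonal
    units. *)
Let om_mid M a b : (m <= a)%N -> (m <= b)%N -> (a < M)%N -> (b < M)%N -> om M a = om M b.
Proof.
move=> ma mb aM bM; have [->//|ab] := eqVneq a b.
apply/eqP; rewrite -subr_eq0; apply/eqP; apply: scaleyI; rewrite scale0r scalerBl -!omE//.
have := @bracket_el F charF M a b b a bM aM; rewrite !eqxx => h.
rewrite -[X in X - _]scale1r -[X in _ - X]scale1r -act_lin2 -h act_bracket.
have ba : b != a by rewrite eq_sym.
rewrite (eijE charF ab aM bM) (eijE charF ba bM aM).
by rewrite (ty ma mb ab) (ty mb ma ba) !act0r subrr.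
Qed.

Let s_hw M : (m <= M)%N -> hwT M (s M) (fun i => om M (nth 0%N (s M) i)) y.
Proof.
move=> mM; split=> [i iM|i j ij jM]; first by apply: omE; exact: s_lt.
have iM := ltn_trans ij jM; have ai := s_lt mM iM; have bj := s_lt mM jM.
have ab : nth 0%N (s M) i != nth 0%N (s M) j.
  by rewrite nth_uniq ?s_size ?s_uniq// (ltn_eqF ij).
rewrite (eijE charF ab ai bj).
have PQ_size : size (P ++ Q) = m by rewrite size_cat.
have PQ_lt k : (k < m)%N -> (nth 0%N (P ++ Q) k < m)%N.
  move=> km; have : nth 0%N (P ++ Q) k \in P ++ Q by rewrite mem_nth ?PQ_size.
  by rewrite (perm_mem PQm) mem_iota.
have PQ0 k l : (k < l)%N -> (l < m)%N ->
    act (eij F (nth 0%N (P ++ Q) k) (nth 0%N (P ++ Q) l)) y = 0.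
  move=> kl lm; have km := ltn_trans kl lm; rewrite -(@eijE F charF m) ?PQ_lt//; first exact: hy.2.
  by rewrite nth_uniq ?PQ_size ?(perm_uniq PQm) ?iota_uniq// (ltn_eqF kl).
have [ip|pi] := ltnP i p.
  have iE : nth 0%N (s M) i = nth 0%N (P ++ Q) i by rewrite sP// nth_cat ip.
  have [jp|pj] := ltnP j p.
    have -> : nth 0%N (s M) j = nth 0%N (P ++ Q) j by rewrite sP// nth_cat jp.
    by rewrite iE PQ0//; lia.
  have [jm|mj] := ltnP j (p + (M - m)).
    by rewrite (smid pj jm) Py ?leq_addr// sP// mem_nth.
  have -> : nth 0%N (s M) j = nth 0%N (P ++ Q) (j - (M - m)).
    rewrite sQ// nth_cat -/p; have -> : (j - (M - m) < p)%N = false by lia.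
    by congr nth; lia.
  by rewrite iE PQ0//; lia.
have [jm|mj] := ltnP j (p + (M - m)).
  rewrite (smid (leq_trans pi (ltnW ij)) jm) (smid pi (ltn_trans ij jm)).
  by apply: ty; rewrite ?leq_addr//; lia.
have jQ : nth 0%N (s M) j \in Q by rewrite sQ// mem_nth// -/q; lia.
have [im|mi] := ltnP i (p + (M - m)).
  by rewrite (smid pi im) Qy// leq_addr.
have H k : (p + (M - m) <= k)%N -> nth 0%N (s M) k = nth 0%N (P ++ Q) (k - (M - m)).
  move=> pk; rewrite sQ// nth_cat -/p; have -> : (k - (M - m) < p)%N = false by lia.
  by congr nth; lia.
by rewrite !H// PQ0//; lia.
Qed.

Let s_dom M i j : (m <= M)%N -> (i < j)%N -> (j < M)%N ->
  exists n : nat, om M (nth 0%N (s M) i) - om M (nth 0%N (s M) j) = n%:R.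
Proof. by move=> mM; exact: (hwT_dominant charF (s_perm mM) lL (s_hw mM) y0). Qed.

Let mS : (m <= m.+1)%N := leqnSn m.
Let s_p : nth 0%N (s m.+1) p = m.
Proof. by rewrite smid// ?subnn ?addn0// subSnn addn1. Qed.

(** Weights are measured from the index [m], the first one outside [P] and [Q], at the smallest
    level that contains it; by [om_diff] the columns then serve every level. *)
Let columns_P : exists cs, all (fun c => c <= p)%N cs /\ forall i, (i < p)%N ->
  om m.+1 (nth 0%N P i) - om m.+1 m = (count (fun c => i < c)%N cs)%:R.
Proof.
have /choice[f fE] : forall i, exists n : nat, (i < p)%N -> om m.+1 (nth 0%N P i) - om m.+1 m = n%:R.
  move=> i; have [ip|] := ltnP i p; last by exists 0%N.
  have [|n nE] := s_dom mS ip; first by rewrite ltnS -pq leq_addr.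
  by exists n => _; rewrite -nE s_p sP.
have [|cs [csp fcs]] := @dec_columns p f.
  move=> i j ij jp; have [|n] := s_dom mS ij; first by rewrite ltnS; lia.
  rewrite !sP//; last exact: ltn_trans jp.
  move=> nE; have : (f i)%:R = (f j + n)%:R :> F.
    by rewrite natrD -nE -!fE// ?(ltn_trans ij)// [RHS]addrC addrA subrK.
  by move/(natF_inj charF) => ->; exact: leq_addr.
by exists cs; split=> // i ip; rewrite fE// fcs.
Qed.

(** [Q] is read backwards, because columns of dual vectors are final segments. *)
Let columns_Q : exists ds, all (fun d => d <= q)%N ds /\ forall i, (i < q)%N ->
  om m.+1 m - om m.+1 (nth 0%N Q (q - i.+1)) = (count (fun d => i < d)%N ds)%:R.
Proof.
have sQ' i : (i < q)%N -> nth 0%N (s m.+1) (m - i) = nth 0%N Q (q - i.+1).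
  move=> iq; rewrite sQ; last by lia.
  by congr nth; lia.
have /choice[f fE] : forall i, exists n : nat, (i < q)%N -> om m.+1 m - om m.+1 (nth 0%N Q (q - i.+1)) = n%:R.
  move=> i; have [iq|] := ltnP i q; last by exists 0%N.
  have [||n nE] := @s_dom m.+1 p (m - i) mS; try by lia.
  by exists n => _; rewrite -nE s_p sQ'.
have [|ds [dsq fds]] := @dec_columns q f.
  move=> i j ij jq; have [||n] := @s_dom m.+1 (m - j) (m - i) mS; try by lia.
  rewrite !sQ'//; last exact: ltn_trans jq.
  move=> nE; have : (f j + n)%:R = (f i)%:R :> F.
    rewrite natrD -nE -!fE// ?(ltn_trans ij)//.
    by rewrite addrA subrK.
  by move/(natF_inj charF) => e; rewrite -e leq_addr.
by exists ds; split=> // i iq; rewrite fE// fds.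
Qed.

Lemma realize : exists tau : T, tau != 0 /\
  forall t, term_act t y = 0 <-> term_act t tau = 0.
Proof.
have [cs [csp csE]] := columns_P; have [ds [dsq dsE]] := columns_Q.
pose ls := [seq take c P | c <- cs]; pose ks := [seq drop (q - d) Q | d <- ds].
have [uP uQ] : uniq P /\ uniq Q.
  by have := perm_uniq PQm; rewrite iota_uniq cat_uniq => /and3P[].
have uls : {in ls, forall l, uniq l} by move=> l /mapP[c _ ->]; exact: take_uniq.
have uks : {in ks, forall l, uniq l} by move=> l /mapP[c _ ->]; exact: drop_uniq.
exists (tensor_vec F ls ks : T); split; first exact: tensor_vec_neq0.
move=> t; have [n tn] := level_ex t; pose M := maxn m.+1 n.
have mM : (m < M)%N by exact: leq_maxl.
have mM' := ltnW mM; have tM : level M t by apply: level_le tn; exact: leq_maxr.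
have [sz us] := (s_size mM', s_uniq mM').
have mem_l c i : c \in cs -> (i < M)%N -> (nth 0%N (s M) i \in take c P) = (i < c)%N.
  move=> /(allP csp) cp iM; rewrite -(takel_cat (iota m (M - m) ++ Q) cp).
  by rewrite mem_take_uniq ?sz.
have mem_k d i : d \in ds -> (i < M)%N -> (nth 0%N (s M) i \in drop (q - d) Q) = (M - d <= i)%N.
  move=> /(allP dsq) dq iM.
  have -> : drop (q - d) Q = drop (M - d) (s M).
    rewrite /s catA drop_cat size_cat size_iota -/p ltnNge.
    have -> : (p + (M - m) <= M - d)%N by lia.
    by rewrite /=; congr drop; lia.
  by rewrite mem_drop_uniq ?sz.
have hT : hwT M (s M) (fun i => tvwt F M ls ks (nth 0%N (s M) i)) (tensor_vec F ls ks : T).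
  apply: tensor_vec_hw; [exact: charF|exact: s_perm| |].
    move=> l lls; split; first exact: uls.
    move=> i j ij jM; have [c cc ->] := mapP lls; have iM := ltn_trans ij jM.
    by rewrite !mem_l//; exact: ltn_trans.
  move=> l lls; split; first exact: uks.
  move=> i j ij jM; have [d dd ->] := mapP lls; have iM := ltn_trans ij jM.
  by rewrite !mem_k// => h; exact: leq_trans (ltnW ij).
(* The weights of [y] and of the tensor vector have the same differences to index [m], so they
   differ by this constant; since both have sum 0 over the indices below [M], it vanishes. *)
pose K := om M m + \sum_(l <- ls) (count (fun c => c < M)%N l)%:R / M%:R -
  \sum_(l <- ks) (count (fun c => c < M)%N l)%:R / M%:R.
have omK i : (i < M)%N -> om M (nth 0%N (s M) i) = tvwt F M ls ks (nth 0%N (s M) i) + K.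
  move=> iM; rewrite /tvwt /colwt !sumrB.
  have -> : \sum_(l <- ls) (nth 0%N (s M) i \in l)%:R = (count (fun c => i < c)%N cs)%:R :> F.
    by rewrite big_map -sum_count; apply: eq_big_seq => c cc; rewrite mem_l.
  have -> : \sum_(l <- ks) (nth 0%N (s M) i \in l)%:R = (count (fun d => M - d <= i)%N ds)%:R :> F.
    by rewrite big_map -sum_count; apply: eq_big_seq => d dd; rewrite mem_k.
  (* The three ranges of positions: in [P] only [cs] counts, in the middle neither list does, and in
     [Q] only [ds]. *)
  have E : om M (nth 0%N (s M) i) - om M m =
      (count (fun c => i < c)%N cs)%:R - (count (fun d => M - d <= i)%N ds)%:R.
    have ds0 : (i < p + (M - m))%N -> count (fun d => M - d <= i)%N ds = 0%N.
      move=> ip; rewrite (eq_in_count (a2 := pred0)) ?count_pred0// => d /(allP dsq) dq /=.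
      by apply/negbTE; rewrite -ltnNge; lia.
    have cs0 : (p <= i)%N -> count (fun c => i < c)%N cs = 0%N.
      move=> ip; rewrite (eq_in_count (a2 := pred0)) ?count_pred0// => c /(allP csp) cp /=.
      by apply/negbTE; rewrite -leqNgt; lia.
    have [ip|pi] := ltnP i p.
      rewrite ds0 ?subr0; last by lia.
      rewrite -csE// sP//; apply/esym/om_diff => //.
      have := @s_lt m i (leqnn m); rewrite sP// => h.
      by apply: (leq_trans (h _)) => //; lia.
    rewrite cs0// sub0r; have [im|mi] := ltnP i (p + (M - m)).
      rewrite ds0// oppr0 smid//; apply/eqP; rewrite subr_eq0; apply/eqP.
      by apply: om_mid => //; rewrite ?leq_addr//; lia.
    have iq : (M - i.+1 < q)%N by lia.
    have -> : count (fun d => M - d <= i)%N ds = count (fun d => M - i.+1 < d)%N ds.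
      by apply: eq_in_count => d /(allP dsq) dq /=; apply/idP/idP; lia.
    rewrite -dsE// opprB; have -> : nth 0%N (s M) i = nth 0%N Q (q - (M - i.+1).+1).
      by rewrite sQ//; congr nth; lia.
    apply/esym/om_diff => //.
    have := @s_lt m (p + (q - (M - i.+1).+1)) (leqnn m).
    rewrite sQ; last by lia.
    by rewrite subnn addn0 addKn => h; apply: (leq_trans (h _)) => //; lia.
  have -> : om M (nth 0%N (s M) i) = om M (nth 0%N (s M) i) - om M m + om M m by rewrite subrK.
  rewrite E /K.
  move: (\sum_(_ <- _) _) (\sum_(_ <- _) _) (_%:R) (_%:R) (om M m) => a b c d e.
  by ring.
have M0 : (0 < M)%N by exact: leq_ltn_trans mM.
have K0 : K = 0.
  apply: (const_sum0 charF M0).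
  have := wtT_sum charF (s_perm mM') lL (s_hw mM').1 y0.
  rewrite (eq_bigr _ (fun (i : 'I_M) _ => omK i (ltn_ord i))) big_split /=.
  rewrite (wtT_sum charF (s_perm mM') (@locfin_T F) hT.1) ?add0r//.
  exact: tensor_vec_neq0.
apply: (hwT_ann charF (s_perm mM') lL (@locfin_T F) _ hT y0) => //.
  by apply: hwT_ext (s_hw mM') => i iM; rewrite omK// K0 addr0.
exact: tensor_vec_neq0.
Qed.

End TensorRealization.

Theorem proposition5p9 (F : closedFieldType) (charF : [pchar F] =i pred0)
    (M : lieModule (slInf F)) (simpleM : mod_simple M)
    (detM : determined_by_ann M) (intM : integrable_ideal (ann M)) :
  exists N : lieModule (slInf F), is_simple_tensor_module N /\ mod_iso M N.
Proof.
have [N [intN annN]] := intM.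
have MN t : kills t M <-> kills t N by rewrite /kills !ann_term annN.
have [L [u [lev [sL LM lL [cu u0 wu levS su]]]]] :=
  model_exists charF simpleM (locfin_integrable charF intN) MN.
(* [L] is itself isomorphic to [M], hence also determined by its annihilator. *)
have detL L' : mod_simple L' -> (forall t, kills t L' <-> kills t L) -> mod_iso L' L.
  move=> sL' L'L; apply: (@mod_iso_trans _ _ _ M).
    by apply: detM => //; apply: ann_eq => t; rewrite -[X in X <-> _]/(kills t L') L'L LM.
  by apply/mod_iso_sym/detM => //; apply: ann_eq => t; exact: LM.
have [n tu] := tail_vanish charF cu u0 wu levS su detL.
have [P [Q [m [y [mu [y0 wy PQ hy [ty Py Qy]]]]]]] := structure charF lL u0 wu tu.
have [tau [tau0 ytau]] := realize charF lL y0 wy PQ hy ty Py Qy.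
have [|sS annS] := same_ann_simple sL y0 (@gen_vec_cyclic _ _ _ tau).
  by move=> t; rewrite ytau gen_vec_kill.
have annL : ann L = ann M by apply: ann_eq => t; exact: LM.
exists M; split; last exact: mod_iso_refl.
exists (genS tau); split=> //; apply/mod_iso_sym/detM => //.
by rewrite annS annL.
Qed.
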